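(* Let $n\ge 1$ and $x\ge 0$ be integers. The number of centered vertically symmetric rhombus tilings of a $(2n,2x+1,2n)$ hexagon equals $R(n,x)\cdot ST(2n,2x+1,2n)$.
   Context: For positive integers $a,b,c$, an $(a,b,c)$ hexagon is the equi-angular hexagon (on the triangular lattice) with side lengths $a,b,c,a,b,c$ in clockwise order starting from the southwestern side, so that the sides of length $b$ are vertical. A rhombus tiling is a tiling of the hexagon by unit rhombi with angles $60^\circ$ and $120^\circ$. A tiling is vertically symmetric if it is invariant under reflection in the vertical symmetry axis of the hexagon. When $a$ and $b$ have opposite parity, an $(a,b,a)$ hexagon has a central rhombus (the unit rhombus centered at the center of the hexagon); a tiling is centered if it contains it. Notation: $(a)_k=a(a+1)\cdots(a+k-1)$, $(a)_0=1$; $m!!$ is the double factorial ($(2n)!!=2^n n!$, $(2n-1)!!=1\cdot3\cdots(2n-1)$); $ST(a,b,a)=\prod_{i=1}^a\frac{2i+b-1}{2i-1}\prod_{1\le i<j\le a}\frac{i+j+b-1}{i+j-1}$; for a positive integer $n$ and nonnegative integer $x$, $U_n(x)=\sum_{i=1}^n\big((2n-1)!!+(-1)^{i+1}(2n)!!\big)\frac{(\frac32-i)_{2n-1}}{(i-1)!(2n-i)!}\big((x+1)_{i-1}(x+i+1)_{2n-i}-(x+1)_{2n-i}(x+2n+2-i)_{i-1}\big)$ and $R(n,x)=2^{3n-2}\frac{(2x+2)!\,(x+2n)!}{n!\,(x+1)!\,(2x+4n)!}U_n(x)$. *)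

(* Defs.v *)
From HB Require Import structures.
From mathcomp Require Import all_boot all_order all_algebra.
Set Implicit Arguments. Unset Strict Implicit. Unset Printing Implicit Defensive.
Import Order.TTheory GRing.Theory Num.Theory.

(* ---------- Triangular lattice coordinates ----------
   Lattice points are (k*sqrt3/2, h/2) with k, h integers, k = h mod 2
   (vertical lattice lines are the columns k).  The unit triangles between
   columns k and k+1 ("strip k") are indexed by an integer m: the triangle
   (k,m) has its vertical side on one of the two columns, spanning heights
   [m-1, m+1], and its apex on the other column at height m.  It points
   right (vertical side on column k) iff k+m is odd, left (vertical side on
   column k+1) iff k+m is even.
   The (a,b,c) hexagon is placed with vertices (0,0),(0,2b),(c,2b+c),
   (a+c,2b+c-a),(a+c,c-a),(a,-a): sides SW=a, W=b (vertical), NW=c,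
   NE=a, E=b (vertical), SE=c, clockwise from the SW side.
   Heights are shifted by +2a so that they are natural numbers. *)

Definition tri (a b c : nat) : finType :=
  ('I_(a + c) * 'I_(2 * (a + b + c) + 1))%type.

Definition hlow (a : nat) (x : nat) : nat := maxn (2 * a - x) x.
Definition hup (a b c : nat) (x : nat) : nat :=
  minn (2 * a + 2 * b + x) (2 * a + 2 * b + 2 * c - x).

(* the unit triangle t lies in the (a,b,c) hexagon: all three vertices are
   between the lower and upper boundary *)
Definition in_hex (a b c : nat) (t : tri a b c) : bool :=
  let k := val t.1 in let m := val t.2 in
  let s := if odd (k + m) then k else k.+1 in   (* column of vertical side *)
  let ap := if odd (k + m) then k.+1 else k in  (* column of apex *)
  [&& hlow a s < m, hlow a ap <= m, m.+1 <= hup a b c s & m <= hup a b c ap].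

Definition region (a b c : nat) : {set tri a b c} := [set t | in_hex t].

Definition adj (a b c : nat) (t u : tri a b c) : bool :=
  let k1 := val t.1 in let m1 := val t.2 in
  let k2 := val u.1 in let m2 := val u.2 in
  ((k1 == k2) && ((m1.+1 == m2) || (m2.+1 == m1))) ||
  ((m1 == m2) && ((~~ odd (k1 + m1) && (k1.+1 == k2)) ||
                  (~~ odd (k2 + m2) && (k2.+1 == k1)))).

Definition is_rhombus (a b c : nat) (B : {set tri a b c}) : bool :=
  [exists t, exists u, adj t u && (B == [set t; u])].

Definition is_tiling (a b c : nat) (P : {set {set tri a b c}}) : bool :=
  partition P (region a b c) && [forall B in P, is_rhombus B].

Definition refl (a b : nat) (t : tri a b a) : tri a b a := (rev_ord t.1, t.2).

Definition vsym (a b : nat) (P : {set {set tri a b a}}) : bool :=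
  [set (@refl a b) @: (B : {set tri a b a}) | B in P] == P.

(* the central unit rhombus of the (a,b,a) hexagon (a, b of opposite parity):
   the two triangles sharing the vertical edge on column a with midpoint at
   the centre (a, b) of the hexagon *)
Definition central (a b : nat) : {set tri a b a} :=
  [set t : tri a b a |
     ((val t.1 == a.-1) || (val t.1 == a)) && (val t.2 == b + 2 * a)].

Definition centered (a b : nat) (P : {set {set tri a b a}}) : bool :=
  central a b \in P.

Definition num_cvs_tilings (a b : nat) : nat :=
  #|[set P : {set {set tri a b a}} | [&& is_tiling P, vsym P & centered P]]|.

Local Open Scope ring_scope.

Definition poch (x : rat) (k : nat) : rat := \prod_(j < k) (x + j%:R).

Fixpoint dfact (m : nat) : nat :=
  match m with
  | 0 => 1
  | 1 => 1
  | (p.+2) as q => (q * dfact p)%N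
  end.

Definition ST (a b : nat) : rat :=
  (\prod_(1 <= i < a.+1) ((2 * i + b - 1)%N%:R / (2 * i - 1)%N%:R)) *
  (\prod_(1 <= j < a.+1) \prod_(1 <= i < j)
      ((i + j + b - 1)%N%:R / (i + j - 1)%N%:R)).

Definition U (n x : nat) : rat :=
  \sum_(1 <= i < n.+1)
    (((dfact (2 * n - 1))%N%:R + (-1) ^+ i.+1 * (dfact (2 * n))%N%:R) *
     poch (3%:R / 2%:R - i%:R) (2 * n - 1)%N /
     (((i - 1)`!)%N%:R * ((2 * n - i)`!)%N%:R) *
     (poch (x.+1)%:R (i - 1)%N * poch (x + i + 1)%N%:R (2 * n - i)%N -
      poch (x.+1)%:R (2 * n - i) * poch (x + 2 * n + 2 - i)%N%:R (i - 1)%N)).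

Definition R (n x : nat) : rat :=
  (2 ^ (3 * n - 2))%N%:R * ((2 * x + 2)`!)%N%:R * ((x + 2 * n)`!)%N%:R /
  ((n`!)%:R * ((x + 1)`!)%N%:R * ((2 * x + 4 * n)`!)%N%:R) * U n x.

(* Main.v *)
(** A vertically symmetric tiling is determined by its left half. Recording, on
    each vertical lattice line, the positions of the rhombi crossing that line
    turns the left half into a chain of interlacing sets from the empty set to
    the set S of crossings of the axis, and the tiling is centered iff S
    contains the middle position. Peeling off one strip at a time shows that the
    number of chains ending in S is the determinant of the binomial coefficients
    'C(p, i), p in S, i < |S|.

    To sum these determinants over S, write them as products of the linear forms
    v_p = sum_i 'C(p, i) eta_i in anticommuting variables; the generating function
    prod_p (1 + v_p X) of all subsets is (1 + L X) exp(Omega X^2) with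
    L = sum_p v_p and Omega = sum_(p < q) v_p v_q. After replacing 'C(p, i) by
    polynomials that are even or odd about the middle position, the resulting
    Pfaffian becomes an n x n determinant pairing even with odd polynomials.
    Even discrete Chebyshev polynomials P_k make it bidiagonal, which gives ST.
    Deleting the middle position changes one row only, and the proportion of
    centered tilings is sum_(k < n) t_k (1 - b_k / b_n), where 1 / t_k is the
    squared norm of P_k and b_k / b_n is explicit.

    With denominators cleared this proportion is a polynomial in x of degree
    less than 2n, and so is U_n. Both are invariant under x |-> -x - 2n - 1 on
    x = -1, ..., -2n, and explicit at x = -1, ..., -n, where the sums of t_k and of
    t_k b_k telescope to 1 and to a sign. *)
Require Import Defs.
From HB Require Import structures.
From mathcomp Require Import all_boot all_order all_algebra.
From mathcomp Require Import fingroup perm.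
From mathcomp Require Import zify ring lra.
Import Order.TTheory GRing.Theory Num.Theory.
Local Open Scope ring_scope.

Set Implicit Arguments. Unset Strict Implicit. Unset Printing Implicit Defensive.

(** Summing maximal minors over all subsets normally gives a Pfaffian; in an algebra of
    anticommuting elements, powers of one even element take over the role of Pfaffian theory. The
    axis has N = 2n + 2x + 1 = 2M + 1 positions with M = n + x, and s = p - M puts the middle at s =
    0. Every even basis polynomial except the constant vanishes there, which is why a single row
    feels the deletion. The norms are rational functions of N, so negative x makes sense. For x = q
    - n with 0 <= q < n, N becomes 2q + 1, the terms with k > q vanish, and the remaining sums run
    over a complete orthogonal system of even functions on {-q, ..., q}. Behind the two telescoping
    sums stand two evaluations. The sum of t_k is the reproducing kernel at 0, hence 1. The number
    b_k is the value at P_k of the functional f |-> H(M), where H is the polynomial with H(s) + H(s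
    - 1) = 2 f(s) and H(-s - 1) = H(s); when f is 1 at 0 and 0 elsewhere on {-q, ..., q}, H
    alternates between 1 and -1, which gives the sign. *)

Notation bits N := {ffun 'I_N -> bool}.

Section Combinatorics.
Local Open Scope nat_scope.

(** * Interlacing sets *)

Definition bit_at N (S : bits N) (p : nat) : bool := oapp S false (insub p).

Lemma bit_atE N (S : bits N) (i : 'I_N) : bit_at S i = S i.
Proof. by rewrite /bit_at valK. Qed.

Lemma bit_at_ge N (S : bits N) p : (N <= p)%N -> bit_at S p = false.
Proof. by move=> h; rewrite /bit_at insubF // ltnNge h. Qed.

(* [s] and [b] tell whether [p] belongs to S and to S'. The level at [p] is the
   number of elements of S below [p] minus that of S'; interlacing confines it to
   {0, 1}, and [None] records a violation. *)
Definition level_step (s b : bool) (e : bool) : option bool :=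
  if e && s || b && ~~ (e || s) then None else Some ((e || s) && ~~ b).

Fixpoint level_run (s f : nat -> bool) n : option bool :=
  if n is p.+1 then obind (level_step (s p) (f p)) (level_run s f p) else Some false.

(** With S = {s_1 < ... < s_(r+1)} and S' = {b_1 < ... < b_r} the condition reads s_i <= b_i <
    s_(i+1). The asymmetry reflects the numbering: position p of a vertical line lies half a unit
    below position p of the next line away from the axis. *)
Definition interlacing N (S S' : bits N) := level_run (bit_at S) (bit_at S') N == Some true.

(* [pattern_count a S] counts the left halves of the tilings in which the rhombi
   crossing the axis sit at the positions in [S]. *)
Fixpoint pattern_count N k (S : bits N) : nat :=
  if k is k'.+1 then \sum_(S' : bits N | interlacing S S') pattern_count k' S'
  else S == [ffun=> false].

Definition weight N (S : bits N) := #|[pred p | S p]|.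

Lemma weightE N (S : bits N) : weight S = (\sum_(p < N) bit_at S p)%N.
Proof.
by rewrite /weight -sum1_card big_mkcond; apply: eq_bigr => p _; rewrite bit_atE inE; case: (S p).
Qed.

Lemma level_run_count s f n e : level_run s f n = Some e ->
  (\sum_(p < n) s p = \sum_(p < n) f p + e)%N.
Proof.
elim: n e => [|n IH] e /=; first by move=> [<-]; rewrite !big_ord0.
case: (level_run s f n) IH => //= e' /(_ _ erefl) IH; rewrite !big_ord_recr /= IH /level_step.
by case: e' {IH}; case: (s n); case: (f n) => //= -[<-]; rewrite ?addn0 ?addn1 ?addnS ?addn0.
Qed.

Lemma interlacing_weight N (S S' : bits N) : interlacing S S' -> weight S = (weight S').+1.
Proof. by move=> /eqP/level_run_count; rewrite !weightE addn1. Qed.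

Lemma weight0 N (S : bits N) : (weight S == 0) = (S == [ffun=> false]).
Proof.
apply/idP/eqP => [/eqP/card0_eq h|->].
  by apply/ffunP => p; have := h p; rewrite ffunE inE.
by apply/eqP/eq_card0 => p; rewrite inE ffunE.
Qed.

Lemma pattern_count_weight N k (S : bits N) : weight S != k -> pattern_count k S = 0.
Proof.
elim: k S => [|k IH] S /=; first by rewrite weight0 => /negbTE->.
move=> h; rewrite big1 // => S' /interlacing_weight e; apply: IH.
by apply: contra h; rewrite e eqSS.
Qed.

(** * Tilings as fixpoint-free involutions *)

Section Matching.
Variables a b c : nat.
Implicit Types (t u : tri a b c) (P : {set {set tri a b c}}).

Lemma adj_sym t u : adj t u = adj u t.
Proof. by rewrite /adj; lia. Qed.

Lemma adj_irr t : adj t t = false.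
Proof. by rewrite /adj; lia. Qed.

Lemma set2_eqr (T : finType) (x y z : T) : x != y -> [set x; y] = [set x; z] -> y = z.
Proof.
move=> xy e; have := set22 x y; rewrite e !inE => /orP[/eqP yx|/eqP//].
by rewrite yx eqxx in xy.
Qed.

Lemma tiling_mate P t : is_tiling P -> t \in region a b c ->
  exists u, [/\ u \in region a b c, adj t u, [set t; u] \in P &
             forall u', [set t; u'] \in P -> u' = u].
Proof.
move=> /andP[hP /forallP hR] ht.
have := ht; rewrite -(cover_partition hP) => tc.
have triv : trivIset P by case/and3P: hP.
have BP := pblock_mem tc.
have := hR (pblock P t); rewrite BP => /existsP[x /existsP[y /andP[xy /eqP e]]].
have tB : t \in pblock P t by rewrite mem_pblock.
have [u [tu e']] : exists u, adj t u /\ pblock P t = [set t; u].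
  move: tB; rewrite e !inE => /orP[/eqP->|/eqP->]; first by exists y.
  by exists x; rewrite adj_sym xy setUC.
have nt : t != u by apply: contraTneq tu => ->; rewrite adj_irr.
exists u; split=> //; last first.
- move=> u' hu'; have e2 := def_pblock triv hu' (set21 t u').
  by apply/esym; apply: (@set2_eqr _ t) => //; rewrite -e' e2.
- by rewrite -e'.
by apply/bigcupP; exists (pblock P t) => //; rewrite e' set22.
Qed.

Variable mate : tri a b c -> tri a b c.
Hypothesis mate_in : forall t, t \in region a b c -> mate t \in region a b c.
Hypothesis mate_adj : forall t, t \in region a b c -> adj t (mate t).
Hypothesis mateK : forall t, t \in region a b c -> mate (mate t) = t.

Definition tiling_of := [set [set t; mate t] | t in region a b c].

Lemma mem_tiling_of t u : t \in region a b c -> ([set t; u] \in tiling_of) = (u == mate t).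
Proof.
move=> ht; apply/imsetP/eqP => [[x hx e]|->]; last by exists t.
have nx : t != mate t by apply: contraTneq (mate_adj ht) => <-; rewrite adj_irr.
have : t \in [set x; mate x] by rewrite -e set21.
rewrite !inE => /orP[/eqP tx|/eqP tx].
  by apply/esym; apply: (@set2_eqr _ t) => //; rewrite e tx.
by apply/esym; apply: (@set2_eqr _ t) => //; rewrite e tx mateK // setUC.
Qed.

Lemma is_tiling_of : is_tiling tiling_of.
Proof.
apply/andP; split; last first.
  apply/forallP => B; apply/implyP => /imsetP[t ht ->].
  by apply/existsP; exists t; apply/existsP; exists (mate t); rewrite mate_adj // eqxx.
apply/and3P; split.
- rewrite eqEsubset; apply/andP; split; apply/subsetP => t.
    by move=> /bigcupP[B /imsetP[x hx ->]]; rewrite !inE -!(in_set (@in_hex a b c)) => /orP[/eqP->|/eqP->]; rewrite ?mate_in.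
  by move=> ht; apply/bigcupP; exists [set t; mate t]; rewrite ?set21 //; apply/imsetP; exists t.
- apply/trivIsetP => A B /imsetP[x hx ->] /imsetP[y hy ->] nAB.
  rewrite -setI_eq0; apply: contraR nAB => /set0Pn[z]; rewrite !inE.
  move=> /andP[/orP[]/eqP-> /orP[]/eqP e]; rewrite ?e //.
  - by rewrite mateK // setUC.
  - by rewrite -e mateK // setUC.
  - by rewrite -(mateK hx) e mateK.
- by apply/imsetP => -[t ht] /setP/(_ t); rewrite !inE eqxx.
Qed.

Lemma tiling_ofE P : is_tiling P -> (forall t, t \in region a b c -> [set t; mate t] \in P) ->
  P = tiling_of.
Proof.
move=> hP hm; apply/setP => B; apply/idP/imsetP => [BP|[t ht ->]]; last exact: hm.
have /andP[hp /forallP/(_ B)] := hP; rewrite BP => /existsP[x /existsP[y /andP[xy /eqP e]]].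
have hx : x \in region a b c.
  by rewrite -(cover_partition hp); apply/bigcupP; exists B => //; rewrite e set21.
exists x => //; rewrite e; have [u [_ _ _ hu]] := tiling_mate hP hx.
by rewrite (hu _ (hm _ hx)) (hu y) // -e.
Qed.
End Matching.

(** * Coordinates folded along the symmetry axis *)

Section Coords.
Variables a b : nat.
Hypothesis a_gt0 : 0 < a.
Local Notation T := (tri a b a).

Lemma columns_gt0 : 0 < a + a. Proof. lia. Qed.

Lemma heights_gt0 : 0 < 2 * (a + b + a) + 1. Proof. lia. Qed.

Definition mk_tri (k m : nat) : T := (insubd (Ordinal columns_gt0) k, insubd (Ordinal heights_gt0) m).

Lemma mk_tri1 k m : k < a + a -> val (mk_tri k m).1 = k.
Proof. by move=> h; rewrite val_insubd h. Qed.

Lemma mk_tri2 k m : m < 2 * (a + b + a) + 1 -> val (mk_tri k m).2 = m.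
Proof. by move=> h; rewrite val_insubd h. Qed.

Definition folded_strip (t : T) : nat := if val t.1 < a then val t.1 else (2 * a).-1 - val t.1.
Definition offset (t : T) : nat := val t.2 - (2 * a - folded_strip t).

(* [side] is the half of the hexagon containing the triangle, [strip] its strip
   counted from the nearer vertical side, and [2 * pos + par] its rank from the
   bottom in that strip. Triangles of consecutive ranks are adjacent; those with
   [par = false] have their vertical side towards the axis. *)
Record cell := Cell { side : bool; strip : nat; pos : nat; par : bool }.

Definition valid (x : cell) := (strip x < a) && ((pos x).*2 + par x <= (b + strip x).*2).

Definition cell_of (t : T) : cell := Cell (a <= val t.1) (folded_strip t) (offset t)./2 (odd (offset t)).

Definition tri_of (x : cell) : T :=
  mk_tri (if side x then (2 * a).-1 - strip x else strip x) (2 * a - strip x + ((pos x).*2 + par x)).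

Definition flip (x : cell) := Cell (~~ side x) (strip x) (pos x) (par x).

(** The bounds are strict for triangles whose vertical side faces away from the axis and weak for
    the others. Parity excludes the two extreme heights in the strict case, so one interval of
    heights serves for both. *)
Lemma in_hexE (t : T) : in_hex t = (2 * a - folded_strip t <= val t.2 <= 2 * a + b.*2 + folded_strip t).
Proof.
rewrite /in_hex /folded_strip /=; have := ltn_ord t.1; move: (nat_of_ord t.1) (nat_of_ord t.2) => k m ka.
have par_ne c : odd (k + m) != odd (k + c) -> m != c by apply: contraNneq => ->.
have lowE x : x <= a -> hlow a x = 2 * a - x by move=> h; apply/maxn_idPl; lia.
have lowE' x : a <= x -> hlow a x = x by move=> h; apply/maxn_idPr; lia.
have upE x : x <= a -> hup a b a x = 2 * a + b.*2 + x.
  by move=> h; rewrite /hup -mul2n; apply/minn_idPl; lia.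
have upE' x : a <= x -> x <= a + a -> hup a b a x = 2 * a + b.*2 + (2 * a - x).
  by move=> h h'; transitivity (2 * a + 2 * b + 2 * a - x); [apply/minn_idPr; lia|lia].
case: (ltnP k a) => h /=.
  rewrite !lowE ?upE //; try by case: ifP => _; lia.
  case: ifP => [km|_]; last by apply/and4P/andP => -[*]; split; lia.
  have n1 : m != 2 * a - k.
    by apply: par_ne; rewrite km; have -> : k + (2 * a - k) = a.*2; [lia|rewrite odd_double].
  have n2 : m != 2 * a + b.*2 + k.
    by apply: par_ne; rewrite km; have -> : k + (2 * a + b.*2 + k) = (a + b + k).*2; [lia|rewrite odd_double].
  by apply/and4P/andP => -[*]; split; lia.
rewrite !lowE' ?upE' //; try by case: ifP => _; lia.
case: ifP => [_|/negbT km]; first by apply/and4P/andP => -[*]; split; lia.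
have n1 : m != k.+1.
  by apply: par_ne; rewrite (negbTE km) addnS /= addnn odd_double.
have n2 : m != 2 * a + b.*2 + (2 * a - k).-1.
  apply: par_ne; rewrite (negbTE km); have -> : k + (2 * a + b.*2 + (2 * a - k).-1) = (a + b + a).*2.-1 by lia.
  by rewrite -subn1 oddB ?odd_double //; lia.
by apply/and4P/andP => -[*]; split; lia.
Qed.

Lemma tri_of_val x : valid x ->
  val (tri_of x).1 = (if side x then (2 * a).-1 - strip x else strip x) /\
  val (tri_of x).2 = 2 * a - strip x + ((pos x).*2 + par x).
Proof.
by move=> /andP[h1 h2]; rewrite /tri_of mk_tri1 ?mk_tri2 //; [lia|case: (side x); lia].
Qed.

Lemma folded_strip_tri_of x : valid x -> folded_strip (tri_of x) = strip x.
Proof.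
move=> hx; have [e1 _] := tri_of_val hx; rewrite /folded_strip e1; case/andP: hx => h1 h2.
by case: (side x); case: ifP; lia.
Qed.

Lemma tri_of_region x : valid x -> tri_of x \in region a b a.
Proof.
move=> hx; rewrite inE in_hexE folded_strip_tri_of //; have [_ ->] := tri_of_val hx.
case/andP: hx; lia.
Qed.

Lemma tri_ofK x : valid x -> cell_of (tri_of x) = x.
Proof.
move=> hx; rewrite /cell_of /offset folded_strip_tri_of //; have [-> ->] := tri_of_val hx.
case/andP: hx; case: x => s k p o /= h1 h2.
rewrite addKn [_ + nat_of_bool o]addnC half_bit_double oddD odd_double oddb addbF.
by congr Cell; case: s; [apply/idP; lia|apply/negbTE; lia].
Qed.

Lemma cell_of_valid t : t \in region a b a -> valid (cell_of t).
Proof.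
rewrite inE in_hexE /valid /= => h; apply/andP; split.
  by rewrite /folded_strip; have := ltn_ord t.1; case: ifP; lia.
by rewrite [_ + odd _]addnC odd_double_half; move: h; rewrite /offset /=; lia.
Qed.

Lemma cell_ofK t : t \in region a b a -> tri_of (cell_of t) = t.
Proof.
move=> ht; have hv := cell_of_valid ht; have [e1 e2] := tri_of_val hv.
move: ht; rewrite inE in_hexE => ht; have l1 := ltn_ord t.1.
apply: injective_projections; apply: val_inj; rewrite ?e1 ?e2 /=.
  by move: l1; rewrite /folded_strip /=; move: (nat_of_ord t.1) => k; case: (leqP a k); lia.
by move: ht; rewrite [_ + odd _]addnC odd_double_half /offset /=; lia.
Qed.

Definition cell_adj (x y : cell) : bool :=
  let r x := (pos x).*2 + par x in
  if side x == side y then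
    (strip x == strip y) && ((r x).+1 == r y) || (strip x == strip y) && ((r y).+1 == r x) ||
    ~~ par x && par y && ((strip x).+1 == strip y) && (pos x == pos y) ||
    par x && ~~ par y && ((strip y).+1 == strip x) && (pos x == pos y)
  else [&& (strip x).+1 == a, (strip y).+1 == a, ~~ par x, ~~ par y & pos x == pos y].

Lemma odd_tri_of x : valid x -> odd (val (tri_of x).1 + val (tri_of x).2) = side x (+) par x.
Proof.
move=> hx; have [-> ->] := tri_of_val hx; case/andP: hx; case: x => s k p o /= ka _.
have -> : 2 * a - k + (p.*2 + o) = 2 * a + p.*2 - k + o by lia.
case: s => /=.
  have -> : (2 * a).-1 - k + (2 * a + p.*2 - k + o) = ((2 * a + p - k).*2 - 1) + o by lia.
  by rewrite oddD oddB ?odd_double ?double_gt0 ?oddb //; lia.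
have -> : k + (2 * a + p.*2 - k + o) = (a + p).*2 + o by lia.
by rewrite oddD odd_double oddb.
Qed.

Lemma eq_height_succ k p p' (o o' : bool) : k < a ->
  (2 * a - k + (p.*2 + o) == 2 * a - k.+1 + (p'.*2 + o')) = (o' == ~~ o) && (p' == p + o).
Proof.
move=> ka; have -> : 2 * a - k = (2 * a - k.+1).+1 by lia.
rewrite addSnnS eqn_add2l; case: o; case: o' => /=; lia.
Qed.

Lemma adj_tri_of x y : valid x -> valid y -> adj (tri_of x) (tri_of y) = cell_adj x y.
Proof.
move=> hx hy; have [e1 e2] := tri_of_val hx; have [e3 e4] := tri_of_val hy.
have := odd_tri_of hx; have := odd_tri_of hy.
rewrite /adj e1 e2 e3 e4 /cell_adj => -> ->; move: hx hy.
case: x e1 e2 => s k p o /= _ _; case: y e3 e4 => s' k' p' o' /= _ _.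
move=> /andP[/= ka _] /andP[/= ka' _].
have flipE i j : i < a -> j < a -> ((2 * a).-1 - i == (2 * a).-1 - j) = (i == j) by lia.
have flipSE i j : i < a -> j < a -> (((2 * a).-1 - i).+1 == (2 * a).-1 - j) = (j.+1 == i) by lia.
have crossF i j : i < a -> j < a -> (i == (2 * a).-1 - j) = false by lia.
have crossF' i j : i < a -> j < a -> ((2 * a).-1 - j == i) = false by lia.
have crossSF i j : i < a -> j < a -> (((2 * a).-1 - i).+1 == j) = false by lia.
have crossS i j : i < a -> j < a -> (i.+1 == (2 * a).-1 - j) = (i.+1 == a) && (j.+1 == a) by lia.
case: (eqVneq s s') => [<-{s'}|].
  have -> : ((if s then (2 * a).-1 - k else k) == (if s then (2 * a).-1 - k' else k')) = (k == k').
    by case: s; rewrite ?flipE.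
  have -> : ((if s then (2 * a).-1 - k else k).+1 == (if s then (2 * a).-1 - k' else k')) =
    if s then k'.+1 == k else k.+1 == k' by case: s; rewrite ?flipSE.
  have -> : ((if s then (2 * a).-1 - k' else k').+1 == (if s then (2 * a).-1 - k else k)) =
    if s then k.+1 == k' else k'.+1 == k by case: s; rewrite ?flipSE.
  case: (eqVneq k k') => [<-{k' ka'}|kk'].
    have kS : (k.+1 == k) = false by lia.
    by rewrite kS !if_same !andbF !orbF -!addnS !eqn_add2l.
  rewrite /=; case: (eqVneq k.+1 k') => [e|k1].
    rewrite -e eq_height_succ //; have -> : (k.+2 == k) = false by lia.
    by rewrite !andbF !orbF; case: s; case: o; case: o'; rewrite //= ?andbF ?addn0 ?andbT // eq_sym.
  case: (eqVneq k'.+1 k) => [e|k2]; last by rewrite !if_same !andbF.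
  rewrite -e eq_sym eq_height_succ // !andbF.
  by case: s; case: o; case: o'; rewrite //= ?andbF ?addn0 ?andbT.
move=> ss'; have -> : s' = ~~ s by case: s s' ss' => -[].
have height (c : bool) : (c == o) || (c == o') -> k.+1 = a -> k'.+1 = a ->
  (2 * a - k + (p.*2 + o) == 2 * a - k' + (p'.*2 + o')) && ~~ c = [&& ~~ o, ~~ o' & p == p'].
  move=> cE e e'; have -> : k' = k by lia.
  rewrite eqn_add2l; case: o o' c cE => -[] [] //= _; rewrite ?andbF ?andbT //; lia.
case: s {ss'} => /=.
  rewrite (crossF' k' k) // (crossSF k k') // (crossS k' k) // andbF /=.
  case: (eqVneq k'.+1 a) => [e'|_]; last by rewrite !andbF.
  case: (eqVneq k.+1 a) => [e|_]; last by rewrite !andbF.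
  by rewrite !andbT height ?eqxx ?orbT.
rewrite (crossF k k') // (crossS k k') // (crossSF k' k) // andbF orbF /=.
case: (eqVneq k.+1 a) => [e|_]; last by rewrite !andbF.
case: (eqVneq k'.+1 a) => [e'|_]; last by rewrite !andbF.
by rewrite !andbT height ?eqxx.
Qed.

Lemma refl_tri_of x : valid x -> refl (tri_of x) = tri_of (flip x).
Proof.
move=> hx; have hf : valid (flip x) by [].
have [e1 e2] := tri_of_val hx; have [e3 e4] := tri_of_val hf.
apply: injective_projections; apply: val_inj; rewrite /= ?e4 ?e2 // e3.
rewrite -/(val (tri_of x).1) e1.
by case/andP: hx; case: x {e1 e2 e3 e4 hf} => s k p o /=; case: s => /=; lia.
Qed.
End Coords.

(** * From interlacing chains to symmetric tilings *)

Section Levels.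
Variables s f : nat -> bool.

(** Total form of [level_run], meaningful where no violation occurs. In a strip of a tiling, level p
    says that the triangles of ranks 2p - 1 and 2p form a rhombus. *)
Fixpoint level n : bool := if n is p.+1 then (level p || s p) && ~~ f p else false.

Lemma level_run_level n p e : level_run s f n = Some e -> p <= n -> level_run s f p = Some (level p).
Proof.
elim: n p e => [|n IH] p e /=; first by rewrite leqn0 => _ /eqP ->.
case E: (level_run s f n) => [e'|] //= h; rewrite leq_eqVlt => /orP[/eqP->|]; last exact: IH E.
have := IH n e' E (leqnn n); rewrite E => -[ee] /=; rewrite E /= -ee.
by move: h; rewrite /level_step; case: ifP.
Qed.

Lemma level_run_valid n p e : level_run s f n = Some e -> p < n ->
  ~~ (level p && s p) /\ (f p -> level p || s p).
Proof.
move=> h hp; have h1 := level_run_level h (ltnW hp); have := level_run_level h hp.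
rewrite /= h1 /= /level_step; case: ifP => // /negbT; rewrite negb_or => /andP[-> h2] _.
by split=> // fp; move: h2; rewrite fp /= negbK.
Qed.
End Levels.

Section Chain.
Variables a b : nat.
Hypothesis a_gt0 : 0 < a.
Local Notation T := (tri a b a).
(* [X k] is the set of positions of the rhombi crossing the [k]th vertical line. *)
Variable X : nat -> nat -> bool.

Definition chain := [/\ forall p, X 0 p = false, forall k p, a + b <= p -> X k p = false &
  forall k, k < a -> level_run (X k.+1) (X k) (a + b) = Some true].

Local Notation l k := (level (X k.+1) (X k)).

Definition crossing (x : cell) := if par x then X (strip x) (pos x) else X (strip x).+1 (pos x).

(** Among uncrossed triangles, the one of rank 2p goes up unless it is already matched with rank 2p
    - 1; the one of rank 2p + 1 goes up when rank 2p is used otherwise, downwards or across. *)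
Definition upward (x : cell) :=
  if par x then l (strip x) (pos x) || X (strip x).+1 (pos x) else ~~ l (strip x) (pos x).

Definition up (x : cell) := Cell (side x) (strip x) (pos x + par x) (~~ par x).
Definition down (x : cell) := Cell (side x) (strip x) (pos x - ~~ par x) (~~ par x).
Definition across (x : cell) :=
  if par x then Cell (side x) (strip x).-1 (pos x) false
  else if (strip x).+1 < a then Cell (side x) (strip x).+1 (pos x) true
  else Cell (~~ side x) (strip x) (pos x) false.

Definition cell_mate (x : cell) :=
  if crossing x then across x else if upward x then up x else down x.

Hypothesis hX : chain.

(** Above the last crossing of line k + 1 a level that drops to 0 cannot return to 1, yet the run
    must end at 1. So the level stays 1 and line k has no crossing from q on. *)
Lemma chain_top k q : k < a -> (forall p, q < p -> X k.+1 p = false) -> q < a + b ->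
  l k q.+1 /\ forall p, q <= p -> X k p = false.
Proof.
case: hX => _ hN hst ka hS qn; have h := hst _ ka.
have step d : d + q.+1 <= a + b -> l k (a + b - d).
  elim: d => [|d IH] hd.
    by have := level_run_level h (leqnn _); rewrite h subn0 => -[<-].
  have := IH (leq_trans (leqnSn _) hd).
  have -> : a + b - d = (a + b - d.+1).+1 by lia.
  by rewrite /= hS ?orbF; [case/andP|lia].
have hl p : q < p <= a + b -> l k p.
  by move=> hp; have := step (a + b - p); rewrite subKn; [apply; lia|lia].
split; first by apply: hl; lia.
move=> p qp; case: (leqP (a + b) p) => hp; first exact: hN.
by have := hl p.+1; rewrite ltnS qp hp /= => /(_ isT) /andP[_ /negbTE].
Qed.

(** Descent from the axis, where all a + b positions are available: each line outwards loses its top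
    position by [chain_top]. *)
Lemma chain_supp k : k <= a -> forall p, b + k <= p -> X k p = false.
Proof.
move=> ka; rewrite -[k](subKn ka).
have : a - k <= a by lia.
elim: (a - k) => [|d IH] da p; first by case: hX => _ hN _; rewrite subn0 addnC; apply: hN.
have e : a - d = (a - d.+1).+1 by lia.
have hd := IH (ltnW da); rewrite e in hd.
have h1 : a - d.+1 < a by lia.
have h2 q : b + (a - d.+1) < q -> X (a - d.+1).+1 q = false by move=> hq; apply: hd; lia.
have h3 : b + (a - d.+1) < a + b by lia.
exact: (chain_top h1 h2 h3).2.
Qed.

Lemma chain_full k : k < a -> l k (b + k) || X k.+1 (b + k).
Proof.
move=> ka; have h2 q : b + k < q -> X k.+1 q = false by move=> hq; apply: chain_supp => //; lia.
have h3 : b + k < a + b by lia.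
by have [/= /andP[]] := chain_top ka h2 h3.
Qed.

Lemma chain_ok k p : k < a -> p < a + b ->
  ~~ (l k p && X k.+1 p) /\ (X k p -> l k p || X k.+1 p).
Proof. by case: hX => _ _ hst ka; apply: level_run_valid (hst _ ka). Qed.

(** By [chain_ok] the rule applied to the partner points back, and [chain_full] prevents the topmost
    triangle of a strip from being sent upwards out of the hexagon. *)
Lemma cell_mate_spec x : valid a b x ->
  [/\ valid a b (cell_mate x), cell_adj a x (cell_mate x) & cell_mate (cell_mate x) = x].
Proof.
case: x => s k p o /andP[/= ka hr].
have X0 : forall p, X 0 p = false by case: hX.
have pn : p < a + b by lia.
have [ok1 ok2] := chain_ok ka pn.
rewrite {1 2 4}/cell_mate ![crossing (Cell s k p o)]/crossing /=; case: o hr => hr.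
  have pb : p < b + k by lia.
  case hx : (X k p).
    have k0 : 0 < k by case: (k) hx => //; rewrite X0.
    rewrite /across /=; split.
    - by rewrite /valid /=; lia.
    - by rewrite /cell_adj /= !eqxx; lia.
    - by rewrite /cell_mate /crossing /= (prednK k0) hx /across /= (prednK k0) ka.
  rewrite /upward /=; case hl : (l k p || X k.+1 p).
    rewrite /up /= addn1; split.
    - by rewrite /valid /=; lia.
    - by rewrite /cell_adj /= !eqxx; lia.
    have pn1 : p.+1 < a + b by lia.
    have [ok3 ok4] := chain_ok ka pn1.
    have l1 : l k p.+1 by rewrite /= hl hx.
    rewrite /cell_mate /crossing /=; rewrite l1 /= in ok3; rewrite (negbTE ok3) /upward /= -[_ && _]/(l k p.+1) l1 /=.
    by rewrite /down /= subn1.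
  rewrite /down /= subn0; split.
  - by rewrite /valid /=; lia.
  - by rewrite /cell_adj /= !eqxx; lia.
  move/norP: hl => [l0 s0].
  by rewrite /cell_mate /crossing /= (negbTE s0) /upward /= l0 /up /= addn0.
case hx : (X k.+1 p).
  rewrite /across /=; case: ltnP => ka1; split.
  - by rewrite /valid /=; lia.
  - by rewrite /cell_adj /= !eqxx; lia.
  - by rewrite /cell_mate /crossing /= hx /across /=.
  - by rewrite /valid /=; lia.
  - rewrite /cell_adj /=; have -> : (s == ~~ s) = false by case: (s).
    by rewrite eqxx; lia.
  - by rewrite /cell_mate /crossing /= hx /across /= ltnNge ka1 /= negbK.
rewrite /upward /=; case hl : (l k p) => /=.
  have p0 : 0 < p by case: (p) hl.
  rewrite /down /= subn1; split.
  - by rewrite /valid /=; lia.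
  - by rewrite /cell_adj /= !eqxx; lia.
  move: hl; rewrite -{1}(prednK p0) /= => /andP[l1 f1].
  by rewrite /cell_mate /crossing /= (negbTE f1) /upward /= l1 /up /= addn1 prednK.
have pb : p < b + k.
  have : p <= b + k by lia.
  rewrite leq_eqVlt => /orP[/eqP pe|//]; have := chain_full ka.
  by rewrite -pe hl hx.
rewrite /up /= addn0; split.
- by rewrite /valid /=; lia.
- by rewrite /cell_adj /= !eqxx; lia.
have nf : X k p = false by apply/negP => /ok2; rewrite hl hx.
by rewrite /cell_mate /crossing /= nf /upward /= hl hx /down /= subn0.
Qed.

Lemma cell_mate_flip x : cell_mate (flip x) = flip (cell_mate x).
Proof.
case: x => s k p o; rewrite /cell_mate /crossing /upward /across /flip /=.
case: o => /=; first by case: (X k p) => //; case: (_ || _).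
by case: (X k.+1 p); [case: ltnP|case: (l k p)].
Qed.

Definition mate (t : T) : T := tri_of b a_gt0 (cell_mate (cell_of t)).

Lemma mate_tri_of x : valid a b x -> mate (tri_of b a_gt0 x) = tri_of b a_gt0 (cell_mate x).
Proof. by move=> hx; rewrite /mate tri_ofK. Qed.

Lemma mate_in t : t \in region a b a -> mate t \in region a b a.
Proof. by move=> ht; apply: tri_of_region; have [] := cell_mate_spec (cell_of_valid a_gt0 ht). Qed.

Lemma mate_adj t : t \in region a b a -> adj t (mate t).
Proof.
move=> ht; rewrite -{1}(cell_ofK a_gt0 ht); have hv := cell_of_valid a_gt0 ht.
by have [h1 h2 _] := cell_mate_spec hv; rewrite adj_tri_of.
Qed.

Lemma mateK t : t \in region a b a -> mate (mate t) = t.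
Proof.
move=> ht; have hv := cell_of_valid a_gt0 ht; have [h1 _ h3] := cell_mate_spec hv.
by rewrite {2}/mate mate_tri_of // h3 cell_ofK.
Qed.

Definition chain_tiling := tiling_of mate.

Lemma chain_tiling_is : is_tiling chain_tiling.
Proof. exact: is_tiling_of mate_in mate_adj mateK. Qed.

Lemma mem_chain_tiling x y : valid a b x -> valid a b y ->
  ([set tri_of b a_gt0 x; tri_of b a_gt0 y] \in chain_tiling) = (tri_of b a_gt0 y == tri_of b a_gt0 (cell_mate x)).
Proof.
move=> hx hy; rewrite (mem_tiling_of mate_adj mateK) ?mate_tri_of //; exact: tri_of_region.
Qed.

Lemma refl_region (t : T) : t \in region a b a -> refl t \in region a b a.
Proof.
by move=> ht; rewrite -(cell_ofK a_gt0 ht) refl_tri_of ?tri_of_region //; apply: (cell_of_valid a_gt0 ht).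
Qed.

Lemma reflK : involutive (@refl a b).
Proof. by case=> i j; rewrite /refl /= rev_ordK. Qed.

Lemma mate_refl t : t \in region a b a -> mate (refl t) = refl (mate t).
Proof.
move=> ht; have hv := cell_of_valid a_gt0 ht; rewrite -(cell_ofK a_gt0 ht) refl_tri_of //.
have hf : valid a b (flip (cell_of t)) by [].
have [h1 _ _] := cell_mate_spec hv.
by rewrite !mate_tri_of // cell_mate_flip refl_tri_of.
Qed.

Lemma vsym_chain_tiling : vsym chain_tiling.
Proof.
have sub B : B \in chain_tiling -> @refl a b @: B \in chain_tiling.
  move=> /imsetP[t ht ->]; rewrite imsetU1 imset_set1 -mate_refl //.
  by apply/imsetP; exists (refl t) => //; apply: refl_region.
apply/eqP/setP => B; apply/imsetP/idP => [[C hC ->]|hB]; first exact: sub.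
exists (@refl a b @: B); first exact: sub.
by rewrite -imset_comp (eq_imset _ reflK) imset_id.
Qed.
End Chain.

(** * From symmetric tilings to interlacing chains *)

Section FromTiling.
Variables a b : nat.
Hypothesis a_gt0 : 0 < a.
Local Notation T := (tri a b a).
Local Notation tri_of := (tri_of b a_gt0).
Definition opp_cell k p := if k.+1 < a then Cell false k.+1 p true else Cell true k p false.

Lemma opp_valid k p : k < a -> p <= b + k -> valid a b (opp_cell k p).
Proof. by move=> ka hp; rewrite /opp_cell; case: ifP => h; rewrite /valid /=; lia. Qed.

Variable P : {set {set T}}.
Hypothesis hP : is_tiling P.

Definition edge (x y : cell) : bool := [set tri_of x; tri_of y] \in P.

Lemma edgeC x y : edge x y = edge y x.
Proof. by rewrite /edge setUC. Qed.

Definition crossings k p := if k is k'.+1 then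
  [&& k' < a, p < b + k & edge (Cell false k' p false) (opp_cell k' p)] else false.

Lemma edge_inj x y z : valid a b x -> valid a b y -> valid a b z -> edge x y -> edge x z -> y = z.
Proof.
move=> hx hy hz; have [u [_ _ _ hu]] := tiling_mate hP (tri_of_region a_gt0 hx).
move=> /hu ey /hu ez; rewrite -(tri_ofK a_gt0 hy) -(tri_ofK a_gt0 hz).
by rewrite [X in cell_of X]ey [X in _ = cell_of X]ez.
Qed.

Lemma edge_ex x : valid a b x -> exists y, [/\ valid a b y, cell_adj a x y & edge x y].
Proof.
move=> hx; have [u [hu au eu _]] := tiling_mate hP (tri_of_region a_gt0 hx).
have hv := cell_of_valid a_gt0 hu; exists (cell_of u); split=> //.
  by rewrite -(adj_tri_of a_gt0 hx hv) cell_ofK.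
by rewrite /edge cell_ofK.
Qed.

Section Strip.
Variable k : nat.
Hypothesis ka : k < a.

Definition lower_edge p := (0 < p) && edge (Cell false k p.-1 true) (Cell false k p false).
Definition upper_edge p := (p < b + k) && edge (Cell false k p false) (Cell false k p true).

Lemma exact_even p : p <= b + k ->
  [/\ [|| lower_edge p, upper_edge p | crossings k.+1 p], ~~ (lower_edge p && upper_edge p),
      ~~ (lower_edge p && crossings k.+1 p) & ~~ (upper_edge p && crossings k.+1 p)].
Proof.
move=> hp; have hx : valid a b (Cell false k p false) by rewrite /valid /=; lia.
have v0 : 0 < p -> valid a b (Cell false k p.-1 true) by rewrite /valid /=; lia.
have v1 : p < b + k -> valid a b (Cell false k p true) by rewrite /valid /=; lia.
have v2 := opp_valid ka hp.
split.
- have [[s' k' p' o'] [vy ay ey]] := edge_ex hx; rewrite /lower_edge /upper_edge /crossings ka addnS ltnS hp /=.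
  move: ay; rewrite /cell_adj /=; case: s' vy ey => /= vy ey.
    move=> /and4P[/eqP h1 /eqP h2 h3 /eqP h4].
    have ek : k' = k by lia.
    subst k' p'; case: o' h3 vy ey => // _ _ ey; rewrite /opp_cell h1 ltnn.
    by rewrite ey !orbT.
  rewrite !orbF; case: o' vy ey => vy ey /=; last first.
    by rewrite !addn0 => /orP[/orP[]|] //; lia.
  rewrite !addn1 !addn0 /=.
  move=> /orP[/orP[/andP[/eqP ek /eqP ep]|/andP[/eqP ek /eqP ep]]|/andP[/eqP ek /eqP ep]].
  - have pp : p' = p by lia.
    subst k' p'; rewrite ey andbT; case/andP: vy => /= _ vy.
    by rewrite (_ : p < b + k) ?orbT //; lia.
  - have pp : p' = p.-1 by lia.
    subst k' p'; rewrite edgeC ey andbT; have -> // : 0 < p by lia.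
  - subst k' p'; case/andP: vy => /= vy _; rewrite /opp_cell vy ey !orbT //.
- apply/negP => /andP[/andP[p0 e1] /andP[p1 e2]]; rewrite edgeC in e1.
  by have := edge_inj hx (v0 p0) (v1 p1) e1 e2 => -[]; lia.
- apply/negP => /andP[/andP[p0 e1] /and3P[_ _ e2]]; rewrite edgeC in e1.
  have := edge_inj hx (v0 p0) v2 e1 e2; rewrite /opp_cell; case: ifP => // _ []; lia.
- apply/negP => /andP[/andP[p0 e1] /and3P[_ _ e2]].
  have := edge_inj hx (v1 p0) v2 e1 e2; rewrite /opp_cell; case: ifP => // _ []; lia.
Qed.

Lemma exact_odd p : p < b + k ->
  [/\ [|| upper_edge p, lower_edge p.+1 | crossings k p], ~~ (upper_edge p && lower_edge p.+1),
      ~~ (upper_edge p && crossings k p) & ~~ (lower_edge p.+1 && crossings k p)].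
Proof.
move=> hp; have hx : valid a b (Cell false k p true) by rewrite /valid /=; lia.
have v0 : valid a b (Cell false k p false) by rewrite /valid /=; lia.
have v1 : valid a b (Cell false k p.+1 false) by rewrite /valid /=; lia.
have cr k' : k = k'.+1 -> opp_cell k' p = Cell false k p true by move=> e; rewrite /opp_cell -e ka.
have v2 k' : k = k'.+1 -> valid a b (Cell false k' p false) by move=> e; rewrite /valid /=; lia.
split.
- have [[s' k' p' o'] [vy ay ey]] := edge_ex hx; rewrite /upper_edge /lower_edge hp /=.
  move: ay; rewrite /cell_adj /=; case: s' vy ey => /= vy ey; first by rewrite !andbF.
  case: o' vy ey => vy ey /=; first by rewrite !addn1 !orbF => /orP[]; lia.
  rewrite !addn1 !addn0.
  move=> /orP[/orP[/orP[/andP[/eqP ek /eqP ep]|/andP[/eqP ek /eqP ep]]|]|/andP[/eqP ek /eqP ep]] //.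
  - have pp : p' = p.+1 by lia.
    by subst k' p'; rewrite ey !orbT.
  - have pp : p' = p by lia.
    by subst k' p'; rewrite edgeC ey.
  - subst p'; have -> : crossings k p; last by rewrite !orbT.
    rewrite -ek /crossings (cr k' (esym ek)) edgeC ey andbT.
    by case/andP: vy => /= -> _; lia.
- apply/negP => /andP[/andP[_ e1] /andP[_ e2]]; rewrite edgeC in e1.
  by have := edge_inj hx v0 v1 e1 e2 => -[]; lia.
- apply/negP => /andP[/andP[_ e1]]; rewrite edgeC in e1; rewrite /crossings.
  case folded_strip : k => [//|k'] /and3P[_ _]; rewrite (cr k') // edgeC => e2.
  by have := edge_inj hx v0 (v2 k' folded_strip) e1 e2 => -[]; lia.
- apply/negP => /andP[/andP[_ e1]]; rewrite /crossings.
  case folded_strip : k => [//|k'] /and3P[_ _]; rewrite (cr k') // edgeC => e2.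
  by have := edge_inj hx v1 (v2 k' folded_strip) e1 e2 => -[]; lia.
Qed.

Arguments crossings : simpl never.

(** The triangles of ranks 2p and 2p + 1 are each covered exactly once, so a step of the run meets
    no violation and passes from the rhombus below rank 2p to the one below rank 2p + 2. *)
Lemma level_run_edge p : p <= b + k -> level_run (crossings k.+1) (crossings k) p = Some (lower_edge p).
Proof.
elim: p => [//|p IH] hp; rewrite /= IH ?(ltnW hp) //=.
have [] := exact_even (ltnW hp); have [] := exact_odd hp; rewrite /level_step.
by case: (lower_edge p); case: (upper_edge p); case: (crossings k.+1 p); case: (crossings k p); case: (lower_edge p.+1).
Qed.

Lemma crossings_above p : b + k <= p -> crossings k p = false.
Proof. by move=> h; rewrite /crossings; case: k h => // k' h; rewrite [p < _]ltnNge h /= andbF. Qed.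

Lemma crossings_aboveS p : b + k < p -> crossings k.+1 p = false.
Proof. by move=> h; rewrite /crossings [p < _]ltnNge addnS h /= andbF. Qed.

(** The top triangle of the strip has no upper neighbour. It is covered from below or across, so the
    level after it is 1, and no crossing beyond the strip can change it. *)
Lemma level_run_full d : level_run (crossings k.+1) (crossings k) (b + k + d).+1 = Some true.
Proof.
elim: d => [|d IH].
  rewrite addn0 /= level_run_edge //= crossings_above // /level_step.
  have [] := exact_even (leqnn (b + k)); rewrite [upper_edge _]/upper_edge ltnn /=.
  by case: (lower_edge _); case: (crossings k.+1 _).
by rewrite addnS /= -/(level_run _ _ (b + k + d).+1) IH /= crossings_above ?crossings_aboveS //; lia.
Qed.

End Strip.

Arguments crossings : simpl never.

Lemma crossings_chain : chain a b crossings.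
Proof.
split=> //.
  by move=> [//|k] p h; rewrite /crossings; case: ltnP => //= ka; rewrite [p < _]ltnNge; case: leqP => //; lia.
move=> k ka; have -> : a + b = (b + k + (a - k.+1)).+1 by lia.
exact: level_run_full.
Qed.

Lemma edge_mate x : valid a b x -> ~~ side x -> edge x (cell_mate a crossings x).
Proof.
case: x => s k p o /andP[/= ka hr] /negbTE hs; rewrite {s}hs.
have hX := crossings_chain.
have lE q : q <= b + k -> level (crossings k.+1) (crossings k) q = lower_edge k q.
  move=> hq; have := level_run_edge ka hq => h.
  by have := level_run_level h (leqnn _); rewrite h => -[].
rewrite /cell_mate /crossing /upward /=; case: o hr => hr.
  have pb : p < b + k by lia.
  have [h1 h2 h3 h4] := exact_odd ka pb; have [h5 h6 h7 h8] := exact_even ka (ltnW pb).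
  case hx : (crossings k p).
    have := hx; rewrite /crossings; case folded_strip : k => [//|k'] /and3P[_ _].
    by rewrite /across /= /opp_cell -folded_strip ka edgeC.
  rewrite lE ?(ltnW pb) //; case hl : (_ || _).
    rewrite /up /= addn1; move: h1; rewrite hx orbF.
    have -> : upper_edge k p = false.
      by move: hl h6 h8; case: (upper_edge k p); case: (lower_edge k p); case: (crossings k.+1 p).
    by rewrite /lower_edge /=.
  rewrite /down /= subn0; move: h5 hl; case: (lower_edge k p) => //=; case: (crossings k.+1 p); rewrite ?orbT //.
  by rewrite orbF /upper_edge edgeC => /andP[].
have pb : p <= b + k by lia.
have [h5 h6 h7 h8] := exact_even ka pb.
case hx : (crossings k.+1 p).
  have := hx; rewrite /crossings => /and3P[_ _].
  by rewrite /across /opp_cell /=; case: ifP.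
rewrite lE //; move: h5; rewrite hx orbF; case he : (lower_edge k p) => /=.
  by move: he; rewrite /lower_edge /down /= subn1 edgeC => /andP[].
by rewrite /upper_edge /up /= addn0 => /andP[].
Qed.

Hypothesis hS : vsym P.

Lemma refl_mem (B : {set T}) : B \in P -> @refl a b @: B \in P.
Proof. by move=> hB; rewrite -(eqP hS); apply/imsetP; exists B. Qed.

Lemma tiling_crossings : P = chain_tiling b a_gt0 crossings.
Proof.
have hX := crossings_chain.
apply: (tiling_ofE hP).
have h0 t : t \in region a b a -> ~~ side (cell_of t) -> [set t; mate a_gt0 crossings t] \in P.
  move=> ht hs; have := edge_mate (cell_of_valid a_gt0 ht) hs.
  by rewrite /edge cell_ofK.
move=> t ht; case hs : (side (cell_of t)); last by apply: h0; rewrite ?hs.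
have hr := refl_region a_gt0 ht.
have := h0 _ hr; rewrite -{1}(cell_ofK a_gt0 ht) refl_tri_of ?tri_ofK; try exact: (cell_of_valid a_gt0 ht).
rewrite negbK => /(_ hs) /refl_mem; rewrite imsetU1 imset_set1 reflK.
by rewrite (mate_refl a_gt0 hX ht) reflK.
Qed.

End FromTiling.

(** * Symmetric tilings as tuples of crossing sets *)

Section Bijection.
Variables a b : nat.
Hypothesis a_gt0 : 0 < a.
Local Notation T := (tri a b a).
Local Notation tri_of := (tri_of b a_gt0).

Lemma tri_of_inj x y : valid a b x -> valid a b y -> tri_of x = tri_of y -> x = y.
Proof. by move=> hx hy e; rewrite -(tri_ofK a_gt0 hx) -(tri_ofK a_gt0 hy) e. Qed.

Lemma crossings_chain_tiling X k p : chain a b X -> k <= a ->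
  crossings a_gt0 (chain_tiling b a_gt0 X) k p = X k p.
Proof.
move=> hX; case: k => [|k] ka; first by rewrite /crossings; case: hX => ->.
rewrite /crossings ka /=; case: ltnP => hp; last by rewrite (chain_supp a_gt0 hX).
have hx : valid a b (Cell false k p false) by rewrite /valid /=; lia.
have ho : valid a b (opp_cell a k p) by apply: opp_valid => //; lia.
rewrite /edge mem_chain_tiling //; have [hm _ _] := cell_mate_spec a_gt0 hX hx.
apply/eqP/idP => [/(tri_of_inj ho hm)|h].
  rewrite /cell_mate /crossing /=; case: (X k.+1 p) => // e; move: e.
  rewrite /up /down /opp_cell /= addn0 subn1; case: (upward _ _); case: ifP => _ [] //; lia.
by rewrite /cell_mate /crossing /= h /across /opp_cell /=; case: ifP.
Qed.

Lemma eq_tri_of (t : T) x : valid a b x -> (t == tri_of x) =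
  (val t.1 == (if side x then (2 * a).-1 - strip x else strip x)) &&
  (val t.2 == 2 * a - strip x + ((pos x).*2 + par x)).
Proof.
move=> hx; have [<- <-] := tri_of_val a_gt0 hx.
by rewrite !val_eqE; case: t => i j; rewrite [tri_of x]surjective_pairing xpair_eqE.
Qed.

(** The central rhombus has height 2a + b and position p of the axis has height a + 1 + 2p, so p =
    (a + b - 1)/2, which is the integer half because a + b is odd. *)
Lemma centered_crossings (P : {set {set T}}) : odd (a + b) ->
  centered P = crossings a_gt0 P a (a + b)./2.
Proof.
move=> ho; rewrite -[X in crossings _ _ X _](prednK a_gt0) /centered /crossings.
have -> : a.-1 < a by lia.
have -> : (a + b)./2 < b + a.-1.+1 by lia.
rewrite /edge /opp_cell prednK // ltnn /=; congr (_ \in P); apply/setP => t.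
have v s : valid a b (Cell s a.-1 (a + b)./2 false) by rewrite /valid /=; lia.
rewrite !inE !eq_tri_of //=; lia.
Qed.

Local Notation B := (bits (a + b)).

Definition nth_row (p : B * a.-tuple B) j : B := nth p.1 (p.1 :: p.2) j.

(** Rows are listed from the axis outwards, as [pattern_count] peels them, while chains are indexed
    from the vertical side; hence the index [a - k]. *)
Definition to_chain (p : B * a.-tuple B) (k : nat) : nat -> bool :=
  if k <= a then bit_at (nth_row p (a - k)) else fun=> false.

Definition of_chain (X : nat -> nat -> bool) : B * a.-tuple B :=
  ([ffun p : 'I__ => X a p], [tuple [ffun p : 'I__ => X (a - i.+1) p] | i < a]).

Definition chain_path (p : B * a.-tuple B) : bool :=
  path (@interlacing (a + b)) p.1 p.2 && (last p.1 p.2 == [ffun=> false]).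

Lemma chain_pathP p : reflect ((forall i, i < a -> interlacing (nth_row p i) (nth_row p i.+1)) /\
  nth_row p a = [ffun=> false]) (chain_path p).
Proof.
have el : last p.1 p.2 = nth_row p a by rewrite (last_nth p.1) size_tuple.
apply: (iffP andP) => -[h1 /eqP h2].
  by split; [move=> i hi; apply: (pathP p.1 h1); rewrite size_tuple|rewrite -el].
split; last by rewrite el.
by apply/(pathP p.1) => i; rewrite size_tuple; apply: h1.
Qed.

Lemma bit_at_ffun (f : nat -> bool) p : (forall q, a + b <= q -> f q = false) ->
  bit_at [ffun i : 'I_(a + b) => f i] p = f p.
Proof.
move=> h; case: (ltnP p (a + b)) => hp; last by rewrite bit_at_ge ?h.
by rewrite -[p]/(val (Ordinal hp)) bit_atE ffunE.
Qed.

Lemma bit_at0 p : bit_at ([ffun=> false] : B) p = false.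
Proof. by rewrite /bit_at; case: insubP => //= i _ _; rewrite ffunE. Qed.

Lemma bit_at_inj (S S' : B) : bit_at S =1 bit_at S' -> S = S'.
Proof. by move=> h; apply/ffunP => i; rewrite -!bit_atE. Qed.

Lemma eq_level_run s f s' f' n : s =1 s' -> f =1 f' -> level_run s f n = level_run s' f' n.
Proof. by move=> es ef; elim: n => //= n ->; rewrite es ef. Qed.

Lemma eq_level s f s' f' n : s =1 s' -> f =1 f' -> level s f n = level s' f' n.
Proof. by move=> es ef; elim: n => //= n ->; rewrite es ef. Qed.

Lemma of_chain_nth X k : chain a b X -> k <= a -> bit_at (nth_row (of_chain X) (a - k)) =1 X k.
Proof.
move=> [_ hN _] ka p; rewrite /nth_row.
case e : (a - k) => [|j] /=.
  have -> : k = a by lia.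
  by rewrite bit_at_ffun // => q; apply: hN.
have ja : j < a by lia.
rewrite (nth_map (Ordinal ja)) ?size_enum_ord // nth_enum_ord //.
have -> : a - j.+1 = k by lia.
by rewrite bit_at_ffun // => q; apply: hN.
Qed.

Lemma chain_path_of_chain X : chain a b X -> chain_path (of_chain X).
Proof.
move=> hX; have hn := of_chain_nth hX; have [h0 hN hst] := hX.
apply/chain_pathP; split; last first.
  apply: bit_at_inj => p; have := hn 0 (leq0n a) p; rewrite subn0 => ->.
  by rewrite h0 bit_at0.
move=> i hi; have e1 : bit_at (nth_row (of_chain X) i) =1 X (a - i.+1).+1.
  by move=> p; have := hn (a - i) (leq_subr _ _) p; rewrite subKn 1?ltnW // subnSK.
have e2 : bit_at (nth_row (of_chain X) i.+1) =1 X (a - i.+1).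
  by move=> p; have := hn (a - i.+1) (leq_subr _ _) p; rewrite subKn.
by rewrite /interlacing (eq_level_run _ e1 e2) hst //; lia.
Qed.

Lemma to_chain_chain p : chain_path p -> chain a b (to_chain p).
Proof.
move=> /chain_pathP[h1 h2]; split.
- by move=> q; rewrite /to_chain leq0n subn0 h2 bit_at0.
- by move=> k q hq; rewrite /to_chain; case: ifP => // _; apply: bit_at_ge.
move=> k ka; rewrite /to_chain ka (ltnW ka).
have := h1 (a - k.+1); rewrite /interlacing subnSK // => h; apply/eqP; apply: h; lia.
Qed.

Lemma to_chainK p : of_chain (to_chain p) = p.
Proof.
apply: injective_projections.
  apply: bit_at_inj => q; rewrite /= bit_at_ffun ?/to_chain ?leqnn ?subnn // => r hr.
  exact: bit_at_ge.
apply: eq_from_tnth => i; apply: bit_at_inj => q; have hi := ltn_ord i.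
rewrite tnth_mktuple bit_at_ffun; last first.
  by move=> r hr; rewrite /to_chain leq_subr; apply: bit_at_ge.
by rewrite /to_chain leq_subr subKn // /nth_row /= -tnth_nth.
Qed.

Lemma eq_of_chain X X' : (forall k p, k <= a -> X k p = X' k p) -> of_chain X = of_chain X'.
Proof.
move=> h; apply: injective_projections => /=; first by apply/ffunP => p; rewrite !ffunE h.
by apply: eq_from_tnth => i; rewrite !tnth_mktuple; apply/ffunP => p; rewrite !ffunE h // leq_subr.
Qed.

Lemma eq_cell_mate X X' x : (forall k p, k <= a -> X k p = X' k p) -> valid a b x ->
  cell_mate a X x = cell_mate a X' x.
Proof.
case: x => s k p o h /andP[/= ka _]; have ka' := ltnW ka.
rewrite /cell_mate /crossing /upward /= !h //.
by rewrite (@eq_level _ _ (X' k.+1) (X' k)) // => q; apply: h.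
Qed.

Lemma eq_chain_tiling X X' : (forall k p, k <= a -> X k p = X' k p) ->
  chain_tiling b a_gt0 X = chain_tiling b a_gt0 X'.
Proof.
move=> h; apply: eq_in_imset => t ht.
by rewrite /mate (eq_cell_mate h) //; apply: (cell_of_valid a_gt0 ht).
Qed.

Lemma card_centered : odd (a + b) -> num_cvs_tilings a b =
  #|[set p : B * a.-tuple B | chain_path p && bit_at p.1 (a + b)./2]|.
Proof.
move=> ho; rewrite /num_cvs_tilings; set A := [set P | _]; set C := [set p | _].
pose F (P : {set {set T}}) := of_chain (crossings a_gt0 P).
have -> : C = F @: A.
  apply/setP => p; apply/idP/imsetP => [|[P]]; rewrite inE.
    move=> /andP[gp bp]; have hX := to_chain_chain gp.
    have hc k q : k <= a -> crossings a_gt0 (chain_tiling b a_gt0 (to_chain p)) k q = to_chain p k q.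
      exact: crossings_chain_tiling.
    exists (chain_tiling b a_gt0 (to_chain p)); last first.
      by rewrite /F (eq_of_chain hc) to_chainK.
    rewrite inE (chain_tiling_is a_gt0 hX) (vsym_chain_tiling a_gt0 hX) /=.
    by rewrite centered_crossings // hc // /to_chain leqnn subnn.
  move=> /and3P[h1 h2 h3] ->; have hX := crossings_chain a_gt0 h1.
  rewrite inE /F chain_path_of_chain //= bit_at_ffun -?centered_crossings //.
  by move=> q hq; case: hX => _ hN _; apply: hN.
rewrite card_in_imset // => P P'; rewrite !inE => /and3P[h1 h2 _] /and3P[h1' h2' _] e.
have hX := crossings_chain a_gt0 h1; have hX' := crossings_chain a_gt0 h1'.
rewrite (tiling_crossings a_gt0 h1 h2) (tiling_crossings a_gt0 h1' h2').
apply: eq_chain_tiling => k p ka.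
by rewrite -(of_chain_nth hX ka) -(of_chain_nth hX' ka) -/(F P) e.
Qed.

End Bijection.

(** * Counting chains as interlacing paths *)

Section Count.
Variable N : nat.

Lemma card_tuple_cons (V : finType) k (Q : seq V -> bool) :
  #|[set t : k.+1.-tuple V | Q t]| = \sum_x #|[set t : k.-tuple V | Q (x :: t)]|.
Proof.
rewrite -sum1dep_card.
under [RHS]eq_bigr => x _ do rewrite -sum1dep_card.
rewrite pair_big_dep /=.
rewrite (reindex (fun p : V * k.-tuple V => [tuple of p.1 :: p.2])) //=.
exists (fun t : k.+1.-tuple V => (thead t, [tuple of behead t])).
  by move=> [x t] _; congr pair; apply: val_inj.
by move=> t _; apply: val_inj; rewrite [in RHS](tuple_eta t).
Qed.

Lemma pattern_count_path k (S : bits N) : pattern_count k S =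
  #|[set t : k.-tuple (bits N) | path (@interlacing N) S t && (last S t == [ffun=> false])]|.
Proof.
elim: k S => [|k IH] S /=.
  case: eqP => e.
    rewrite (_ : [set t | _] = [set: 0.-tuple (bits N)]) ?cardsT ?card_tuple ?expn0 //.
    by apply/setP => t; rewrite !inE tuple0 /= e eqxx.
  apply/esym/eqP; rewrite cards_eq0; apply/eqP/setP => t; rewrite !inE tuple0 /=.
  by apply/eqP.
rewrite (card_tuple_cons k (fun t => path (@interlacing N) S t && (last S t == [ffun=> false]))).
rewrite big_mkcond; apply: eq_bigr => x _ /=; rewrite IH.
case: ifP => _ //.
by apply/esym/eqP; rewrite cards_eq0; apply/eqP/setP => t; rewrite !inE.
Qed.

Lemma sum_pattern_count k (Q : pred (bits N)) : \sum_(S | Q S) pattern_count k S =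
  #|[set p : bits N * k.-tuple (bits N) |
     [&& path (@interlacing N) p.1 p.2, last p.1 p.2 == [ffun=> false] & Q p.1]]|.
Proof.
transitivity (\sum_(S : bits N) \sum_(t : k.-tuple (bits N) |
    [&& path (@interlacing N) S t, last S t == [ffun=> false] & Q S]) 1); last first.
  by rewrite pair_big_dep /= sum1dep_card.
rewrite big_mkcond; apply: eq_bigr => S _; rewrite sum1dep_card; case: ifP => _.
  by rewrite pattern_count_path; apply: eq_card => t; rewrite !inE andbT.
by apply/esym/eqP; rewrite cards_eq0; apply/eqP/setP => t; rewrite !inE !andbF.
Qed.
End Count.

Theorem num_cvs_tilingsE a b : 0 < a -> odd (a + b) ->
  num_cvs_tilings a b = \sum_(S : bits (a + b) | bit_at S (a + b)./2) pattern_count a S.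
Proof.
move=> a0 ho; rewrite (card_centered a0 ho) sum_pattern_count; apply: eq_card => p.
by rewrite !inE /chain_path andbA.
Qed.
End Combinatorics.

(** * Anticommuting families *)

Section Grassmann.
Variable A : algType rat.
Implicit Types (x y z : A).

Definition anti x y := x * y = - (y * x).

Lemma eq_opp0 (V : lmodType rat) (v : V) : v = - v -> v = 0.
Proof.
move=> /eqP; rewrite -subr_eq0 opprK -mulr2n -scaler_nat scaler_eq0 => /orP[|/eqP//].
by rewrite pnatr_eq0.
Qed.

Lemma anti_sq x : anti x x -> x * x = 0.
Proof. exact: eq_opp0. Qed.

Lemma antiC x y : anti x y -> anti y x.
Proof. by rewrite /anti => ->; rewrite opprK. Qed.

Lemma anti_sumr (I : Type) (r : seq I) (P : pred I) (F : I -> A) x :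
  (forall i, P i -> anti x (F i)) -> anti x (\sum_(i <- r | P i) F i).
Proof.
move=> h; rewrite /anti mulr_sumr mulr_suml -sumrN.
by apply: eq_bigr => i /h.
Qed.

Lemma antiZr (c : rat) x y : anti x y -> anti x (c *: y).
Proof. by rewrite /anti -scalerAr -scalerAl => ->; rewrite scalerN. Qed.

Lemma anti_prod (I : Type) (r : seq I) (F : I -> A) x :
  (forall i, anti x (F i)) ->
  x * \prod_(i <- r) F i = (-1) ^+ size r *: (\prod_(i <- r) F i * x).
Proof.
move=> h; elim: r => [|a r IH]; first by rewrite big_nil mulr1 mul1r scale1r.
rewrite big_cons mulrA (h a : _ = _) mulNr -[_ * x * _]mulrA IH /=.
by rewrite exprS mulN1r scaleNr -scalerAr mulrA.
Qed.

Lemma anti_prod_ord n (F : nat -> A) x : (forall i, anti x (F i)) ->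
  x * \prod_(i < n) F i = (-1) ^+ n *: (\prod_(i < n) F i * x).
Proof. by move=> h; rewrite -(big_mkord xpredT) anti_prod // size_iota subn0. Qed.

(** The block between two factors passes both with the same sign e, and the two signs cancel; an
    exchange of distant factors thus costs a single minus sign. *)
Lemma anti_swap x y b (e : rat) : e * e = 1 -> anti x y ->
  x * b = e *: (b * x) -> y * b = e *: (b * y) ->
  x * b * y = - (y * b * x).
Proof.
move=> he hxy hx hy; rewrite hx -scalerAl -[b * x * y]mulrA hxy mulrN scalerN.
by rewrite hy -scalerAl mulrA.
Qed.

Lemma prod_tperm (H : nat -> A) (m x y : nat) : (x < y < m)%N ->
  (forall i j, anti (H i) (H j)) ->
  \prod_(0 <= i < m) H (if i == x then y else if i == y then x else i)
    = - \prod_(0 <= i < m) H i.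
Proof.
move=> /andP[xy ym] h.
have split (F : nat -> A) : \prod_(0 <= i < m) F i =
    \prod_(0 <= i < x) F i * (F x * \prod_(x.+1 <= i < y) F i * F y) *
    \prod_(y.+1 <= i < m) F i.
  rewrite (@big_cat_nat _ _ _ x) //=; last lia.
  rewrite (@big_ltn _ _ _ x); last lia.
  rewrite (@big_cat_nat _ _ _ y x.+1) //=; last lia.
  rewrite (@big_ltn _ _ _ y) //.
  by rewrite !mulrA.
have e0 a b : (forall i, a <= i < b -> i != x /\ i != y)%N ->
  \prod_(a <= i < b) H (if i == x then y else if i == y then x else i) =
  \prod_(a <= i < b) H i.
  by move=> hh; apply: eq_big_nat => i /hh[/negbTE-> /negbTE->].
rewrite !split !e0; try by move=> i; lia.
rewrite eqxx eqxx; case: eqP => [e|_]; first by lia.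
rewrite (@anti_swap (H y) (H x) _ ((-1) ^+ (y - x.+1))) ?mulrN ?mulNr //.
- by rewrite -expr2 sqrr_sign.
- by rewrite anti_prod ?size_iota.
- by rewrite anti_prod ?size_iota.
Qed.

Lemma prod_perm m (H : 'I_m -> A) (s : 'S_m) :
  (forall i j, anti (H i) (H j)) ->
  \prod_(i < m) H (s i) = (-1) ^+ s *: \prod_(i < m) H i.
Proof.
case: m H s => [|m] H s h.
  by rewrite !big_ord0 (_ : s = 1%g) ?odd_perm1 ?scale1r //; apply/permP => -[].
have tp (H' : 'I_m.+1 -> A) (x y : 'I_m.+1) : (forall i j, anti (H' i) (H' j)) ->
    x != y -> \prod_i H' (tperm x y i) = - \prod_i H' i.
  move=> h' nxy; wlog xy : x y nxy / (x < y)%N.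
    move=> hw; case: (ltngtP x y) => [/hw->//|/hw|/val_inj e].
    - by rewrite tpermC => ->//; rewrite eq_sym.
    - by rewrite e eqxx in nxy.
  have := @prod_tperm (fun i => H' (inord i)) m.+1 x y.
  rewrite xy ltn_ord => /(_ isT (fun i j => h' _ _)).
  rewrite !big_mkord => e; transitivity (\prod_(i < m.+1) - 0 + - \prod_(i < m.+1) H' (inord i)); last first.
    rewrite big_ord_recl oppr0 mul0r add0r; congr (- _).
    by apply: eq_bigr => i _; rewrite inord_val.
  rewrite big_ord_recl oppr0 mul0r add0r -e; apply: eq_bigr => i _.
  case: tpermP => [->|->|/eqP n1 /eqP n2].
  - by rewrite eqxx inord_val.
  - rewrite eqxx; case: eqP => [e'|_]; last by rewrite inord_val.
    by have := nxy; rewrite -val_eqE /= e' eqxx.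
  - by rewrite -val_eqE in n1; rewrite -val_eqE in n2; rewrite (negbTE n1) (negbTE n2) inord_val.
have [ts -> hts] := prod_tpermP s.
elim: ts H h hts => [|[x y] ts IH] H h /=.
  rewrite big_nil => _; rewrite odd_perm1 scale1r.
  by apply: eq_bigr => i _; rewrite perm1.
move=> /andP[/= dxy hts]; rewrite big_cons /=.
transitivity (\prod_i (H \o (\prod_(t <- ts) tperm t.1 t.2)%g) (tperm x y i)).
  by apply: eq_bigr => i _; rewrite permM.
rewrite tp //; last by move=> i j; apply: h.
by rewrite odd_permM odd_tperm dxy signr_addb mulN1r scaleNr -(IH H h hts).
Qed.

Definition lin_comb m (eta : nat -> A) (u : nat -> rat) : A := \sum_(i < m) u i *: eta i.

Lemma lin_comb_anti m (eta : nat -> A) u v :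
  (forall i j, anti (eta i) (eta j)) -> anti (lin_comb m eta u) (lin_comb m eta v).
Proof.
move=> h; apply: anti_sumr => i _; apply: antiZr; apply: antiC.
by apply: anti_sumr => j _; apply: antiZr.
Qed.

Lemma prod_noninj m (H : 'I_m -> A) i j : i != j -> H i = H j ->
  (forall i j, anti (H i) (H j)) -> \prod_k H k = 0.
Proof.
move=> ij e h; apply: eq_opp0.
have := prod_perm (tperm i j) h; rewrite odd_tperm ij expr1 scaleN1r => <-.
by apply: eq_bigr => k _; case: tpermP => [->|->|].
Qed.

(** Multilinear expansion: a repeated generator kills its term, and reordering distinct generators
    costs the sign of the permutation. *)
Lemma prod_lin_comb_det m (eta : nat -> A) (w : 'I_m -> nat -> rat) :
  (forall i j, anti (eta i) (eta j)) ->
  \prod_(i < m) lin_comb m eta (w i) =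
  \det (\matrix_(i < m, j < m) w i j) *: \prod_(i < m) eta i.
Proof.
move=> h; rewrite /lin_comb bigA_distr_bigA /= (bigID (fun f => injectiveb (f : {ffun 'I_m -> 'I_m}))) /=.
rewrite [X in _ + X]big1 => [|f /injectivePn[i [j ij fij]]]; last first.
  by rewrite scaler_prod (@prod_noninj m _ i j) ?scaler0 // fij.
rewrite addr0 /determinant scaler_suml.
rewrite (reindex (@pval _)) /=; last first.
  pose in_Sn := insubd (1%g : 'S_m).
  by exists in_Sn => /= f Uf; first apply: val_inj; apply: insubdK.
under eq_bigl => s do rewrite (valP s).
apply: eq_bigr => s _; rewrite scaler_prod.
have -> : \prod_i eta (pval s i) = (-1) ^+ s *: \prod_(i < m) eta i.
  by rewrite -(@prod_perm m (fun i => eta i)) //; apply: eq_bigr => i _; rewrite pvalE.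
rewrite scalerA mulrC; congr (_ * _ *: _).
by apply: eq_bigr => i _; rewrite mxE pvalE.
Qed.

End Grassmann.

(** * A matrix model of the anticommuting variables *)

Section Block.
Variable d : nat.
Definition block (a b c e : 'M[rat]_d.+1) : 'M[rat]_((d + d.+1).+1) :=
  @block_mx _ d.+1 d.+1 d.+1 d.+1 a b c e.

Lemma blockM a b c e a' b' c' e' : block a b c e * block a' b' c' e' =
  block (a * a' + b * c') (a * b' + b * e') (c * a' + e * c') (c * b' + e * e').
Proof. exact: (@mulmx_block _ d.+1 d.+1 d.+1 d.+1 d.+1 d.+1). Qed.

Lemma blockN a b c e : - block a b c e = block (- a) (- b) (- c) (- e).
Proof. exact: (@opp_block_mx _ d.+1 d.+1 d.+1 d.+1). Qed.

Lemma block1 : 1 = block 1 0 0 1.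
Proof. exact: (@scalar_mx_block _ d.+1 d.+1 1). Qed.

Lemma block_ur0 a b c e : block a b c e = 0 -> b = 0.
Proof.
rewrite -[0 in X in X -> _](@block_mx0 _ d.+1 d.+1 d.+1 d.+1).
by move=> /(@eq_block_mx _ d.+1 d.+1 d.+1 d.+1)[].
Qed.
End Block.

(** Scalar identities will be read off as coefficients of the product of all m generators, which
    must therefore not vanish. Generators beyond the first m are 0, so that anticommutation can be
    required for all indices. *)
Lemma anti_family m : exists d (eta : nat -> 'M[rat]_d.+1),
  (forall i j, anti (eta i) (eta j)) /\ \prod_(i < m) eta i != 0.
Proof.
elim: m => [|m [d [eta [h e0]]]].
  by exists 0, (fun=> 0); rewrite big_ord0 oner_neq0 /anti mulr0 oppr0.
(* Tensor the old family with diag(1, -1) and adjoin [[0, 1], [0, 0]]. *)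
pose et i := if (i < m)%N then block (eta i) 0 0 (- eta i)
  else if i == m then block 0 1 0 0 else 0.
exists (d + d.+1)%N, et; split.
  move=> i j; rewrite /anti /et.
  case: (ltnP i m) => im; case: (ltnP j m) => jm.
  - by rewrite !blockM blockN !(mul0r, mulr0, addr0, add0r, oppr0) !mulrNN (h i j : _ = _).
  - case: eqP => _; last by rewrite mul0r mulr0 oppr0.
    by rewrite !blockM blockN !(mul0r, mulr0, addr0, add0r, oppr0) mulr1 mul1r opprK.
  - case: eqP => _; last by rewrite mul0r mulr0 oppr0.
    by rewrite !blockM blockN !(mul0r, mulr0, addr0, add0r, oppr0) mulr1 mul1r.
  - do 2 case: eqP => _; rewrite ?(mul0r, mulr0, oppr0) //.
    by rewrite !blockM blockN !(mul0r, mulr0, addr0, add0r, oppr0).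
have pr k : (k <= m)%N -> \prod_(i < k) et i =
   block (\prod_(i < k) eta i) 0 0 (\prod_(i < k) - eta i).
  elim: k => [|k IH] km; first by rewrite !big_ord0 block1.
  rewrite !big_ord_recr /= IH 1?ltnW // {1}/et km blockM.
  by rewrite !(mul0r, mulr0, addr0, add0r).
rewrite big_ord_recr /= pr // /et ltnn eqxx blockM.
rewrite !(mul0r, mulr0, addr0, add0r) mulr1.
by apply: contra e0 => /eqP/block_ur0 ->.
Qed.

Lemma expD_sq0 (A : algType rat) (a b : A) j : GRing.comm b a -> b * b = 0 ->
  (a + b) ^+ j = a ^+ j + (a ^+ j.-1 * b) *+ j.
Proof.
move=> c sq; elim: j => [|j IH]; first by rewrite !expr0 mulr0n addr0.
rewrite exprS IH mulrDl !mulrDr -!exprS -!addrA; congr (_ + _).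
have -> : b * (a ^+ j.-1 * b *+ j) = 0.
  by rewrite mulrnAr mulrA (commrX j.-1 c) -mulrA sq mulr0 mul0rn.
rewrite addr0 (commrX j c) mulrnAr mulrA /=.
case: j {IH} => [|j]; first by rewrite mulr0n add0r mulr1n.
by rewrite /= -exprS -mulrSr.
Qed.

(** * Generating function of products over subsets *)

Section Subsets.
Variable A : algType rat.
Variable v : nat -> A.
Hypothesis hv : forall i j, anti (v i) (v j).

Definition subset_poly N : {poly A} := \prod_(p < N) (1 + (v p)%:P * 'X).
Definition partial_sum N := \sum_(p < N) v p.
Definition pair_sum N := \sum_(t < N) partial_sum t * v t.

Lemma anti_partial_sum N p : anti (partial_sum N) (v p).
Proof. by apply: antiC; apply: anti_sumr => i _. Qed.

Lemma comm_pair_sum x N : (forall p, anti x (v p)) -> pair_sum N * x = x * pair_sum N.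
Proof.
move=> h; rewrite /pair_sum mulr_suml mulr_sumr; apply: eq_bigr => t _.
have hL : anti x (partial_sum t) by apply: anti_sumr.
by rewrite [RHS]mulrA (hL : _ = _) mulNr -!mulrA (h t : _ = _) mulrN opprK.
Qed.

Lemma exp_pair_sumS N j : (pair_sum N + partial_sum N * v N) ^+ j =
   pair_sum N ^+ j + (pair_sum N ^+ j.-1 * (partial_sum N * v N)) *+ j.
Proof.
apply: expD_sq0.
  have cL : pair_sum N * partial_sum N = partial_sum N * pair_sum N by rewrite comm_pair_sum // => p; apply: anti_partial_sum.
  have cv : pair_sum N * v N = v N * pair_sum N by rewrite comm_pair_sum.
  by rewrite /GRing.comm -mulrA -cv mulrA -cL mulrA.
rewrite -mulrA [v N * _]mulrA -[v N * partial_sum N]opprK -(anti_partial_sum N N : _ = _).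
by rewrite mulNr -mulrA anti_sq // mulr0 oppr0 mulr0.
Qed.

(* That is, [subset_poly N] is (1 + L X) exp(Omega X^2) with L = [partial_sum N]
   and Omega = [pair_sum N]. *)
Lemma coef_subset_poly N j : (subset_poly N)`_(j.*2) = (j`!)%:R^-1 *: pair_sum N ^+ j /\
   (subset_poly N)`_(j.*2.+1) = (j`!)%:R^-1 *: (partial_sum N * pair_sum N ^+ j).
Proof.
elim: N j => [|N IH] j.
  rewrite /subset_poly /partial_sum /pair_sum !big_ord0 mul0r scaler0 !coef1 /=.
  case: j => [|j]; first by rewrite fact0 invr1 scale1r expr0.
  by rewrite doubleS exprS mul0r scaler0.
have cf k : (subset_poly N.+1)`_k.+1 = (subset_poly N)`_k.+1 + (subset_poly N)`_k * v N.
  by rewrite /subset_poly big_ord_recr /= mulrDr mulr1 mulrA coefD coefMX coefMC.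
have f0 k : (k`!)%:R != 0 :> rat by rewrite pnatr_eq0 -lt0n fact_gt0.
have eO : pair_sum N.+1 = pair_sum N + partial_sum N * v N by rewrite /pair_sum big_ord_recr.
have eL : partial_sum N.+1 = partial_sum N + v N by rewrite /partial_sum big_ord_recr.
have cv k : v N * pair_sum N ^+ k = pair_sum N ^+ k * v N.
  by apply: (@commrX A (v N) (pair_sum N) k); rewrite /GRing.comm comm_pair_sum.
have cL k : partial_sum N * pair_sum N ^+ k = pair_sum N ^+ k * partial_sum N.
  by apply: (@commrX A (partial_sum N) (pair_sum N) k); rewrite /GRing.comm comm_pair_sum // => p; apply: anti_partial_sum.
split.
  case: j => [|j].
    rewrite fact0 invr1 scale1r expr0 /subset_poly big_ord_recr /= mulrDr mulr1 mulrA.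
    by rewrite coefD coefMX addr0 (IH 0).1 fact0 invr1 scale1r expr0.
  rewrite doubleS cf -doubleS (IH j.+1).1 (IH j).2 eO exp_pair_sumS scalerDr.
  congr (_ + _); rewrite /= -scalerAl cL mulrA.
  rewrite -scaler_nat scalerA factS natrM invfM mulrAC mulVf ?mul1r //.
  by rewrite pnatr_eq0.
rewrite cf (IH j).1 (IH j).2 eO eL exp_pair_sumS -scalerAl -scalerDr; congr (_ *: _).
rewrite mulrDr [(partial_sum N + v N) * (_ *+ _)](_ : _ = 0).
  by rewrite addr0 mulrDl cv.
have z : (partial_sum N + v N) * (partial_sum N * v N) = 0.
  rewrite mulrDl !mulrA anti_sq; last by apply: anti_sumr => i _; apply: anti_partial_sum.
  have -> : v N * partial_sum N = - (partial_sum N * v N) by rewrite (anti_partial_sum N N : _ = _) opprK.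
  by rewrite mul0r mulNr -mulrA anti_sq // mulr0 oppr0 addr0.
by rewrite mulrnAr mulrA mulrDl cv cL -mulrDr -mulrA z mulr0 mul0rn.
Qed.

Lemma subset_polyE N : subset_poly N = \sum_(S : {ffun 'I_N -> bool})
  (\prod_(p < N | S p) v p)%:P * 'X^#|[pred p | S p]|.
Proof.
pose F (p : 'I_N) b := if b then (v p)%:P * 'X else 1.
have -> : subset_poly N = \prod_(p < N) \sum_b F p b.
  by apply: eq_bigr => p _; rewrite big_bool addrC.
rewrite bigA_distr_bigA; apply: eq_bigr => S _.
rewrite -big_mkcond /= -sum1_card.
transitivity ((\prod_(p < N | S p) (v p)%:P) * 'X^(\sum_(p < N | S p) 1) : {poly A}).
  elim/big_rec3: _ => [|p y z x _ ->]; first by rewrite expr0 mulr1.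
  by rewrite add1n exprS -!mulrA [z * ('X * _)]mulrA commr_polyX -!mulrA.
by rewrite rmorph_prod.
Qed.

Lemma sum_subsets N n : \sum_(S : {ffun 'I_N -> bool} | #|[pred p | S p]| == n.*2)
  \prod_(p < N | S p) v p = (n`!)%:R^-1 *: pair_sum N ^+ n.
Proof.
rewrite -(coef_subset_poly N n).1 subset_polyE coef_sum big_mkcond; apply: eq_bigr => S _.
by rewrite coefCM coefXn eq_sym; case: eqP => _; rewrite ?mulr1 ?mulr0.
Qed.
End Subsets.

Lemma sum_pairs_rev (V : nmodType) N (K : nat -> nat -> V) :
  \sum_(t < N) \sum_(s < t) K s t =
  \sum_(t < N) \sum_(s < t) K (N.-1 - t)%N (N.-1 - s)%N.
Proof.
have w (H : nat -> nat -> V) : \sum_(t < N) \sum_(s < t) H s t =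
    \sum_(t < N) \sum_(s < N | (s < t)%N) H s t.
  apply: eq_bigr => t _.
  by rewrite (big_ord_widen N (fun s => H s t)) // ltnW.
rewrite w [RHS](w (fun s t => K (N.-1 - t)%N (N.-1 - s)%N)) (reindex_inj rev_ord_inj) /=.
under eq_bigr => t _ do rewrite (reindex_inj rev_ord_inj) /=.
rewrite (exchange_big_dep predT) //=; apply: eq_bigr => t _.
by apply: eq_big => s; [have := ltn_ord t; have := ltn_ord s; lia|
 move=> _; congr K; have := ltn_ord t; have := ltn_ord s; lia].
Qed.

Definition skew_form N (f g : nat -> rat) :=
  \sum_(t < N) \sum_(s < t) (f s * g t - f t * g s).

(** * From a Pfaffian to a determinant by parity *)

Section Pairs.
Variable A : algType rat.
Implicit Types (y e z eta : nat -> A).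

Lemma big_double (V : Type) (idx : V) (op : Monoid.law idx) n (F : nat -> V) :
  \big[op/idx]_(k < n.*2) F k = \big[op/idx]_(j < n) op (F j.*2) (F j.*2.+1).
Proof.
elim: n => [|n IH]; first by rewrite !big_ord0.
by rewrite doubleS !big_ord_recr /= IH Monoid.mulmA.
Qed.

Lemma expr_sum_sq0 z n : (forall i j, GRing.comm (z i) (z j)) ->
  (forall i, z i * z i = 0) ->
  (\sum_(i < n) z i) ^+ n = \prod_(i < n) z i *+ n`! /\ (\sum_(i < n) z i) ^+ n.+1 = 0.
Proof.
move=> c sq; elim: n => [|n [IH1 IH2]].
  by rewrite !big_ord0 expr0 mulr1n expr1.
have cS : GRing.comm (z n) (\sum_(i < n) z i) by apply: commr_sum.
rewrite !big_ord_recr /=; split; rewrite expD_sq0 ?sq //=.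
  by rewrite IH2 IH1 add0r mulrnAl -mulrnA mulnC.
by rewrite exprS IH2 mulr0 mul0r mul0rn addr0.
Qed.

Lemma comm_pair (a b u : A) : anti a u -> anti b u -> GRing.comm (a * b) u.
Proof. by move=> h1 h2; rewrite /GRing.comm -mulrA (h2 : _ = _) mulrN [a * (u * _)]mulrA (h1 : _ = _) mulNr opprK mulrA. Qed.

Lemma comm_pairs (a b u v : A) : anti a u -> anti b u -> anti a v -> anti b v ->
  GRing.comm (a * b) (u * v).
Proof. by move=> *; apply: commrM; apply: comm_pair. Qed.

(** All that matters about the reordering sign is that it is nonzero and the same for all families:
    it is applied to two families and cancels. *)
Lemma prod_pairs n : exists2 s : rat, s != 0 & forall y e,
  (forall i j, anti (e i) (y j)) ->
  \prod_(j < n) (y j * e j) = s *: (\prod_(j < n) y j * \prod_(j < n) e j).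
Proof.
elim: n => [|n [s s0 IH]].
  by exists 1 => // y e _; rewrite !big_ord0 mulr1 scale1r.
exists (s * (-1) ^+ n); first by rewrite mulf_neq0 // signr_eq0.
move=> y e h; rewrite !big_ord_recr /= IH // -scalerA -scalerAl; congr (_ *: _).
have -> : \prod_(i < n) y i * y n * (\prod_(i < n) e i * e n) =
  \prod_(i < n) y i * (y n * \prod_(i < n) e i) * e n by rewrite !mulrA.
rewrite [y n * \prod_(_ < _) _]anti_prod_ord; last by move=> i; apply: antiC; apply: h.
rewrite -scalerAr -scalerAl scalerA -expr2 sqrr_sign scale1r.
by rewrite !mulrA.
Qed.

(* The reversal p |-> N - 1 - p kills the pairings of two forms of equal parity,
   which is why a determinant appears instead of a Pfaffian. *)
Theorem exp_pair_sum_parity n N (c : nat -> nat -> rat) eta :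
  (forall k p, (p < N)%N -> c k (N.-1 - p)%N = (-1) ^+ k * c k p) ->
  (forall i j, anti (eta i) (eta j)) ->
  pair_sum (fun p => lin_comb n.*2 eta (c^~ p)) N ^+ n =
  (n`!)%:R *: (\det (\matrix_(i < n, j < n) skew_form N (c i.*2) (c j.*2.+1)) *:
     \prod_(k < n.*2) eta k).
Proof.
move=> hc he.
pose F p : A := \sum_(i < n) c i.*2 p *: eta i.*2.
pose G p : A := \sum_(j < n) c j.*2.+1 p *: eta j.*2.+1.
have vE p : lin_comb n.*2 eta (c^~ p) = F p + G p.
  by rewrite /lin_comb (big_double _ _ (fun k => c k p *: eta k)) big_split.
have aF s t : anti (F s) (F t).
  by apply: anti_sumr => i _; apply: antiZr; apply: antiC; apply: anti_sumr => j _; apply: antiZr.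
have aG s t : anti (G s) (G t).
  by apply: anti_sumr => i _; apply: antiZr; apply: antiC; apply: anti_sumr => j _; apply: antiZr.
have aFG s t : anti (F s) (G t).
  by apply: anti_sumr => i _; apply: antiZr; apply: antiC; apply: anti_sumr => j _; apply: antiZr.
have rF p : (p < N)%N -> F (N.-1 - p)%N = F p.
  by move=> hp; apply: eq_bigr => i _; rewrite hc // -signr_odd odd_double mul1r.
have rG p : (p < N)%N -> G (N.-1 - p)%N = - G p.
  move=> hp; rewrite /G -sumrN; apply: eq_bigr => i _.
  by rewrite hc // -signr_odd /= odd_double mulN1r scaleNr.
have FF0 : \sum_(t < N) \sum_(s < t) F s * F t = 0.
  apply: eq_opp0; rewrite {1}(sum_pairs_rev N (fun s t => F s * F t)) -sumrN; apply: eq_bigr => t _.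
  rewrite -sumrN; apply: eq_bigr => s _.
  by rewrite !rF ?(aF t s : _ = _) // (ltn_trans (ltn_ord s)).
have GG0 : \sum_(t < N) \sum_(s < t) G s * G t = 0.
  apply: eq_opp0; rewrite {1}(sum_pairs_rev N (fun s t => G s * G t)) -sumrN; apply: eq_bigr => t _.
  rewrite -sumrN; apply: eq_bigr => s _.
  by rewrite !rG ?mulrNN ?(aG t s : _ = _) // (ltn_trans (ltn_ord s)).
pose w i j := skew_form N (c i.*2) (c j.*2.+1).
(* Collecting terms by the odd-indexed variables turns [pair_sum] into a sum of n commuting elements
   of square zero, whose n-th power is n! times a single product. *)
pose y j : A := \sum_(i < n) w i j *: eta i.*2.
have OmE : pair_sum (fun p => lin_comb n.*2 eta (c^~ p)) N = \sum_(j < n) y j * eta j.*2.+1.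
  transitivity (\sum_(t < N) \sum_(s < t) (F s * G t - F t * G s)).
    transitivity (\sum_(t < N) \sum_(s < t) (F s * G t - F t * G s) +
        \sum_(t < N) \sum_(s < t) F s * F t + \sum_(t < N) \sum_(s < t) G s * G t).
      rewrite -!big_split /=.
      apply: eq_bigr => t _; rewrite /partial_sum mulr_suml -!big_split /=.
      apply: eq_bigr => s _; rewrite !vE mulrDl !mulrDr (aFG t s : _ = _) opprK.
      by rewrite !addrA; congr (_ + _); rewrite [RHS]addrC addrA.
    by rewrite FF0 GG0 !addr0.
  under eq_bigr => t _ do under eq_bigr => s _ do
    rewrite /F /G !mulr_suml -sumrB.
  transitivity (\sum_(t < N) \sum_(s < t) \sum_(i < n) \sum_(j < n)
      (c i.*2 s * c j.*2.+1 t - c i.*2 t * c j.*2.+1 s) *: (eta i.*2 * eta j.*2.+1)).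
    apply: eq_bigr => t _; apply: eq_bigr => s _; apply: eq_bigr => i _.
    rewrite !mulr_sumr -sumrB; apply: eq_bigr => j _.
    by rewrite -!scalerAr -!scalerAl !scalerA scalerBl ![c j.*2.+1 _ * _]mulrC.
  under eq_bigr => t _ do rewrite exchange_big /=.
  rewrite exchange_big /= [RHS](eq_bigr (fun j : 'I_n => \sum_(i < n) w i j *: (eta i.*2 * eta j.*2.+1))); last first.
    by move=> j _; rewrite mulr_suml; apply: eq_bigr => i _; rewrite scalerAl.
  rewrite [RHS]exchange_big /=; apply: eq_bigr => i _.
  under eq_bigr => t _ do rewrite exchange_big /=.
  rewrite exchange_big /=; apply: eq_bigr => j _.
  by rewrite /w /skew_form scaler_suml; apply: eq_bigr => t _; rewrite scaler_suml.
have ay j k : anti (eta k) (y j).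
  by apply: anti_sumr => i _; apply: antiZr.
have ayy i j : anti (y i) (y j).
  by apply: anti_sumr => k _; apply: antiZr; apply: antiC; apply: ay.
rewrite OmE (@expr_sum_sq0 (fun j => y j * eta j.*2.+1) n _ _).1; last first.
- move=> i; rewrite -mulrA [eta _ * (_ * _)]mulrA (ay i _ : _ = _).
  by rewrite mulNr mulrN !mulrA anti_sq // !mul0r oppr0.
- by move=> i j; apply: comm_pairs => //; apply: antiC.
rewrite -scaler_nat; congr (_ *: _).
have [e e0 hp] := prod_pairs n.
rewrite (big_double _ n eta) (hp y (fun j => eta j.*2.+1)); last by move=> i j; apply: ay.
rewrite (hp (fun j => eta j.*2) (fun j => eta j.*2.+1)); last by [].
rewrite scalerA mulrC -scalerA; congr (_ *: _).
have -> : \prod_(j < n) y j = \prod_(j < n) lin_comb n (fun i => eta i.*2) (fun i => w i j) by [].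
rewrite (@prod_lin_comb_det _ _ (fun i => eta i.*2) (fun j i => w i j)) // -scalerAl.
by congr (_ *: _); rewrite -det_tr; congr (\det _); apply/matrixP => i j; rewrite !mxE.
Qed.

End Pairs.

(** * The number of chains as a determinant *)

Section Transfer.
Variable A : algType rat.
Variables (h w : nat -> A) (s : nat -> bool).
Hypothesis hS : forall p, h p.+1 = h p + w p.
Hypothesis ha : forall p, h p * h p = 0.

(* Entry (e, e') is the contribution of [p] to a run going from level e to e'. *)
Definition transfer_mx (p : nat) (b : bool) : 'M[A]_2 :=
  \matrix_(i, j) (if level_step (s p) b (i == 1) == Some (j == 1) then
                     if b then w p else 1 else 0).

Lemma prod_transfer_mx (f : nat -> bool) n (j : 'I_2) : (\prod_(p < n) transfer_mx p (f p)) 0 j =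
  if level_run s f n == Some (j == 1) then \prod_(p < n | f p) w p else 0.
Proof.
elim: n j => [|n IH] j.
  by rewrite !big_ord0 mxE; case: j => -[|[|//]] ?.
rewrite big_ord_recr /= -mulmxE mxE big_ord_recl big_ord1 !IH !mxE /=.
rewrite [in RHS]big_mkcond big_ord_recr -big_mkcond /=.
case: (level_run s f n) => [[]|] /=; rewrite ?mul0r ?add0r ?addr0 //=.
  by case: eqP; rewrite ?mulr0 //; case: (f n).
by case: eqP; rewrite ?mulr0 //; case: (f n).
Qed.

Definition transfer_total n : 'M[A]_2 := \prod_(p < n) (transfer_mx p false + transfer_mx p true).

Lemma transfer_total_rec n : transfer_total n.+1 0 0 = (if s n then transfer_total n 0 0 * w n else transfer_total n 0 0 + transfer_total n 0 1 * w n) /\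
  transfer_total n.+1 0 1 = if s n then transfer_total n 0 0 else transfer_total n 0 1.
Proof.
rewrite /transfer_total big_ord_recr /= -mulmxE !mxE !big_ord_recl !big_ord0 !mxE /= /level_step.
have -> : lift ord0 ord0 = 1 :> 'I_2 by apply: val_inj.
by split; case: (s n) => /=; rewrite ?(mulr0, mulr1, mul0r, addr0, add0r) //.
Qed.

(** Row 0 of [transfer_total] sums products of increments over the sets compatible with s, according
    to the final level. The invariant survives off s because h n = h n.+1 - w n redistributes
    between the two entries, and at an element of s because h n has square zero and only the first
    entry remains. *)
Lemma prod_transfer n : \prod_(p < n | s p) h p =
  (-1) ^+ (\sum_(p < n) s p)%N *: (transfer_total n 0 0 - transfer_total n 0 1 * h n).
Proof.
elim: n => [|n IH].
  by rewrite /transfer_total !big_ord0 !mxE /= mul0r subr0 scale1r.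
rewrite big_mkcond big_ord_recr -big_mkcond [in RHS]big_ord_recr /= IH.
have [-> ->] := transfer_total_rec n; case: (s n) => /=.
  rewrite addn1 exprS mulN1r scaleNr -scalerN opprB -scalerAl; congr (_ *: _).
  by rewrite mulrBl -mulrA ha mulr0 subr0 hS mulrDr addrK.
by rewrite mulr1 addn0 hS mulrDr opprD addrACA subrr addr0.
Qed.

Lemma transfer_total_sum N (j : 'I_2) : transfer_total N 0 j =
  \sum_(S' : bits N | level_run s (bit_at S') N == Some (j == 1)) \prod_(p < N | S' p) w p.
Proof.
have -> : transfer_total N = \prod_(p < N) \sum_b transfer_mx p b by apply: eq_bigr => p _; rewrite big_bool addrC.
rewrite bigA_distr_bigA summxE [RHS]big_mkcond; apply: eq_bigr => S' _.
rewrite (eq_bigr (fun p : 'I_N => transfer_mx p (bit_at S' p))); last by move=> p _; rewrite bit_atE.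
rewrite prod_transfer_mx; case: ifP => // _; apply: eq_bigl => p; exact: bit_atE.
Qed.
End Transfer.

Section Counting.
Variable A : algType rat.

(** The enumeration r of S is left existential: the lemma serves to show that a product vanishes
    when the coefficients of one generator are all zero. *)
Lemma prod_subset_det N (S : bits N) m (eta : nat -> A) (u : nat -> nat -> rat) :
  (forall i j, anti (eta i) (eta j)) -> weight S = m ->
  exists r : 'I_m -> 'I_N, \prod_(p < N | S p) lin_comb m eta (u p) =
    \det (\matrix_(i < m, j < m) u (r i) j) *: \prod_(i < m) eta i.
Proof.
move=> he; have -> : weight S = size (enum [pred p | S p]) by rewrite -cardE.
move=> <-; exists (tnth (in_tuple (enum [pred p | S p]))).
rewrite -(prod_lin_comb_det (fun i => u (tnth (in_tuple (enum [pred p | S p])) i))) //.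
rewrite -(big_tnth _ _ _ xpredT (fun p : 'I_N => lin_comb _ eta (u p))).
generalize (size (enum [pred p | S p])) => k; rewrite /enum_mem big_filter.
by rewrite [index_enum _]unlock.
Qed.

Lemma det_col0 m (u : 'I_m.+1 -> nat -> rat) j :
  (forall i, u i (j : 'I_m.+1) = 0) -> \det (\matrix_(i, j) u i j) = 0.
Proof.
by move=> h; rewrite (expand_det_col _ j) big1 // => i _; rewrite mxE h mul0r.
Qed.

Lemma lin_comb_shift m (eta : nat -> A) u : lin_comb m (fun i => eta i.+1) u =
  lin_comb m.+1 eta (fun i => if i is i'.+1 then u i' else 0).
Proof. by rewrite /lin_comb big_ord_recl scale0r add0r. Qed.

Theorem pattern_count_det N k (eta : nat -> A) (S : bits N) :
  (forall i j, anti (eta i) (eta j)) -> weight S = k ->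
  \prod_(p < N | S p) lin_comb k eta (fun i => 'C(p, i)%:R) =
  (pattern_count k S)%:R *: \prod_(i < k) eta i.
Proof.
elim: k eta S => [|k IH] eta S he hw.
  have /eqP := hw; rewrite weight0 /= => e; rewrite e big_ord0 (eqP e).
  by rewrite big_pred0 ?scale1r // => p; rewrite ffunE.
(* By Pascal's rule the increments of [h] are the forms for [k] variables, so
   [prod_transfer] turns the sum over interlacing sets into one product. *)
pose h p := lin_comb k.+1 eta (fun i => 'C(p, i)%:R).
pose w p := lin_comb k (fun i => eta i.+1) (fun i => 'C(p, i)%:R).
have hS p : h p.+1 = h p + w p.
  rewrite /h /w lin_comb_shift /lin_comb -big_split /=; apply: eq_bigr => i _.
  rewrite -scalerDl; congr (_ *: _); case: (i : nat) => [|j]; first by rewrite !bin0 addr0.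
  by rewrite binS natrD addrC.
have hh p : h p * h p = 0 by apply: anti_sq; apply: lin_comb_anti.
transitivity (\prod_(p < N | bit_at S p) h p); first by apply: eq_bigl => p; rewrite bit_atE.
rewrite (prod_transfer (bit_at S) hS hh) -weightE hw !transfer_total_sum /=.
(* Sets ending at level 0 have k + 1 elements, too many for forms in the k variables eta 1, ..., eta
   k: the corresponding minor has a zero column. *)
rewrite big1 => [|S' /eqP/level_run_count]; last first.
  rewrite -!weightE addn0 hw => /esym hw'.
  rewrite /w; under eq_bigr => p _ do rewrite lin_comb_shift.
  have [r ->] := @prod_subset_det N S' k.+1 eta (fun p i => if i is i'.+1 then 'C(p, i')%:R else 0) he hw'.
  rewrite (@det_col0 _ (fun i j => if j is j'.+1 then 'C(r i, j')%:R else 0) ord0) ?scale0r //.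
rewrite sub0r.
rewrite (eq_bigr (fun S' => (pattern_count k S')%:R *: \prod_(i < k) eta i.+1)); last first.
  move=> S' /(@interlacing_weight N S S'); rewrite hw => -[/esym hw'].
  by rewrite /w IH.
rewrite -scaler_suml -natr_sum -/(interlacing S _) -scalerAl.
(* The product already contains eta 1, ..., eta k, so only the eta 0 term of h N, with coefficient
   'C(N, 0) = 1, survives. *)
have -> : \prod_(i < k) eta i.+1 * h N = \prod_(i < k) eta i.+1 * eta 0.
  rewrite /h /lin_comb big_ord_recl bin0 scale1r mulrDr mulr_sumr [X in _ + X]big1 ?addr0 // => j _.
  rewrite -scalerAr; apply/eqP; rewrite scaler_eq0; apply/orP; right; apply/eqP.
  pose H (i : nat) := eta (if i == k then j.+1 else i.+1).
  have := @prod_noninj A k.+1 (fun i => H i) (widen_ord (leqnSn k) j) ord_max.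
  rewrite big_ord_recr /= => <- //; last by move=> *; apply: he.
  - rewrite {2}/H eqxx; congr (_ * _); apply: eq_bigr => i _; rewrite /H.
    by have := ltn_ord i; case: eqP => // ->; rewrite ltnn.
  - by rewrite -val_eqE /= neq_ltn ltn_ord.
  - by rewrite /H eqxx; have := ltn_ord j; case: eqP => // ->; rewrite ltnn.
have e : eta 0 * \prod_(i < k) eta i.+1 = (-1) ^+ k *: (\prod_(i < k) eta i.+1 * eta 0).
  by rewrite (anti_prod_ord k (F := fun i => eta i.+1)).
rewrite big_ord_recl /= e exprS mulN1r scaleNr scalerN opprK !scalerA mulrC.
by [].
Qed.
End Counting.

(** * Change of basis from binomial coefficients to polynomials with a symmetry *)

(** Coefficients of the polynomial with roots rs in the basis 'C(p, i), obtained from (p - r) 'C(p,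
    i) = (i - r) 'C(p, i) + (i + 1) 'C(p, i + 1). *)
Fixpoint newton (rs : seq rat) (i : nat) : rat :=
  if rs is r :: rs' then i%:R * newton rs' i.-1 + (i%:R - r) * newton rs' i
  else (i == 0)%:R.

Lemma newton_gt rs i : (size rs < i)%N -> newton rs i = 0.
Proof.
elim: rs i => [|r rs IH] [|i] //= h.
by rewrite !IH ?mulr0 ?addr0 //; lia.
Qed.

Lemma newton_size rs : newton rs (size rs) = ((size rs)`!)%:R.
Proof.
elim: rs => [//|r rs IH] /=.
by rewrite IH newton_gt // mulr0 addr0 factS natrM.
Qed.

Lemma newtonE rs m p : (size rs < m)%N ->
  \prod_(r <- rs) (p%:R - r) = \sum_(i < m) newton rs i * 'C(p, i)%:R.
Proof.
elim: rs m => [|r rs IH] [|m] // h.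
  rewrite big_nil big_ord_recl /= bin0 mulr1 big1 ?addr0 // => i _.
  by rewrite mul0r.
rewrite big_cons (IH m) //= big_ord_recl /= mul0r add0r bin0 mulr1 sub0r.
have split : \sum_(i < m) newton rs i * 'C(p, i)%:R =
   newton rs 0 + \sum_(i < m) newton rs i.+1 * 'C(p, i.+1)%:R.
  case: m h => [//|m] h.
  rewrite big_ord_recl bin0 mulr1; congr (_ + _).
  rewrite big_ord_recr /= newton_gt ?mul0r ?addr0 //.
transitivity (\sum_(i < m) newton rs i * ((i%:R - r) * 'C(p, i)%:R + i.+1%:R * 'C(p, i.+1)%:R)).
  rewrite mulr_sumr; apply: eq_bigr => i _.
  have -> : i.+1%:R * 'C(p, i.+1)%:R = (p%:R - i%:R) * 'C(p, i)%:R :> rat.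
    rewrite -natrM mul_bin_left; case: (leqP i p) => ip; first by rewrite natrM natrB.
    by rewrite bin_small // muln0 mulr0.
  by ring.
rewrite (eq_bigr (fun i : 'I_m => newton rs i * ((i%:R - r) * 'C(p, i)%:R) +
  newton rs i * (i.+1%:R * 'C(p, i.+1)%:R))); last by move=> i _; rewrite mulrDr.
rewrite big_split /=.
have -> : \sum_(i < m) newton rs i * ((i%:R - r) * 'C(p, i)%:R) =
  - r * newton rs 0 + \sum_(i < m) newton rs i.+1 * ((i.+1%:R - r) * 'C(p, i.+1)%:R).
  case: m h {split} => [//|m] h.
  rewrite big_ord_recl bin0 [in RHS]big_ord_recr /= (@newton_gt rs m.+1) // mul0r addr0 sub0r.
  by congr (_ + _); ring.
rewrite -addrA -big_split /=; congr (_ + _); apply: eq_bigr => i _.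
by rewrite /bump /=; ring.
Qed.

Section Change.
Variables (n N : nat) (c U : nat -> nat -> rat) (a : pred nat).
Hypothesis U_tri : forall k i, (k < i)%N -> U k i = 0.
Hypothesis U_diag : forall k, U k k = k`!%:R.
Hypothesis cE : forall k p, (k < n.*2)%N ->
  c k p = \sum_(i < n.*2) U k i * 'C(p, i)%:R.
Hypothesis c_rev : forall k p, (p < N)%N -> c k (N.-1 - p)%N = (-1) ^+ k * c k p.
Hypothesis a_rev : forall p, (p < N)%N -> a (N.-1 - p)%N = a p.

(** The mask a lets one statement count all patterns and those avoiding the middle. Passing from
    binomials to c is a triangular change of variables, whose diagonal contributes the product of
    factorials. *)
Theorem sum_pattern_count_det :
  (\sum_(S : bits N | [forall p, S p ==> a p]) pattern_count n.*2 S)%:R * \prod_(k < n.*2) k`!%:R =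
  \det (\matrix_(i < n, j < n)
     skew_form N (fun p => (a p)%:R * c i.*2 p) (fun p => (a p)%:R * c j.*2.+1 p)) :> rat.
Proof.
have [d [eta [he top0]]] := anti_family n.*2.
pose m := n.*2; rewrite -/m in top0 *.
pose c' k p := (a p)%:R * c k p.
pose v p := lin_comb m eta (c'^~ p).
have hv i j : anti (v i) (v j) by apply: lin_comb_anti.
have hc' k p : (p < N)%N -> c' k (N.-1 - p)%N = (-1) ^+ k * c' k p.
  by move=> hp; rewrite /c' a_rev // c_rev // mulrCA.
have := sum_subsets hv N n; rewrite -/m (exp_pair_sum_parity n hc' he).
rewrite (scalerA (n`!%:R)^-1) mulVf ?pnatr_eq0 -?lt0n ?fact_gt0 // scale1r => e.
have e1 (x y : rat) : x *: (\prod_(k < m) eta k) = y *: (\prod_(k < m) eta k) -> x = y.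
  move/eqP; rewrite -subr_eq0 -scalerBl scaler_eq0 (negbTE top0) orbF subr_eq0.
  by move/eqP.
apply: e1; rewrite -e; pose et i := lin_comb m eta (fun k => U k i).
have het i j : anti (et i) (et j) by apply: lin_comb_anti.
have vE p : v p = (a p)%:R *: lin_comb m et (fun i => 'C(p, i)%:R).
  rewrite /v /lin_comb scaler_sumr.
  transitivity (\sum_(k < m) \sum_(i < m) ((a p)%:R * (U k i * 'C(p, i)%:R)) *: eta k).
    apply: eq_bigr => k _; rewrite /c' cE // -scaler_suml; congr (_ *: _).
    by rewrite mulr_sumr.
  rewrite exchange_big /=; apply: eq_bigr => i _; rewrite /et /lin_comb !scaler_sumr.
  by apply: eq_bigr => k _; rewrite !scalerA [U k i * _]mulrC mulrA.
have etE : \prod_(i < m) et i = (\prod_(k < m) k`!%:R) *: \prod_(k < m) eta k.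
  rewrite /et (@prod_lin_comb_det _ _ eta (fun i k => U k i)) //; congr (_ *: _).
  rewrite -det_tr det_trig; last first.
    by apply/is_trig_mxP => i j ij; rewrite !mxE U_tri.
  by apply: eq_bigr => k _; rewrite !mxE U_diag.
rewrite -scalerA -etE natr_sum scaler_suml.
rewrite [LHS](bigID (fun S : bits N => weight S == m)) /= [X in _ + X]big1 ?addr0; last first.
  by move=> S /andP[_ /pattern_count_weight ->]; rewrite scale0r.
rewrite [RHS](bigID (fun S : bits N => [forall p, S p ==> a p])) /=.
rewrite [X in _ = _ + X]big1 ?addr0; last first.
  move=> S /andP[_]; rewrite negb_forall => /existsP[p]; rewrite negb_imply => /andP[Sp ap].
  under eq_bigr => q _ do rewrite vE.
  by rewrite scaler_prod (bigD1 p) //= (negbTE ap) mul0r scale0r.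
apply: eq_big => [S|S /andP[/forallP hS /eqP hw]]; first by rewrite andbC.
rewrite -(pattern_count_det het hw); apply: eq_bigr => p Sp.
by rewrite vE; have := hS p; rewrite Sp /= => ->; rewrite scale1r.
Qed.
End Change.

(** * Even discrete Chebyshev polynomials *)

(** [phi] is even, [gam] is odd and [psi] is symmetric about -1/2. The sum of psi at s and s - 1 is
    a multiple of phi and the difference a multiple of an odd gam, so psi mediates between the even
    and odd basis polynomials under summation. *)
Definition phi l (s : rat) : rat := \prod_(i < l) (i%:R ^+ 2 - s ^+ 2).
Definition psi l (s : rat) : rat := \prod_(i < l) (i%:R * (i%:R + 1) - s * (s + 1)).
Definition gam l (s : rat) : rat := s * \prod_(i < l) (s ^+ 2 - i.+1%:R ^+ 2).

Lemma phiS l s : phi l.+1 s = phi l s * (l%:R ^+ 2 - s ^+ 2).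
Proof. by rewrite /phi big_ord_recr. Qed.

Lemma psiS l s : psi l.+1 s = psi l s * (l%:R * (l%:R + 1) - s * (s + 1)).
Proof. by rewrite /psi big_ord_recr. Qed.

Lemma gamS l s : gam l.+1 s = gam l s * (s ^+ 2 - l.+1%:R ^+ 2).
Proof. by rewrite /gam big_ord_recr mulrA. Qed.

Lemma phi_gam l s : phi l.+1 s = (-1) ^+ l.+1 * s * gam l s.
Proof.
elim: l => [|l IH].
  by rewrite phiS /phi /gam !big_ord0; ring.
by rewrite phiS IH gamS !exprS; ring.
Qed.

Lemma psi_shift l s : psi l.+1 s = (-1) ^+ l * gam l s * (- s - l.+1%:R) /\
  psi l.+1 (s - 1) = (-1) ^+ l * gam l s * (l.+1%:R - s).
Proof.
elim: l => [|l [IH1 IH2]].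
  by rewrite !psiS /psi /gam !big_ord0; split; ring.
by rewrite psiS IH1 [psi _ (s - 1)]psiS IH2 gamS !exprS; split; ring.
Qed.

Lemma psi_add l s : psi l s + psi l (s - 1) = 2%:R * phi l s.
Proof.
case: l => [|l]; first by rewrite /psi /phi !big_ord0; ring.
by have [-> ->] := psi_shift l s; rewrite phi_gam exprS; ring.
Qed.

Lemma psi_sub l s : psi l.+1 (s - 1) - psi l.+1 s = 2%:R * (-1) ^+ l * l.+1%:R * gam l s.
Proof. by have [-> ->] := psi_shift l s; ring. Qed.

Lemma psi_subs l s : s * (psi l s - psi l (s - 1)) = 2%:R * l%:R * phi l s.
Proof.
case: l => [|l]; first by rewrite /psi !big_ord0; ring.
by rewrite -opprB psi_sub phi_gam exprS; ring.
Qed.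

Lemma phi_psi l s : phi l.+1 s = s * (l%:R - s) * psi l s /\
  phi l.+1 (s + 1) = - (s + 1) * (s + l.+1%:R) * psi l s.
Proof.
elim: l => [|l [IH1 IH2]].
  by rewrite !phiS /phi /psi !big_ord0; split; ring.
by rewrite phiS IH1 [phi _ (s + 1)]phiS IH2 psiS; split; ring.
Qed.

Lemma phi_diff l s : phi l.+1 (s + 1) - phi l.+1 s = - (l.+1%:R * (2%:R * s + 1) * psi l s).
Proof. by have [-> ->] := phi_psi l s; ring. Qed.

Lemma phi0 l : phi l 0 = (l == 0)%:R.
Proof.
case: l => [|l]; first by rewrite /phi big_ord0.
by rewrite (phi_psi l 0).1 !mul0r.
Qed.

(* Equations and induction hypotheses slow lra down considerably. *)
Ltac nonzero := repeat (apply/andP; split); try assumption;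
  try (repeat match goal with
       | H : _ -> _ |- _ => clear H
       | H : _ = _ |- _ => clear H end;
       apply: lt0r_neq0; lra).

Section Legendre.
Variable M : nat.
Notation m := (M%:R : rat).

Definition weight_fun s : rat := (m - s) * (m + 1 + s).
(** The second-order difference operator of which the discrete Chebyshev polynomials on {-M, ..., M}
    are eigenfunctions. *)
Definition diff_op (f : rat -> rat) s :=
  weight_fun s * (f (s + 1) - f s) + weight_fun (- s) * (f (s - 1) - f s).

(** The basis phi is chosen for this: the operator is bidiagonal on it, so the coefficients of an
    eigenfunction obey a first-order recurrence and are hypergeometric. *)
Lemma diff_op_phi l s : diff_op (phi l.+1) s =
  - (2%:R * l.+1%:R * (2%:R * l.+1%:R + 1)) * phi l.+1 s
  - 2%:R * l.+1%:R * (2%:R * l.+1%:R - 1) * ((m + l.+1%:R) * (m - l%:R)) * phi l s.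
Proof.
have e1 := phi_diff l s; have := phi_diff l (s - 1); rewrite subrK => e2.
rewrite /diff_op e1 -[phi l.+1 (s - 1) - _]opprB e2.
have p0 := psiS l s; have p1 := psiS l (s - 1).
have a0 := psi_add l s; have a1 := psi_add l.+1 s.
have s0 := psi_subs l s; have s1 := psi_subs l.+1 s.
have -> : weight_fun s = (m + l.+1%:R) * (m - l%:R) + (l%:R * (l%:R + 1) - s * (s + 1)) by rewrite /weight_fun; ring.
have -> : weight_fun (- s) = (m + l.+1%:R) * (m - l%:R) + (l%:R * (l%:R + 1) - (s - 1) * (s - 1 + 1)) by rewrite /weight_fun; ring.
set K := (m + _) * _.
transitivity (- l.+1%:R * (2%:R * (s * (psi l.+1 s - psi l.+1 (s - 1))) + (psi l.+1 s + psi l.+1 (s - 1))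
  + K * (2%:R * (s * (psi l s - psi l (s - 1))) + (psi l s + psi l (s - 1))))).
  by rewrite p0 p1; ring.
by rewrite a0 a1 s0 s1; ring.
Qed.

Definition gram_num k l : rat :=
  (-1) ^+ l * 'C(k, l)%:R * poch (k%:R + 2%:R^-1) l / poch 2%:R^-1 l.

Lemma pochS x l : poch x l.+1 = poch x l * (x + l%:R).
Proof. by rewrite /poch big_ord_recr. Qed.

Lemma poch_gt0 x l : 0 < x -> 0 < poch x l.
Proof. by move=> x0; apply: prodr_gt0 => i _; rewrite ltr_wpDr // ler0n. Qed.

Lemma binS_natr k l : l.+1%:R * 'C(k, l.+1)%:R = (k%:R - l%:R) * 'C(k, l)%:R :> rat.
Proof.
rewrite -natrM mul_bin_left; case: (leqP l k) => lk; first by rewrite natrM natrB.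
by rewrite bin_small // muln0 mulr0.
Qed.

Lemma natS_neq0 (a : nat) : (a.+1%:R : rat) != 0. Proof. by rewrite pnatr_eq0. Qed.

Lemma gram_numS k l : gram_num k l.+1 = gram_num k l * ((l%:R - k%:R) * (2%:R * k%:R + 1 + 2%:R * l%:R)
   / ((2%:R * l%:R + 1) * l.+1%:R)).
Proof.
have n1 := natS_neq0 l; have l0 := ler0n rat l.
have n2 : poch 2%:R^-1 l != 0 by rewrite gt_eqF ?poch_gt0.
have e : 'C(k, l.+1)%:R = (k%:R - l%:R) * 'C(k, l)%:R / l.+1%:R :> rat.
  by rewrite -binS_natr mulrC mulKf.
by rewrite /gram_num e !pochS exprS; field; nonzero.
Qed.

Lemma gram_num0 k : gram_num k 0 = 1.
Proof. by rewrite /gram_num bin0 /poch !big_ord0 expr0 !mulr1. Qed.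

Lemma gram_num_gt k l : (k < l)%N -> gram_num k l = 0.
Proof. by move=> h; rewrite /gram_num bin_small // mulr0 !mul0r. Qed.

(** Chu-Vandermonde summation. Pascal's rule splits the sum into the one for k and a multiple of the
    one for k with b and c both raised by 1. *)
Lemma chu k (b c : rat) : 0 < c ->
  \sum_(l < k.+1) (-1) ^+ l * 'C(k, l)%:R * poch b l / poch c l = poch (c - b) k / poch c k.
Proof.
elim: k b c => [|k IH] b c c0.
  by rewrite big_ord_recl big_ord0 bin0 /poch !big_ord0 !mulr1 addr0.
have c1 : 0 < c + 1 by lra.
have pS x l : poch x l.+1 = x * poch (x + 1) l.
  rewrite /poch big_ord_recl addr0; congr (_ * _); apply: eq_bigr => i _.
  by rewrite /= -natr1; ring.
transitivity (\sum_(l < k.+1) (-1) ^+ l * 'C(k, l)%:R * poch b l / poch c l -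
   b / c * \sum_(l < k.+1) (-1) ^+ l * 'C(k, l)%:R * poch (b + 1) l / poch (c + 1) l).
  rewrite big_ord_recl bin0 /=.
  under eq_bigr => l _ do rewrite /bump /= add1n binS natrD mulrDr !mulrDl.
  rewrite big_split /= addrA; congr (_ + _).
    rewrite [in RHS]big_ord_recl bin0; congr (_ + _).
    by rewrite big_ord_recr /= bin_small // mulr0 !mul0r addr0.
  rewrite mulr_sumr -sumrN; apply: eq_bigr => l _.
  rewrite !pS exprS; field.
  by rewrite !gt_eqF // ?poch_gt0.
rewrite !IH // (_ : c + 1 - (b + 1) = c - b); last by ring.
have p0 : poch c k != 0 by rewrite gt_eqF ?poch_gt0.
have p1 : poch (c + 1) k != 0 by rewrite gt_eqF ?poch_gt0.
have k0 := ler0n rat k; have ck : c + k%:R != 0 by apply: lt0r_neq0; lra.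
have cn : c != 0 by apply: lt0r_neq0; lra.
have e : poch c k * (c + k%:R) = c * poch (c + 1) k by rewrite -pochS pS.
have -> : poch c k = c * poch (c + 1) k / (c + k%:R) by rewrite -e mulfK.
by rewrite !pochS -(mulfK ck (poch c k)) e; field; nonzero.
Qed.

Lemma sum_gram_num k : \sum_(l < k.+1) gram_num k l = (-1) ^+ k * k`!%:R / poch 2%:R^-1 k.
Proof.
rewrite /gram_num chu // (_ : _ - _ = - k%:R); last by ring.
congr (_ / _); rewrite /poch; elim: k => [|k IH]; first by rewrite big_ord0 mulr1.
rewrite big_ord_recl addr0 (eq_bigr (fun j : 'I_k => - k%:R + j%:R)).
  by rewrite IH exprS factS natrM; ring.
by move=> i _; rewrite /= /bump /= add1n -!natr1; ring.
Qed.

Definition gram_coef k l := gram_num k l / psi l m.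
(* The discrete Chebyshev (Gram) polynomial of degree 2k on {-M, ..., M}, scaled to
   be 1 at 0, as a terminating 4F3 series. *)
Definition gram k s := \sum_(l < k.+1) gram_coef k l * phi l s.

Lemma psiS_M l : psi l.+1 m = psi l m * ((l%:R - m) * (m + l.+1%:R)).
Proof. by rewrite psiS -natr1; ring. Qed.

Lemma psi_neq0 l : (l <= M)%N -> psi l m != 0.
Proof.
elim: l => [|l IH] h; first by rewrite /psi big_ord0 oner_neq0.
rewrite psiS_M !mulf_neq0 ?IH 1?ltnW //.
  by rewrite subr_eq0 eqr_nat ltn_eqF.
by rewrite -natrD pnatr_eq0; lia.
Qed.

Lemma gramE K k s : (k < K)%N -> gram k s = \sum_(l < K) gram_coef k l * phi l s.
Proof.
move=> h; rewrite /gram (big_ord_widen K (fun l => gram_coef k l * phi l s)) // big_mkcond.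
apply: eq_bigr => l _; case: ltnP => // hl.
by rewrite /gram_coef gram_num_gt // !mul0r.
Qed.

Lemma natr_ltM l : (l < M)%N -> l%:R + 1 <= m.
Proof. by move=> h; rewrite natr1 ler_nat. Qed.

Lemma gram_coefS k l : (l < M)%N -> gram_coef k l.+1 * (2%:R * l%:R + 1) * l.+1%:R * (m - l%:R) * (m + l.+1%:R) =
  gram_coef k l * (k%:R - l%:R) * (2%:R * k%:R + 1 + 2%:R * l%:R).
Proof.
move=> h; have := natr_ltM h => h'; have l0 := ler0n rat l.
have p0 := psi_neq0 (ltnW h); have n1 := natS_neq0 l.
have p1 : l%:R - m != 0 by apply: ltr0_neq0; lra.
have p2 : m + l.+1%:R != 0 by apply: lt0r_neq0; rewrite -natr1; lra.
by rewrite /gram_coef gram_numS psiS_M; field; nonzero.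
Qed.

Lemma diff_op_gram k s : (k <= M)%N -> diff_op (gram k) s = - (2%:R * k%:R * (2%:R * k%:R + 1)) * gram k s.
Proof.
move=> hk.
have -> : diff_op (gram k) s = \sum_(l < k.+1) gram_coef k l * diff_op (phi l) s.
  rewrite /diff_op /gram -!sumrB !mulr_sumr -big_split /=; apply: eq_bigr => l _; ring.
(* The eigenvalue is split by 2k(2k + 1) - 2l(2l + 1) = 2(k - l)(2k + 1 + 2l). The second sum has no
   term l = k and, shifted by one, matches the lower-order parts of [diff_op_phi] through
   [gram_coefS]. *)
transitivity (\sum_(l < k.+1) (- (2%:R * l%:R * (2%:R * l%:R + 1))) * (gram_coef k l * phi l s) +
   \sum_(l < k.+1) (- (2%:R * (k%:R - l%:R) * (2%:R * k%:R + 1 + 2%:R * l%:R))) * (gram_coef k l * phi l s)).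
  rewrite [LHS]big_ord_recl [X in _ = X + _]big_ord_recl [X in _ = _ + X]big_ord_recr /=.
  have -> : diff_op (phi 0) s = 0 by rewrite /diff_op /phi !big_ord0; ring.
  have -> : - (2%:R * 0 * (2%:R * 0 + 1)) * (gram_coef k 0 * phi 0 s) = 0 by ring.
  have -> : - (2%:R * (k%:R - k%:R) * (2%:R * k%:R + 1 + 2%:R * k%:R)) * (gram_coef k k * phi k s) = 0.
    by ring.
  rewrite mulr0 !add0r addr0 -big_split /=.
  apply: eq_bigr => l _; rewrite /bump /= add1n diff_op_phi mulrBr.
  have := @gram_coefS k l (leq_trans (ltn_ord l) hk) => e.
  transitivity (- (2%:R * l.+1%:R * (2%:R * l.+1%:R + 1)) * (gram_coef k l.+1 * phi l.+1 s) -
    2%:R * (gram_coef k l.+1 * (2%:R * l%:R + 1) * l.+1%:R * (m - l%:R) * (m + l.+1%:R)) * phi l s).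
    ring.
  by rewrite e; ring.
rewrite -big_split /gram mulr_sumr; apply: eq_bigr => l _ /=; ring.
Qed.

Lemma poch_shift (x : rat) l : poch x l.+1 = x * poch (x + 1) l.
Proof.
rewrite /poch big_ord_recl addr0; congr (_ * _); apply: eq_bigr => i _.
by rewrite /= -natr1; ring.
Qed.

(** Contiguity relations, here and below, reduce the coefficients with neighbouring indices to a
    common one, so that the three-term recurrence can be checked coefficientwise as a rational
    identity. *)
Lemma gram_numSS k l : gram_num k.+1 l.+1 = - gram_num k l *
  (k.+1%:R * (2%:R * k%:R + 1 + 2%:R * l%:R) * (2%:R * k%:R + 3%:R + 2%:R * l%:R)) /
  (l.+1%:R * (2%:R * k%:R + 1) * (2%:R * l%:R + 1)).
Proof.
have l0 := ler0n rat l; have k0 := ler0n rat k.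
have p0 : poch 2%:R^-1 l != 0 by rewrite gt_eqF ?poch_gt0.
have eb : 'C(k.+1, l.+1)%:R = k.+1%:R * 'C(k, l)%:R / l.+1%:R :> rat.
  by rewrite -natrM mul_bin_diag natrM mulrC mulKf ?natS_neq0.
have e : poch (k.+1%:R + 2%:R^-1) l.+1 = poch (k%:R + 2%:R^-1) l * (k%:R + 2%:R^-1 + l%:R) *
   (k%:R + 2%:R^-1 + l.+1%:R) / (k%:R + 2%:R^-1).
  have := poch_shift (k%:R + 2%:R^-1) l.+1.
  rewrite (_ : k%:R + 2%:R^-1 + 1 = k.+1%:R + 2%:R^-1); last by ring.
  have x0 : k%:R + 2%:R^-1 != 0 :> rat by apply: lt0r_neq0; lra.
  by move=> e0; apply: (mulfI x0); rewrite -e0 !pochS; field; nonzero.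
by rewrite /gram_num eb e pochS exprS; field; nonzero.
Qed.

Lemma gram_num_predS k l : gram_num k l.+1 = - gram_num k.+1 l *
  ((k.+1%:R - l%:R) * (k%:R - l%:R) * (2%:R * k%:R + 1)) /
  (k.+1%:R * l.+1%:R * (2%:R * l%:R + 1)).
Proof.
have l0 := ler0n rat l; have k0 := ler0n rat k.
have p0 : poch 2%:R^-1 l != 0 by rewrite gt_eqF ?poch_gt0.
have eb : 'C(k, l.+1)%:R = (k%:R - l%:R) * (k.+1%:R - l%:R) * 'C(k.+1, l)%:R / (k.+1%:R * l.+1%:R) :> rat.
  have e1 := binS_natr k l; have e2 := binS_natr k.+1 l.
  have e3 : l.+1%:R * 'C(k.+1, l.+1)%:R = k.+1%:R * 'C(k, l)%:R :> rat.
    by rewrite -!natrM mul_bin_diag.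
  rewrite e3 in e2; apply: (@mulfI _ (k.+1%:R * l.+1%:R)); first by rewrite mulf_neq0 ?natS_neq0.
  rewrite -mulrA e1 mulrCA e2; field; nonzero.
have e : poch (k%:R + 2%:R^-1) l.+1 = poch (k.+1%:R + 2%:R^-1) l * (k%:R + 2%:R^-1).
  by rewrite poch_shift mulrC; congr (poch _ _ * _); ring.
by rewrite /gram_num eb e pochS exprS; field; nonzero.
Qed.

(* The coefficients c_j in p_(j+1) = s p_j - c_j p_(j-1) for the monic discrete
   Chebyshev polynomials p_j; two steps give the recurrence for [gram]. *)
Definition rec_coef (k : nat) : rat :=
  k%:R ^+ 2 * ((2%:R * m + 1) ^+ 2 - k%:R ^+ 2) / (4%:R * (4%:R * k%:R ^+ 2 - 1)).

Lemma neq0_4k1 (k : nat) : 4%:R * k%:R - 1 != 0 :> rat.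
Proof.
by case: k => [|k] //; have k0 := ler0n rat k; apply: lt0r_neq0; rewrite -natr1; lra.
Qed.

Lemma gram_rec_coef k l : (l <= k)%N -> (k < M)%N ->
  l.+1%:R ^+ 2 * gram_coef k l.+1 - gram_coef k l =
  - rec_coef (k.*2.+1) * (gram_coef k.+1 l.+1 - gram_coef k l.+1) + rec_coef k.*2 * (gram_coef k l.+1 - gram_coef k.-1 l.+1).
Proof.
move=> lk kM; have h := leq_ltn_trans lk kM; have h' := natr_ltM h.
have l0 := ler0n rat l; have k0 := ler0n rat k.
have p0 := psi_neq0 (ltnW h).
have d1 : l%:R - m != 0 by apply: ltr0_neq0; lra.
have d2 : m + l.+1%:R != 0 by apply: lt0r_neq0; rewrite -natr1; lra.
have d3 := neq0_4k1 k.
rewrite /gram_coef psiS_M gram_numSS gram_numS /rec_coef -!mul2n.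
rewrite (_ : 4%:R * (2 * k).+1%:R ^+ 2 - 1 = (4%:R * k%:R + 1) * (4%:R * k%:R + 3%:R)); last by ring.
rewrite (_ : 4%:R * (2 * k)%:R ^+ 2 - 1 = (4%:R * k%:R + 1) * (4%:R * k%:R - 1)); last by ring.
rewrite -[(2 * k).+1%:R]natr1 -[l.+1%:R]natr1 -[k.+1%:R]natr1 !natrM.
(* For k = 0 the truncated index [k.-1] is harmless, because its factor [rec_coef M 0] is 0. *)
case: k lk kM k0 d3 => [|k] lk kM k0 d3.
  by rewrite /= ?mulr0n; field; nonzero.
by have k1 := ler0n rat k; rewrite gram_num_predS; field; nonzero.
Qed.

Lemma gram_rec k s : (k < M)%N -> s ^+ 2 * gram k s =
  - rec_coef (k.*2.+1) * gram k.+1 s + (rec_coef (k.*2.+1) + rec_coef k.*2) * gram k s - rec_coef k.*2 * gram k.-1 s.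
Proof.
move=> kM; rewrite (@gramE k.+2 k.+1) // (@gramE k.+2 k) // (@gramE k.+2 k.-1); last by lia.
have e l : s ^+ 2 * phi l s = l%:R ^+ 2 * phi l s - phi l.+1 s by rewrite phiS; ring.
transitivity (\sum_(l < k.+2) l%:R ^+ 2 * gram_coef k l * phi l s - \sum_(l < k.+1) gram_coef k l * phi l.+1 s).
  transitivity (\sum_(l < k.+2) l%:R ^+ 2 * gram_coef k l * phi l s - \sum_(l < k.+2) gram_coef k l * phi l.+1 s).
    rewrite mulr_sumr -sumrB; apply: eq_bigr => l _; rewrite mulrCA e; ring.
  by rewrite [X in _ - X]big_ord_recr /= {3}/gram_coef gram_num_gt // !mul0r addr0.
rewrite !mulr_sumr -big_split -sumrB /= [X in X - _]big_ord_recl [in RHS]big_ord_recl.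
have a0 j : gram_coef j 0 = 1 by rewrite /gram_coef gram_num0 /psi big_ord0 invr1 mulr1.
rewrite !a0 /= expr0n !mul0r add0r -sumrB.
have -> x y z : - x * (1 * z) + (x + y) * (1 * z) - y * (1 * z) = 0 :> rat by ring.
rewrite add0r; apply: eq_bigr => l _; rewrite /bump /= add1n -mulrBl.
by rewrite (@gram_rec_coef k l (ltn_ord l) kM); ring.
Qed.

Notation N := (M.*2.+1).
Definition node (p : nat) : rat := p%:R - m.
Definition node_sum (f : rat -> rat) := \sum_(p < N) f (node p).

(** Summation by parts. The boundary terms vanish because [weight_fun] is zero at -M - 1 and at
    M. *)
Lemma diff_op_adj f h : node_sum (fun s => h s * diff_op f s) = node_sum (fun s => f s * diff_op h s).
Proof.
pose T p := weight_fun (node p - 1) * (h (node p - 1) * f (node p) - f (node p - 1) * h (node p)).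
apply/eqP; rewrite -subr_eq0 /node_sum -sumrB.
rewrite (eq_bigr (fun p : 'I_N => T p.+1 - T p)); last first.
  move=> p _; rewrite /T /diff_op; have -> : node p.+1 = node p + 1 by rewrite /node -natr1; ring.
  by rewrite addrK /weight_fun; ring.
rewrite -(big_mkord xpredT (fun p => T p.+1 - T p)) telescope_sumr // /T /node /weight_fun.
by rewrite -addnn -natr1 natrD; apply/eqP; ring.
Qed.

(** Eigenfunctions of a self-adjoint operator for distinct eigenvalues. *)
Lemma gram_orth k j : (k <= M)%N -> (j <= M)%N -> k != j -> node_sum (fun s => gram k s * gram j s) = 0.
Proof.
move=> hk hj kj; have := diff_op_adj (gram k) (gram j).
rewrite /node_sum; under eq_bigr => p _ do rewrite diff_op_gram //.
under [RHS]eq_bigr => p _ do rewrite diff_op_gram //.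
move=> e; pose lam (k : nat) : rat := 2%:R * k%:R * (2%:R * k%:R + 1).
have : (lam j - lam k) * \sum_(p < N) gram k (node p) * gram j (node p) = 0.
  transitivity (\sum_(p < N) gram j (node p) * (- lam k * gram k (node p)) -
     \sum_(p < N) gram k (node p) * (- lam j * gram j (node p))); last by rewrite e subrr.
  by rewrite mulr_sumr -sumrB; apply: eq_bigr => p _; ring.
move=> /eqP; rewrite mulf_eq0 => /orP[|/eqP//].
have -> : lam j - lam k = (j%:R - k%:R) * (4%:R * (j%:R + k%:R) + 2%:R) by rewrite /lam; ring.
have nonzero : 4%:R * (j%:R + k%:R) + 2%:R != 0 :> rat.
  by have j0 := ler0n rat j; have k0 := ler0n rat k; apply: lt0r_neq0; lra.
by rewrite mulf_eq0 subr_eq0 eqr_nat eq_sym (negbTE kj) (negbTE nonzero).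
Qed.

Definition gram_norm k := node_sum (fun s => gram k s ^+ 2).

Lemma gram_norm0 : gram_norm 0 = 2%:R * m + 1.
Proof.
rewrite /gram_norm /node_sum; under eq_bigr => p _ do rewrite /gram big_ord1 /gram_coef gram_num0 /psi /phi !big_ord0 divr1 mulr1 expr1n.
by rewrite sumr_const card_ord -muln2; ring.
Qed.

(** The inner product of s^2 P_k with P_(k+1) is computed twice, applying the recurrence to either
    factor. The bound on k makes orthogonality available up to index k + 2. *)
Lemma gram_norm_rec k : (k.+1 < M)%N -> gram_norm k.+1 * rec_coef (k.*2.+1) = rec_coef (k.*2.+2) * gram_norm k.
Proof.
move=> kM.
have e1 : node_sum (fun s => s ^+ 2 * gram k s * gram k.+1 s) = - rec_coef k.*2.+1 * gram_norm k.+1.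
  transitivity (- rec_coef k.*2.+1 * gram_norm k.+1 + (rec_coef (k.*2.+1) + rec_coef k.*2) * node_sum (fun s => gram k s * gram k.+1 s)
    - rec_coef k.*2 * node_sum (fun s => gram k.-1 s * gram k.+1 s)).
    rewrite /gram_norm /node_sum !mulr_sumr -big_split -sumrB /=; apply: eq_bigr => p _.
    rewrite gram_rec 1?ltnW //; ring.
  by rewrite !gram_orth ?mulr0 ?addr0 ?subr0 //; lia.
have e2 : node_sum (fun s => s ^+ 2 * gram k s * gram k.+1 s) = - rec_coef k.+1.*2 * gram_norm k.
  transitivity (- rec_coef k.+1.*2.+1 * node_sum (fun s => gram k.+2 s * gram k s) + (rec_coef (k.+1.*2.+1) + rec_coef k.+1.*2) *
     node_sum (fun s => gram k.+1 s * gram k s) - rec_coef k.+1.*2 * gram_norm k).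
    rewrite /gram_norm /node_sum !mulr_sumr -big_split -sumrB /=; apply: eq_bigr => p _.
    rewrite mulrAC gram_rec //=; ring.
  by rewrite !gram_orth ?mulr0 ?add0r ?mulNr //; lia.
by move: e1; rewrite e2 !mulNr doubleS => /oppr_inj ->; rewrite mulrC.
Qed.
End Legendre.

(** * The matrix of the skew form *)

Lemma skew_formS n (f g : nat -> rat) :
  skew_form n.+1 f g = skew_form n f g + \sum_(s < n) (f s * g n - f n * g s).
Proof. by rewrite /skew_form big_ord_recr. Qed.

(** For fixed p, the second argument summed above p minus its sum below p telescopes to (h p.+1 - h
    n) - (h 0 - h p), so the double sum becomes a single one. *)
Lemma skew_form_diff n (f h : nat -> rat) :
  skew_form n f (fun q => h q - h q.+1) = \sum_(p < n) f p * (h p + h p.+1 - h n - h 0).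
Proof.
elim: n => [|n IH]; first by rewrite /skew_form !big_ord0.
rewrite skew_formS IH big_ord_recr /=.
have t : \sum_(s < n) (h s - h s.+1) = h 0 - h n.
  rewrite -(big_mkord xpredT (fun s => h s - h s.+1)) -opprB -(telescope_sumr h (leq0n n)) -sumrN.
  by apply: eq_bigr => s _; rewrite opprB.
rewrite sumrB -mulr_sumr t -mulr_suml addrA [RHS]addrC.
have -> : \sum_(i < n) f i * (h i + h i.+1 - h n.+1 - h 0) =
  \sum_(i < n) f i * (h i + h i.+1 - h n - h 0) + (\sum_(i < n) f i) * (h n - h n.+1).
  by rewrite mulr_suml -big_split; apply: eq_bigr => i _ /=; ring.
ring.
Qed.

Lemma skew_formZr n (f g : nat -> rat) c : skew_form n f (fun p => c * g p) = c * skew_form n f g.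
Proof.
rewrite /skew_form mulr_sumr; apply: eq_bigr => t _; rewrite mulr_sumr.
by apply: eq_bigr => s _; ring.
Qed.

Lemma skew_formBl n (f f' g : nat -> rat) : skew_form n (fun p => f p - f' p) g = skew_form n f g - skew_form n f' g.
Proof.
rewrite /skew_form -sumrB; apply: eq_bigr => t _; rewrite -sumrB.
by apply: eq_bigr => s _; ring.
Qed.

Lemma eq_skew_form n (f f' g g' : nat -> rat) : f =1 f' -> g =1 g' -> skew_form n f g = skew_form n f' g'.
Proof.
by move=> ef eg; apply: eq_bigr => t _; apply: eq_bigr => s _; rewrite !ef !eg.
Qed.

Lemma psi_sym l s : psi l (- s - 1) = psi l s.
Proof. by apply: eq_bigr => i _; ring. Qed.

Section Ratio.
Variables (M n : nat).
Hypothesis nM : (n <= M)%N.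
Notation m := (M%:R : rat).
Notation N := (M.*2.+1).
Local Notation node := (node M).

Fixpoint odd_roots l : seq rat :=
  if l is l'.+1 then [:: m + l%:R, m - l%:R & odd_roots l'] else [:: m].

(** Even degrees 2i > 0 have the centre as a double root, which gives phi i up to sign. Root lists
    are used because [newton] takes the polynomial through its roots. *)
Definition basis_roots k : seq rat :=
  if k is k'.+1 then (if odd k then odd_roots k'./2 else m :: odd_roots k'./2) else [::].

Definition basis k p : rat := \prod_(r <- basis_roots k) (p%:R - r).

Lemma size_odd_roots l : size (odd_roots l) = l.*2.+1.
Proof. by elim: l => //= l ->. Qed.

Lemma size_basis_roots k : size (basis_roots k) = k.
Proof.
case: k => [//|k]; rewrite /basis_roots; have := odd_double_half k.
by rewrite /=; case: (odd k) => /=; rewrite size_odd_roots; lia.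
Qed.

Lemma prod_odd_roots l p : \prod_(r <- odd_roots l) (p%:R - r) = gam l (node p).
Proof.
elim: l => [|l IH].
  by rewrite /odd_roots big_seq1 /gam big_ord0 mulr1.
by rewrite /odd_roots -/odd_roots !big_cons IH gamS /node; ring.
Qed.

Lemma basis_odd j p : basis j.*2.+1 p = gam j (node p).
Proof. by rewrite /basis /basis_roots /= odd_double /= doubleK prod_odd_roots. Qed.

Lemma basis_even i p : basis i.*2 p = (-1) ^+ i * phi i (node p).
Proof.
case: i => [|i]; first by rewrite /basis /basis_roots big_nil /phi big_ord0 mulr1.
rewrite doubleS /basis /basis_roots /= negbK odd_double /= uphalf_double big_cons prod_odd_roots phi_gam.
by rewrite !mulrA -expr2 sqrr_sign mul1r.
Qed.

Lemma node_rev p : (p < N)%N -> node (N.-1 - p) = - node p.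
Proof.
by move=> h; rewrite /node natrB //= -addnn natrD; ring.
Qed.

Lemma phi_opp l s : phi l (- s) = phi l s.
Proof. by apply: eq_bigr => i _; rewrite sqrrN. Qed.

Lemma gam_opp l s : gam l (- s) = - gam l s.
Proof. by rewrite /gam mulNr; congr (- (_ * _)); apply: eq_bigr => i _; rewrite sqrrN. Qed.

Lemma basis_rev k p : (p < N)%N -> basis k (N.-1 - p)%N = (-1) ^+ k * basis k p.
Proof.
move=> h; rewrite -signr_odd -(odd_double_half k); case: (odd k) => /=.
  by rewrite !add1n /= odd_double !basis_odd node_rev // gam_opp mulN1r.
by rewrite !add0n odd_double !basis_even node_rev // phi_opp mul1r.
Qed.

Lemma sum_pattern_count_basis (a : pred nat) : (forall p, (p < N)%N -> a (N.-1 - p)%N = a p) ->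
  (\sum_(S : bits N | [forall p, S p ==> a p]) pattern_count n.*2 S)%:R * \prod_(k < n.*2) k`!%:R =
  \det (\matrix_(i < n, j < n)
     skew_form N (fun p => (a p)%:R * basis i.*2 p) (fun p => (a p)%:R * basis j.*2.+1 p)) :> rat.
Proof.
apply: (@sum_pattern_count_det n N basis (fun k => newton (basis_roots k))).
- by move=> k i ki; rewrite newton_gt // size_basis_roots.
- by move=> k; rewrite -{2}(size_basis_roots k) newton_size size_basis_roots.
- by move=> k p hk; apply: newtonE; rewrite size_basis_roots.
- exact: basis_rev.
Qed.

(** [psi_sub] makes the odd polynomial a difference, so [skew_form_diff] applies; [psi_add] merges
    the neighbouring values of psi into phi, and the two boundary values agree by the symmetry of
    psi. *)
Lemma skew_form_basis f j : skew_form N f (basis j.*2.+1) = (-1) ^+ j / j.+1%:R *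
  \sum_(p < N) f p * (phi j.+1 (node p) - psi j.+1 m).
Proof.
pose h q := psi j.+1 (node q - 1).
have hS q : h q.+1 = psi j.+1 (node q).
  by rewrite /h; congr psi; rewrite /node -natr1; ring.
have j0 := natS_neq0 j.
rewrite (@eq_skew_form N f f _ (fun q => (-1) ^+ j / (2%:R * j.+1%:R) * (h q - h q.+1))) //; last first.
  move=> q; rewrite basis_odd hS /h psi_sub.
  transitivity ((-1) ^+ j * (-1) ^+ j * gam j (node q)); last first.
    by move: ((-1) ^+ j) (j.+1%:R) j0 => e d d0; field.
  by rewrite -expr2 sqrr_sign mul1r.
rewrite skew_formZr skew_form_diff.
have -> : h N = psi j.+1 m by rewrite hS; congr psi; rewrite /node -addnn natrD; ring.
have -> : h 0 = psi j.+1 m by rewrite /h -[RHS]psi_sym; congr psi; rewrite /node; ring.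
rewrite (eq_bigr (fun p : 'I_N => 2%:R * (f p * (phi j.+1 (node p) - psi j.+1 m)))); last first.
  by move=> p _; rewrite hS [h p + _]addrC /h psi_add; ring.
by rewrite -mulr_sumr; move: (\sum_(i < N) _) ((-1) ^+ j) (j.+1%:R) j0 => X e d d0; field.
Qed.

(** Inner products of the phi i with even polynomials of degree at most 2n killed by the functional
    phi l |-> psi l m. All later choices of combinations respect this constraint. *)
Definition gram_mx := \matrix_(i < n, j < n)
  (\sum_(p < N) phi i (node p) * (phi j.+1 (node p) - psi j.+1 m)).
Definition skew_mx := \matrix_(i < n, j < n) skew_form N (basis i.*2) (basis j.*2.+1).

Lemma skew_mxE i j : skew_mx i j = (-1) ^+ i * gram_mx i j * ((-1) ^+ j / j.+1%:R).
Proof.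
rewrite !mxE skew_form_basis mulrC; congr (_ * _); rewrite mulr_sumr; apply: eq_bigr => p _.
by rewrite basis_even mulrA.
Qed.

Lemma det_skew_mx : \det skew_mx = \det gram_mx / \prod_(j < n) j.+1%:R.
Proof.
have -> : skew_mx = diag_mx (\row_(i < n) (-1) ^+ i) *m gram_mx *m diag_mx (\row_(j < n) ((-1) ^+ j / j.+1%:R)).
  by apply/matrixP => i j; rewrite skew_mxE mul_mx_diag mul_diag_mx !mxE.
rewrite !det_mulmx !det_diag mulrAC mulrC; congr (_ * _).
rewrite -prodfV -big_split /=; apply: eq_bigr => j _; rewrite !mxE.
by rewrite mulrA -expr2 sqrr_sign mul1r.
Qed.

(** The value (-1)^k (2k)!! / (2k - 1)!! of that functional at [gram M k], independent of M. *)
Definition alt_sum k : rat := (-1) ^+ k * k`!%:R / poch 2%:R^-1 k.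

Lemma sum_gram_coef_psi k : (k <= M)%N -> forall K, (k < K)%N -> \sum_(l < K) gram_coef M k l * psi l m = alt_sum k.
Proof.
move=> hk K hK; rewrite /alt_sum -sum_gram_num (big_ord_widen K (gram_num k)) // [RHS]big_mkcond.
apply: eq_bigr => l _; case: ltnP => hl; last by rewrite /gram_coef gram_num_gt // !mul0r.
by rewrite /gram_coef divfK // psi_neq0 //; lia.
Qed.

Lemma alt_sum_neq0 k : alt_sum k != 0.
Proof. by rewrite !mulf_neq0 ?signr_eq0 ?invr_eq0 ?pnatr_eq0 -?lt0n ?fact_gt0 // gt_eqF ?poch_gt0. Qed.

Lemma alt_sumS k : alt_sum k.+1 = - alt_sum k * (k.+1%:R / (k%:R + 2%:R^-1)).
Proof.
rewrite /alt_sum pochS factS natrM exprS; have k0 := ler0n rat k.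
have p0 : poch 2%:R^-1 k != 0 by rewrite gt_eqF ?poch_gt0.
by field; nonzero.
Qed.

Lemma gram_coef0 k : gram_coef M k 0 = 1.
Proof. by rewrite /gram_coef gram_num0 /psi big_ord0 invr1 mulr1. Qed.

(** The constraint on x fixes its constant coefficient, which absorbs the psi-terms of the
    matrix. *)
Lemma gram_mx_apply (x : nat -> rat) (i : 'I_n) : \sum_(l < n.+1) x l * psi l m = 0 ->
  \sum_(j < n) gram_mx i j * x j.+1 = node_sum M (fun s => phi i s * \sum_(l < n.+1) x l * phi l s).
Proof.
move=> hx; rewrite /node_sum; under eq_bigr => j _ do rewrite mxE mulr_suml.
rewrite exchange_big /=; apply: eq_bigr => p _.
transitivity (phi i (node p) * \sum_(l < n.+1) x l * (phi l (node p) - psi l m)).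
  rewrite big_ord_recl /psi /phi !big_ord0 subrr mulr0 add0r mulr_sumr.
  by apply: eq_bigr => j _; rewrite /bump /=; ring.
congr (_ * _).
transitivity (\sum_(l < n.+1) x l * phi l (node p) - \sum_(l < n.+1) x l * psi l m).
  by rewrite -sumrB; apply: eq_bigr => l _; rewrite mulrBr.
by rewrite hx subr0.
Qed.

Definition coef_mx := \matrix_(k < n, i < n) gram_coef M k i.

Lemma coef_mx_trig : is_trig_mx coef_mx.
Proof. by apply/is_trig_mxP => i j ij; rewrite mxE /gram_coef gram_num_gt // mul0r. Qed.

Lemma gram_coef_neq0 k : (k <= M)%N -> gram_coef M k k != 0.
Proof.
move=> h; rewrite /gram_coef /gram_num binn mulr1 !mulf_neq0 ?signr_eq0 ?invr_eq0 ?psi_neq0 //.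
  by have k0 := ler0n rat k; rewrite gt_eqF // poch_gt0 //; lra.
by rewrite gt_eqF ?poch_gt0.
Qed.

Lemma det_coef_mx : \det coef_mx = \prod_(k < n) gram_coef M k k.
Proof. by rewrite det_trig ?coef_mx_trig //; apply: eq_bigr => k _; rewrite mxE. Qed.

Lemma coef_mx_apply (x : nat -> rat) (k : 'I_n) : \sum_(l < n.+1) x l * psi l m = 0 ->
  (coef_mx *m (gram_mx *m \col_j x j.+1)) k 0 = node_sum M (fun s => gram M k s * \sum_(l < n.+1) x l * phi l s).
Proof.
move=> hx; rewrite mxE.
transitivity (\sum_(i < n) gram_coef M k i * node_sum M (fun s => phi i s * \sum_(l < n.+1) x l * phi l s)).
  apply: eq_bigr => i _; rewrite !mxE -gram_mx_apply //; congr (_ * _).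
  by apply: eq_bigr => j _; rewrite !mxE.
rewrite /node_sum; under eq_bigr => i _ do rewrite mulr_sumr.
rewrite exchange_big /=; apply: eq_bigr => p _.
by rewrite (@gramE M n) // mulr_suml; apply: eq_bigr => i _; rewrite mulrA.
Qed.

Lemma det_gram_mx : \det gram_mx = \prod_(j < n) (gram_norm M j * (j.+1%:R / (j%:R + 2%:R^-1)) / (gram_coef M j j * gram_coef M j.+1 j.+1)).
Proof.
(* The combination of [gram j.+1] and [gram j] in which the psi-terms cancel; it
   makes the product with the triangular [coef_mx] triangular. *)
pose e j l := gram_coef M j.+1 l - alt_sum j.+1 / alt_sum j * gram_coef M j l.
pose E := \matrix_(l < n, j < n) e j l.+1.
have detE : \det E = \prod_(j < n) gram_coef M j.+1 j.+1.
  rewrite -det_tr det_trig; last first.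
    by apply/is_trig_mxP => i j ij; rewrite !mxE /e /gram_coef !gram_num_gt // ?mul0r ?mulr0 ?subr0 // ltnW.
  apply: eq_bigr => j _; rewrite !mxE /e [gram_coef M j j.+1]/gram_coef gram_num_gt // mul0r mulr0 subr0 //.
have he j : (j < n)%N -> \sum_(l < n.+1) e j l * psi l m = 0.
  move=> jn; transitivity (\sum_(l < n.+1) gram_coef M j.+1 l * psi l m -
     alt_sum j.+1 / alt_sum j * \sum_(l < n.+1) gram_coef M j l * psi l m).
    by rewrite mulr_sumr -sumrB; apply: eq_bigr => l _; rewrite /e; ring.
  by rewrite !sum_gram_coef_psi ?divfK ?subrr ?alt_sum_neq0 //; lia.
have LAE k j : (coef_mx *m (gram_mx *m E)) k j = node_sum M (fun s => gram M k s * gram M j.+1 s) -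
    alt_sum j.+1 / alt_sum j * node_sum M (fun s => gram M k s * gram M j s).
  transitivity ((coef_mx *m (gram_mx *m \col_l e j l.+1)) k 0).
    rewrite !mxE; apply: eq_bigr => i _; rewrite !mxE; congr (_ * _).
    by apply: eq_bigr => l _; rewrite !mxE.
  rewrite coef_mx_apply ?he // /node_sum mulr_sumr -sumrB; apply: eq_bigr => p _.
  have jn := ltn_ord j.
  rewrite /= (@gramE M n.+1 j.+1 _ jn) (@gramE M n.+1 j _ (ltnW jn)).
  transitivity (gram M k (node p) * (\sum_(l < n.+1) gram_coef M j.+1 l * phi l (node p) -
    alt_sum j.+1 / alt_sum j * \sum_(l < n.+1) gram_coef M j l * phi l (node p))); last by ring.
  congr (_ * _); rewrite mulr_sumr -sumrB; apply: eq_bigr => l _; rewrite /e; ring.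
have trig : is_trig_mx (coef_mx *m (gram_mx *m E)).
  apply/is_trig_mxP => k j kj; rewrite LAE !gram_orth ?mulr0 ?subr0 //; move: (ltn_ord k) (ltn_ord j); lia.
have := det_trig trig; rewrite !det_mulmx det_coef_mx detE => e1.
have L0 : \prod_(k < n) gram_coef M k k != 0.
  by apply/prodf_neq0 => k _; apply: gram_coef_neq0; move: (ltn_ord k); lia.
have E0 : \prod_(k < n) gram_coef M k.+1 k.+1 != 0.
  by apply/prodf_neq0 => k _; apply: gram_coef_neq0; move: (ltn_ord k); lia.
apply: (mulfI L0); apply: (mulIf E0); rewrite -mulrA e1 -!big_split /=.
apply: eq_bigr => j _; rewrite LAE gram_orth; last first.
- by rewrite neq_ltn ltnSn.
- by move: (ltn_ord j); lia.
- by move: (ltn_ord j); lia.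
rewrite -/(gram_norm M j) alt_sumS sub0r.
have a0 : gram_coef M j j != 0 by apply: gram_coef_neq0; move: (ltn_ord j); lia.
have a1 : gram_coef M j.+1 j.+1 != 0 by apply: gram_coef_neq0; move: (ltn_ord j); lia.
have b0 := alt_sum_neq0 j; have j0 := ler0n rat j.
by field; nonzero.
Qed.

(** * Representing evaluation at the centre *)

Definition centre_ratio := \sum_(k < n) (gram_norm M k)^-1 * (1 - alt_sum k / alt_sum n).

Hypothesis n_gt0 : (0 < n)%N.
Hypothesis gram_norm_neq0 : forall k, (k < n)%N -> gram_norm M k != 0.

(** Since phi i vanishes at 0 for i > 0 and phi 0 = 1, the system asks for a polynomial in the
    kernel of the functional whose inner product with each phi i is the value of phi i at 0. The
    second sum is minus its constant coefficient. *)
Lemma centre_ratio_spec : exists2 x : nat -> rat, (forall i : 'I_n, \sum_(j < n) gram_mx i j * x j.+1 = (i == 0 :> nat)%:R) &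
  \sum_(j < n) x j.+1 * psi j.+1 m = - centre_ratio.
Proof.
pose sg := \sum_(k < n) alt_sum k / gram_norm M k.
(* Coefficients of the reproducing kernel at 0, corrected by a multiple of
   [gram n], which is orthogonal to all test functions. *)
pose x l := \sum_(k < n) (gram_norm M k)^-1 * gram_coef M k l - sg / alt_sum n * gram_coef M n l.
have hx : \sum_(l < n.+1) x l * psi l m = 0.
  transitivity (\sum_(k < n) (gram_norm M k)^-1 * (\sum_(l < n.+1) gram_coef M k l * psi l m) -
     sg / alt_sum n * \sum_(l < n.+1) gram_coef M n l * psi l m).
    under [X in _ = X - _]eq_bigr => k _ do rewrite mulr_sumr.
    rewrite exchange_big mulr_sumr -sumrB; apply: eq_bigr => l _ /=.
    rewrite /x mulrBl mulr_suml; congr (_ - _); last by ring.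
    by apply: eq_bigr => k _; ring.
  rewrite sum_gram_coef_psi // divfK ?alt_sum_neq0 // /sg -sumrB big1 // => k _.
  by rewrite sum_gram_coef_psi; [ring|move: (ltn_ord k); lia|move: (ltn_ord k); lia].
exists x; last first.
  have := hx; rewrite big_ord_recl /psi big_ord0 mulr1 => /eqP; rewrite addrC addr_eq0 => /eqP ->.
  congr (- _); rewrite /x gram_coef0 mulr1 /sg /centre_ratio mulr_suml -sumrB; apply: eq_bigr => k _.
  by rewrite gram_coef0; ring.
have Lu : coef_mx \in unitmx.
  rewrite unitmxE unitfE det_coef_mx; apply/prodf_neq0 => k _; apply: gram_coef_neq0; move: (ltn_ord k); lia.
have e : gram_mx *m \col_j x j.+1 = \col_(i < n) (i == 0 :> nat)%:R.
  apply: (can_inj (mulKmx Lu)); apply/matrixP => k z; rewrite !ord1 coef_mx_apply //.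
  rewrite [RHS]mxE (bigD1 (Ordinal n_gt0)) //= !mxE eqxx mulr1 big1 ?addr0; last first.
    by move=> i /negbTE; rewrite -val_eqE /= mxE => ->; rewrite mulr0.
  rewrite gram_coef0.
  have xP s : \sum_(l < n.+1) x l * phi l s = \sum_(j < n) (gram_norm M j)^-1 * gram M j s - sg / alt_sum n * gram M n s.
    rewrite (@gramE M n.+1 n) // mulr_sumr.
    under [X in _ = X - _]eq_bigr => j _ do rewrite (@gramE M n.+1 j _ (ltnW (ltn_ord j))) mulr_sumr.
    rewrite exchange_big -sumrB; apply: eq_bigr => l _ /=.
    rewrite /x mulrBl mulr_suml; congr (_ - _); last by ring.
    by apply: eq_bigr => j _; ring.
  transitivity (\sum_(j < n) (gram_norm M j)^-1 * node_sum M (fun s => gram M k s * gram M j s)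
     - sg / alt_sum n * node_sum M (fun s => gram M k s * gram M n s)).
    rewrite /node_sum mulr_sumr; under [X in _ = X - _]eq_bigr => j _ do rewrite mulr_sumr.
    rewrite exchange_big -sumrB; apply: eq_bigr => p _ /=.
    rewrite xP mulrBr mulr_sumr; congr (_ - _); last by ring.
    by apply: eq_bigr => j _; ring.
  have kn := ltn_ord k.
  rewrite [in X in _ - X]gram_orth ?mulr0 ?subr0; try lia.
  rewrite (bigD1 k) //= big1 ?addr0 => [|j jk]; first by rewrite -/(gram_norm M k) mulVf ?gram_norm_neq0.
  by rewrite gram_orth ?mulr0 // 1?eq_sym //; move: (ltn_ord j); lia.
by move=> i; have := congr1 (fun B : 'cV_n => B i 0) e; rewrite !mxE => <-; apply: eq_bigr => j _; rewrite !mxE.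
Qed.

End Ratio.

(** * Closed form of the norms *)

(* (2k - 1)!! / (2k)!! *)
Definition dfact_ratio k : rat := poch 2%:R^-1 k / k`!%:R.

(* The reciprocal norm of [gram M k], with [N = 2 M + 1] made a free variable. *)
Definition inv_norm (N : rat) k : rat := (4%:R * k%:R + 1) / N * dfact_ratio k ^+ 2 *
  \prod_(i < k) (((N - (2%:R * i%:R + 1)) * (N + (2%:R * i%:R + 1))) /
   ((N - (2%:R * i%:R + 2%:R)) * (N + (2%:R * i%:R + 2%:R)))).

Lemma dfact_ratioS k : dfact_ratio k.+1 = dfact_ratio k * ((2%:R * k%:R + 1) / (2%:R * k%:R + 2%:R)).
Proof.
have k0 := ler0n rat k.
have f0 : k`!%:R != 0 :> rat by rewrite pnatr_eq0 -lt0n fact_gt0.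
by rewrite /dfact_ratio pochS factS natrM; field; nonzero.
Qed.

Lemma alt_sumE k : alt_sum k = (-1) ^+ k / dfact_ratio k.
Proof. by rewrite /alt_sum /dfact_ratio invf_div mulrA. Qed.

Lemma inv_normS (N : rat) k : inv_norm N k.+1 = inv_norm N k * ((4%:R * k%:R + 5%:R) / (4%:R * k%:R + 1)) *
  ((2%:R * k%:R + 1) / (2%:R * k%:R + 2%:R)) ^+ 2 *
  (((N - (2%:R * k%:R + 1)) * (N + (2%:R * k%:R + 1))) /
   ((N - (2%:R * k%:R + 2%:R)) * (N + (2%:R * k%:R + 2%:R)))).
Proof.
rewrite /inv_norm dfact_ratioS big_ord_recr /=; have k0 := ler0n rat k.
have k1 : 4%:R * k%:R + 1 != 0 :> rat by apply: lt0r_neq0; lra.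
move: (\prod_(i < k) _) ((_ - _) * _ / _) => X Y.
rewrite (_ : 4%:R * k.+1%:R + 1 = 4%:R * k%:R + 5%:R); last by rewrite -natr1; ring.
move: N^-1 (dfact_ratio k) => Z d; field; nonzero.
Qed.

Section Norm.
Variable M : nat.
Notation m := (M%:R : rat).

Lemma gram_norm_inv k : (k < M)%N -> gram_norm M k != 0 /\ (gram_norm M k)^-1 = inv_norm (2%:R * m + 1) k.
Proof.
elim: k => [|k IH] kM.
  have m0 := ler0n rat M; rewrite gram_norm0; split; first by nonzero.
  by rewrite /inv_norm /dfact_ratio /poch !big_ord0 expr1n !mulr1 mulr0 add0r mul1r.
have k0 := ler0n rat k; have km : k%:R + 2%:R <= m by rewrite -natrD ler_nat addn2.
have c1 : rec_coef M k.*2.+1 = (2%:R * k%:R + 1) ^+ 2 * ((2%:R * m + 1 - (2%:R * k%:R + 1)) * (2%:R * m + 1 + (2%:R * k%:R + 1)))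
    / (4%:R * (4%:R * k%:R + 1) * (4%:R * k%:R + 3%:R)).
  rewrite /rec_coef -muln2 (_ : 4%:R * (k * 2).+1%:R ^+ 2 - 1 = (4%:R * k%:R + 1) * (4%:R * k%:R + 3%:R)); last by ring.
  by field; nonzero.
have c2 : rec_coef M k.+1.*2 = (2%:R * k%:R + 2%:R) ^+ 2 * ((2%:R * m + 1 - (2%:R * k%:R + 2%:R)) * (2%:R * m + 1 + (2%:R * k%:R + 2%:R)))
    / (4%:R * (4%:R * k%:R + 3%:R) * (4%:R * k%:R + 5%:R)).
  rewrite /rec_coef -muln2 (_ : 4%:R * (k.+1 * 2)%:R ^+ 2 - 1 = (4%:R * k%:R + 3%:R) * (4%:R * k%:R + 5%:R)); last by ring.
  by field; nonzero.
have p1 : (2%:R * m + 1 - (2%:R * k%:R + 1)) * (2%:R * m + 1 + (2%:R * k%:R + 1)) != 0.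
  by rewrite mulf_neq0 //; nonzero.
have p2 : (2%:R * m + 1 - (2%:R * k%:R + 2%:R)) * (2%:R * m + 1 + (2%:R * k%:R + 2%:R)) != 0.
  by rewrite mulf_neq0 //; nonzero.
have p3 : 2%:R * k%:R + 1 != 0 :> rat by nonzero.
have p4 : 2%:R * k%:R + 2%:R != 0 :> rat by nonzero.
have p5 : 4%:R * k%:R + 1 != 0 :> rat by nonzero.
have p6 : 4%:R * k%:R + 3%:R != 0 :> rat by nonzero.
have p7 : 4%:R * k%:R + 5%:R != 0 :> rat by nonzero.
have [n0 e] := IH (ltnW kM); have := gram_norm_rec kM; rewrite -doubleS => h.
have h1 : rec_coef M k.*2.+1 != 0.
  rewrite c1; apply: mulf_neq0; first by apply: mulf_neq0 => //; apply: expf_neq0.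
  by rewrite invr_eq0; apply: mulf_neq0 => //; apply: mulf_neq0.
have h2 : rec_coef M k.+1.*2 != 0.
  rewrite c2; apply: mulf_neq0; first by apply: mulf_neq0 => //; apply: expf_neq0.
  by rewrite invr_eq0; apply: mulf_neq0 => //; apply: mulf_neq0.
have e1 : gram_norm M k.+1 = rec_coef M k.+1.*2 * gram_norm M k / rec_coef M k.*2.+1 by rewrite -h mulfK.
split; first by rewrite e1; apply: mulf_neq0; [exact: mulf_neq0|rewrite invr_eq0].
rewrite inv_normS -e e1 c1 c2.
move: (_ * (_ + _)) p1 (_ * (_ + _)) p2 => A A0 B B0.
clear - n0 A0 B0 p3 p4 p5 p6 p7; move: (gram_norm M k) n0 => X n0.
by field; nonzero.
Qed.
End Norm.

Section Sums.

Lemma inv_norm_shift (q k : nat) : (k <= q)%N ->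
  inv_norm (2%:R * q.+1%:R + 1) k * ((q.+1%:R - k%:R) * (2%:R * q%:R + 3%:R + 2%:R * k%:R)) =
  inv_norm (2%:R * q%:R + 1) k * ((q.+1%:R + k%:R) * (2%:R * q%:R + 1 - 2%:R * k%:R)).
Proof.
have q0 := ler0n rat q.
elim: k => [_|k IH kq].
  by rewrite /inv_norm !big_ord0; field; nonzero.
have k0 := ler0n rat k; have km : k%:R + 1 <= q%:R :> rat by rewrite natr1 ler_nat.
have := IH (ltnW kq); rewrite !inv_normS.
have f : q.+1%:R - k%:R != 0 :> rat by rewrite -natr1; nonzero.
have g : 2%:R * q%:R + 3%:R + 2%:R * k%:R != 0 :> rat by nonzero.
set t1 := inv_norm _ k; set t2 := inv_norm _ k => e; clearbody t1 t2.
have -> : t1 = t2 * ((q.+1%:R + k%:R) * (2%:R * q%:R + 1 - 2%:R * k%:R)) / ((q.+1%:R - k%:R) * (2%:R * q%:R + 3%:R + 2%:R * k%:R)).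
  by rewrite -e mulfK // mulf_neq0.
rewrite -[k.+1%:R]natr1 -[q.+1%:R]natr1 in f *.
field; nonzero.
Qed.

Lemma inv_norm_succ (q k : nat) : (k <= q)%N ->
  inv_norm (2%:R * q.+1%:R + 1) k =
  inv_norm (2%:R * q%:R + 1) k * ((q%:R + 1 + k%:R) * (2%:R * q%:R + 1 - 2%:R * k%:R) /
    ((q%:R + 1 - k%:R) * (2%:R * q%:R + 3%:R + 2%:R * k%:R))).
Proof.
move=> kq; have := inv_norm_shift kq; rewrite -[q.+1%:R]natr1 => e.
have q0 := ler0n rat q; have k0 := ler0n rat k; have km : k%:R <= q%:R :> rat by rewrite ler_nat.
have h : (q%:R + 1 - k%:R) * (2%:R * q%:R + 3%:R + 2%:R * k%:R) != 0 :> rat.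
  by apply: mulf_neq0; nonzero.
by apply: (mulIf h); rewrite e -[RHS]mulrA divfK.
Qed.

Lemma odd_neq0 (q k : nat) : 2%:R * q%:R - 1 - 2%:R * k%:R != 0 :> rat.
Proof.
rewrite -addrA -opprD subr_eq0 -!natrM -(natrD _ 1) eqr_nat; lia.
Qed.

Lemma inv_norm_next (q k : nat) : (k <= q)%N -> inv_norm (2%:R * q%:R + 1) k.+1 = inv_norm (2%:R * q%:R + 1) k *
  ((4%:R * k%:R + 5%:R) * (2%:R * k%:R + 1) ^+ 2 * (q%:R - k%:R) * (q%:R + k%:R + 1) /
   ((4%:R * k%:R + 1) * (k%:R + 1) ^+ 2 * (2%:R * q%:R - 1 - 2%:R * k%:R) *
    (2%:R * q%:R + 3%:R + 2%:R * k%:R))).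
Proof.
move=> kq; have q0 := ler0n rat q; have k0 := ler0n rat k.
have km : k%:R <= q%:R :> rat by rewrite ler_nat.
have nz1 := odd_neq0 q k.
rewrite inv_normS; move: (inv_norm _ k) => T.
have -> : 2%:R * q%:R + 1 - (2%:R * k%:R + 2%:R) = 2%:R * q%:R - 1 - 2%:R * k%:R :> rat by ring.
field; nonzero.
Qed.

Lemma inv_norm_diag (q : nat) : inv_norm (2%:R * q.+1%:R + 1) q.+1 = inv_norm (2%:R * q%:R + 1) q *
  (2%:R * (2%:R * q%:R + 1) ^+ 3 / ((4%:R * q%:R + 1) * (4%:R * q%:R + 3%:R) * (q%:R + 1))).
Proof.
have q0 := ler0n rat q.
rewrite inv_norm_next; last exact: leqnSn.
rewrite inv_norm_succ // -[q.+1%:R]natr1; move: (inv_norm _ q) => T.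
have -> : 2%:R * (q%:R + 1) - 1 - 2%:R * q%:R = 1 :> rat by ring.
have -> : q%:R + 1 - q%:R = 1 :> rat by ring.
have -> : 2%:R * (q%:R + 1) + 3%:R + 2%:R * q%:R = 4%:R * q%:R + 5%:R :> rat by ring.
field; nonzero.
Qed.

(* Telescoping certificate from Zeilberger's algorithm. *)
Lemma sum_inv_norm_diff (q K : nat) : (K <= q)%N ->
  \sum_(k < K.+1) (inv_norm (2%:R * q.+1%:R + 1) k - inv_norm (2%:R * q%:R + 1) k) =
  - inv_norm (2%:R * q%:R + 1) K * (2%:R * (2%:R * K%:R + 1) ^+ 2 * (q%:R + K%:R + 1) /
     ((q%:R + 1) * (4%:R * K%:R + 1) * (2%:R * q%:R + 3%:R + 2%:R * K%:R))).
Proof.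
have q0 := ler0n rat q.
elim: K => [_|K IH Kq].
  by rewrite big_ord1 /= inv_norm_succ //; move: (inv_norm _ 0) => T; field; nonzero.
have K0 := ler0n rat K; have Km : K%:R + 1 <= q%:R :> rat by rewrite natr1 ler_nat.
rewrite big_ord_recr /= IH ?(ltnW Kq) // inv_norm_succ // inv_norm_next ?(ltnW Kq) // -[K.+1%:R]natr1.
have nz1 := odd_neq0 q K; move: (inv_norm _ K) => T.
field; nonzero.
Qed.

(** On {-q, ..., q} this is the reproducing kernel of even functions at 0. The proof compares q with
    q + 1, where the certificate leaves a remainder cancelled by the extra diagonal term. *)
Lemma sum_inv_norm q : \sum_(k < q.+1) inv_norm (2%:R * q%:R + 1) k = 1.
Proof.
elim: q => [|q IH]; first by rewrite big_ord1 /= /inv_norm /dfact_ratio /poch !big_ord0 fact0; field.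
have q0 := ler0n rat q.
rewrite big_ord_recr /= -[X in X + _](subrK (\sum_(k < q.+1) inv_norm (2%:R * q%:R + 1) k)) -sumrB.
rewrite sum_inv_norm_diff // IH inv_norm_diag; move: (inv_norm _ q) => T.
field; nonzero.
Qed.

(* Telescoping certificate from Zeilberger's algorithm. *)
Lemma sum_inv_norm_alt_add (q K : nat) : (K <= q)%N ->
  \sum_(k < K.+1) (inv_norm (2%:R * q.+1%:R + 1) k + inv_norm (2%:R * q%:R + 1) k) * alt_sum k =
  inv_norm (2%:R * q%:R + 1) K * alt_sum K * (4%:R * (2%:R * K%:R + 1) * (q%:R + K%:R + 1) /
     ((4%:R * K%:R + 1) * (2%:R * q%:R + 3%:R + 2%:R * K%:R))).
Proof.
have q0 := ler0n rat q.
elim: K => [_|K IH Kq].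
  by rewrite big_ord1 /= inv_norm_succ //; move: (inv_norm _ 0) => T; field; nonzero.
have K0 := ler0n rat K; have Km : K%:R + 1 <= q%:R :> rat by rewrite natr1 ler_nat.
rewrite big_ord_recr /= IH ?(ltnW Kq) // inv_norm_succ // inv_norm_next ?(ltnW Kq) // alt_sumS -[K.+1%:R]natr1.
have nz1 := odd_neq0 q K; move: (inv_norm _ K) (alt_sum K) => T B.
field; nonzero.
Qed.

(** Passing from q to q + 1 flips the sign: the sum of the two consecutive values telescopes to 0
    once the extra diagonal term is included. *)
Lemma sum_inv_norm_alt q : \sum_(k < q.+1) inv_norm (2%:R * q%:R + 1) k * alt_sum k = (-1) ^+ q.
Proof.
elim: q => [|q IH]; first by rewrite big_ord1 /= /inv_norm /dfact_ratio /alt_sum /poch !big_ord0 fact0; field.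
have q0 := ler0n rat q.
rewrite exprS mulN1r -IH; apply/eqP; rewrite -subr_eq0 opprK; apply/eqP.
rewrite big_ord_recr /= addrAC -big_split /=.
under eq_bigr => k _ do rewrite -mulrDl.
rewrite sum_inv_norm_alt_add // inv_norm_diag alt_sumS; move: (inv_norm _ q) (alt_sum q) => T B.
field; nonzero.
Qed.

End Sums.

(** * The polynomial U *)

Lemma dfact_even n : dfact n.*2 = (2 ^ n * n`!)%N.
Proof.
elim: n => [//|n IH].
have -> : dfact n.+1.*2 = (n.*2.+2 * dfact n.*2)%N by [].
by rewrite IH factS expnS; nia.
Qed.

Lemma fact_neq0 k : k`!%:R != 0 :> rat.
Proof. by rewrite pnatr_eq0 -lt0n fact_gt0. Qed.

Lemma dfact_odd n : (dfact (n.*2.+1))%:R = 2%:R ^+ n.+1 * n.+1`!%:R * dfact_ratio n.+1 :> rat.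
Proof.
elim: n => [|n IH]; first by rewrite dfact_ratioS /dfact_ratio /poch big_ord0 factS fact0 /=; field.
have -> : dfact n.+1.*2.+1 = (n.*2.+3 * dfact n.*2.+1)%N by [].
rewrite natrM IH [dfact_ratio n.+2]dfact_ratioS [(n.+2)`!]factS [2 ^+ n.+2]exprS natrM -muln2.
have n0 := ler0n rat n; field; nonzero.
Qed.

Lemma poch_sym (y : rat) n : poch (y - n%:R) n.*2.+1 = y * \prod_(j < n) (y ^+ 2 - j.+1%:R ^+ 2).
Proof.
elim: n => [|n IH]; first by rewrite big_ord0 /poch big_ord1 /=; ring.
rewrite doubleS pochS poch_shift big_ord_recr /=.
have -> : y - n.+1%:R + 1 = y - n%:R by ring.
by rewrite IH -muln2; ring.
Qed.

Lemma poch_neg (a k : nat) : (a < k)%N -> poch (- a%:R) k = 0.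
Proof. by move=> h; rewrite /poch (bigD1 (Ordinal h)) //= addNr mul0r. Qed.

Lemma poch_neg_fact a : poch (- a%:R) a = (-1) ^+ a * a`!%:R.
Proof.
elim: a => [|a IH]; first by rewrite /poch big_ord0 mulr1.
rewrite poch_shift (_ : - a.+1%:R + 1 = - a%:R); last by ring.
by rewrite IH exprS factS natrM; ring.
Qed.

Lemma poch1 a : poch 1 a = a`!%:R.
Proof. by elim: a => [|a IH]; rewrite ?pochS ?IH ?factS ?natrM; [rewrite /poch big_ord0|ring]. Qed.

(** [U] with x replaced by a rational variable, so that it can be evaluated at negative integers. *)
Definition Ufun n (z : rat) : rat :=
  \sum_(1 <= i < n.+1)
    (((dfact (2 * n - 1))%N%:R + (-1) ^+ i.+1 * (dfact (2 * n))%N%:R) *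
     poch (3%:R / 2%:R - i%:R) (2 * n - 1)%N /
     (((i - 1)`!)%N%:R * ((2 * n - i)`!)%N%:R) *
     (poch (z + 1) (i - 1)%N * poch (z + i%:R + 1) (2 * n - i)%N -
      poch (z + 1) (2 * n - i) * poch (z + 2%:R * n%:R + 2%:R - i%:R) (i - 1)%N)).

Lemma UfunE n x : U n x = Ufun n x%:R.
Proof.
apply: eq_big_nat => i /andP[i1 ilen].
have -> : x.+1%:R = x%:R + 1 :> rat by rewrite natr1.
have -> : (x + i + 1)%:R = x%:R + i%:R + 1 :> rat by rewrite !natrD.
have -> // : (x + 2 * n + 2 - i)%:R = x%:R + 2%:R * n%:R + 2%:R - i%:R :> rat.
by rewrite natrB; [ring|lia].
Qed.

(** At either point every summand but the i-th contains vanishing Pochhammer symbols. Of the i-th,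
    the first product survives at -i and the second at -(2n + 1 - i), with equal contributions. *)
Lemma Ufun_eval n i : (0 < i <= n)%N ->
  let v := ((-1) ^+ i.+1 * (dfact (2 * n - 1))%:R + (dfact (2 * n))%:R) *
     poch (3%:R / 2%:R - i%:R) (2 * n - 1)%N in
  Ufun n (- i%:R) = v /\ Ufun n (- (2 * n + 1 - i)%:R) = v.
Proof.
move=> /andP[i0 ilen] v.
have sq : (-1) ^+ i.+1 * (-1) ^+ i.+1 = 1 :> rat by rewrite -expr2 sqrr_sign.
have fv : v = ((dfact (2 * n - 1))%N%:R + (-1) ^+ i.+1 * (dfact (2 * n))%N%:R) *
     poch (3%:R / 2%:R - i%:R) (2 * n - 1)%N / (((i - 1)`!)%N%:R * ((2 * n - i)`!)%N%:R) *
     ((-1) ^+ i.+1 * ((i - 1)`!)%N%:R * ((2 * n - i)`!)%N%:R).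
  have f1 := fact_neq0 (i - 1); have f2 := fact_neq0 (2 * n - i).
  transitivity (((-1) ^+ i.+1 * (dfact (2 * n - 1))%:R + ((-1) ^+ i.+1 * (-1) ^+ i.+1) * (dfact (2 * n))%:R) *
     poch (3%:R / 2%:R - i%:R) (2 * n - 1)%N); first by rewrite sq mul1r.
  by move: ((-1) ^+ i.+1) (poch _ _) => e p; field; rewrite f1 f2.
have iin : (1 <= i < n.+1)%N by lia.
split; rewrite /Ufun (bigD1_seq i) ?iota_uniq ?mem_index_iota //= big_seq_cond big1 ?addr0.
- rewrite fv; congr (_ * _).
  rewrite (_ : - i%:R + 1 = - (i - 1)%:R); last by rewrite natrB //; ring.
  rewrite (_ : - i%:R + i%:R + 1 = 1); last by ring.
  rewrite poch1 poch_neg_fact [X in _ - X](_ : _ = 0) ?subr0.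
    by congr (_ * _ * _); case: (i) i0 => [//|j] _; rewrite subn1 /= !exprS; ring.
  by rewrite poch_neg ?mul0r //; lia.
- move=> j; rewrite mem_index_iota => /andP[/andP[j1 jn] ji].
  rewrite (_ : - i%:R + 1 = - (i - 1)%:R); last by rewrite natrB //; ring.
  rewrite [poch _ (2 * n - j)%N * poch _ (j - 1)%N](_ : _ = 0) ?subr0; last by rewrite poch_neg ?mul0r //; lia.
  case: (ltngtP i j) ji => // ij _; first by rewrite poch_neg ?mul0r ?mulr0 //; lia.
  rewrite (_ : - i%:R + j%:R + 1 = - (i - j - 1)%:R); last by rewrite !natrB //; [ring|lia|lia].
  by rewrite [poch (- (i - j - 1)%:R) _]poch_neg ?mulr0 //; lia.
- rewrite fv; congr (_ * _).
  rewrite (_ : - (2 * n + 1 - i)%:R + 1 = - (2 * n - i)%:R :> rat); last by rewrite !natrB //; [ring|lia|lia].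
  rewrite [X in X - _](_ : _ = 0) ?sub0r; last first.
    rewrite mulrC (_ : - (2 * n + 1 - i)%:R + i%:R + 1 = - (2 * n - i - i)%:R :> rat); last first.
      by rewrite !natrB //; [ring|lia|lia|lia].
    by rewrite poch_neg ?mul0r //; lia.
  rewrite (_ : - (2 * n + 1 - i)%:R + 2%:R * n%:R + 2%:R - i%:R = 1 :> rat); last by rewrite !natrB //; [ring|lia].
  rewrite poch1 poch_neg_fact.
  have -> : (-1) ^+ (2 * n - i) = - (-1) ^+ i.+1 :> rat.
    by rewrite -signr_odd -[in RHS]signr_odd oddB /=; [rewrite oddM /=; case: (odd i) => /=; ring|lia].
  by ring.
- move=> j; rewrite mem_index_iota => /andP[/andP[j1 jn] ji].
  rewrite (_ : - (2 * n + 1 - i)%:R + 1 = - (2 * n - i)%:R :> rat); last by rewrite !natrB //; [ring|lia|lia].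
  rewrite [poch _ (j - 1)%N * poch _ (2 * n - j)%N](_ : _ = 0) ?sub0r; last first.
    rewrite mulrC (_ : - (2 * n + 1 - i)%:R + j%:R + 1 = - (2 * n - i - j)%:R :> rat); last first.
      by rewrite !natrB //; [ring|lia|lia|lia].
    by rewrite poch_neg ?mul0r //; lia.
  rewrite [poch _ (2 * n - j)%N * poch _ (j - 1)%N](_ : _ = 0) ?oppr0 ?mulr0 //.
  case: (ltngtP j i) ji => // ij _; first by rewrite poch_neg ?mul0r //; lia.
  rewrite (_ : - (2 * n + 1 - i)%:R + 2%:R * n%:R + 2%:R - j%:R = - (j - i - 1)%:R :> rat); last first.
    by rewrite !natrB //; [ring|lia|lia|lia].
  by rewrite [poch (- (j - i - 1)%:R) _]poch_neg ?mulr0 //; lia.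
Qed.

(** * Polynomial functions of bounded degree *)

Definition is_polyfun (d : nat) (f : rat -> rat) :=
  exists2 p : {poly rat}, (size p <= d.+1)%N & forall z, p.[z] = f z.

Lemma polyfun_ext d f g : f =1 g -> is_polyfun d f -> is_polyfun d g.
Proof. by move=> e [p hp pE]; exists p => // z; rewrite pE e. Qed.

Lemma polyfun_le d d' f : (d <= d')%N -> is_polyfun d f -> is_polyfun d' f.
Proof. by move=> h [p hp pE]; exists p => //; apply: leq_trans hp _. Qed.

Lemma polyfun_const c : is_polyfun 0 (fun=> c).
Proof. by exists c%:P => [|z]; rewrite ?hornerC // size_polyC leq_b1. Qed.

Lemma polyfun_lin a c : is_polyfun 1 (fun z => a * z + c).
Proof.
exists (a *: 'X + c%:P) => [|z]; last by rewrite hornerD hornerZ hornerX hornerC.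
rewrite (leq_trans (size_polyD _ _)) // geq_max (leq_trans (size_scale_leq _ _)) ?size_polyX //.
by rewrite size_polyC (leq_trans (leq_b1 _)).
Qed.

Lemma polyfunM d d' f g : is_polyfun d f -> is_polyfun d' g ->
  is_polyfun (d + d') (fun z => f z * g z).
Proof.
move=> [p hp pE] [q hq qE]; exists (p * q) => [|z]; last by rewrite hornerM pE qE.
by rewrite (leq_trans (size_polyMleq _ _)) //; lia.
Qed.

Lemma polyfunB d f g : is_polyfun d f -> is_polyfun d g -> is_polyfun d (fun z => f z - g z).
Proof.
move=> [p hp pE] [q hq qE]; exists (p - q) => [|z]; last by rewrite hornerD hornerN pE qE.
by rewrite (leq_trans (size_polyD _ _)) // size_polyN geq_max hp hq.
Qed.

Lemma polyfun_prod (I : Type) (r : seq I) (F : I -> rat -> rat) d :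
  (forall i, is_polyfun d (F i)) -> is_polyfun (d * size r) (fun z => \prod_(i <- r) F i z).
Proof.
move=> h; elim: r => [|a r IH] /=.
  by apply: polyfun_ext (polyfun_le _ (polyfun_const 1)) => // z; rewrite big_nil.
by apply: polyfun_ext (polyfun_le _ (polyfunM (h a) IH)) => [z|]; [rewrite big_cons|lia].
Qed.

Lemma polyfun_sum (I : eqType) (r : seq I) (F : I -> rat -> rat) d :
  (forall i, i \in r -> is_polyfun d (F i)) -> is_polyfun d (fun z => \sum_(i <- r) F i z).
Proof.
elim: r => [|a r IH] h /=.
  by apply: polyfun_ext (polyfun_le (leq0n d) (polyfun_const 0)) => // z; rewrite big_nil.
have [|p hp pE] := IH; first by move=> i hi; apply: h; rewrite inE hi orbT.
have [q hq qE] := h a (mem_head _ _).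
exists (q + p) => [|z]; last by rewrite hornerD big_cons qE pE.
by rewrite (leq_trans (size_polyD _ _)) // geq_max hp hq.
Qed.

Lemma polyfun_eq d (f g : rat -> rat) (rs : seq rat) : is_polyfun d f -> is_polyfun d g ->
  uniq rs -> (d < size rs)%N -> (forall z, z \in rs -> f z = g z) -> f =1 g.
Proof.
move=> hf hg urs drs hrs z; have [p hp pE] := polyfunB hf hg.
have p0 : p = 0.
  apply: (@roots_geq_poly_eq0 _ p rs); last by apply: leq_trans drs.
    by apply/allP => y yr; rewrite /root pE hrs // subrr.
  exact: urs.
by apply/eqP; rewrite -subr_eq0 -pE p0 horner0.
Qed.

Lemma polyfun_poch (f : rat -> rat) k : is_polyfun 1 f -> is_polyfun k (fun z => poch (f z) k).
Proof.
move=> [p hp pE]; rewrite -{1}(mul1n k) -{1}(size_iota 0 k).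
have h := @polyfun_prod nat (iota 0 k) (fun j z => f z + j%:R) 1.
apply: polyfun_ext (h _) => [z|j]; first by rewrite /poch -(big_mkord xpredT (fun j => f z + j%:R)) /index_iota subn0.
exists (p + j%:R%:P) => [|z]; last by rewrite hornerD hornerC pE.
rewrite (leq_trans (size_polyD _ _)) // geq_max hp /= size_polyC.
by rewrite (leq_trans (leq_b1 _)).
Qed.

Section Identity.
Variable n' : nat.
Notation n := n'.+1.

Definition width (z : rat) : rat := 2%:R * z + (2%:R * n%:R + 1).

(* [centre_ratio] with its denominators cleared, as a polynomial in [z = x]. *)
Definition Vfun (z : rat) : rat := \sum_(0 <= k < n) ((4%:R * k%:R + 1) * dfact_ratio k ^+ 2 * (1 - alt_sum k / alt_sum n)) *
  (\prod_(i <- iota 0 k) ((width z - (2%:R * i%:R + 1)) * (width z + (2%:R * i%:R + 1))) *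
   \prod_(i <- iota k (n' - k)) ((width z - (2%:R * i%:R + 2%:R)) * (width z + (2%:R * i%:R + 2%:R)))).

Lemma polyfun_Vfun : is_polyfun (2 * n - 1) Vfun.
Proof.
apply: polyfun_sum => k; rewrite mem_index_iota => /= hk.
have l c c' : is_polyfun 2 (fun z => (width z - c) * (width z + c')).
  by apply: (@polyfunM 1 1); [apply: polyfun_ext (polyfun_lin 2%:R (2%:R * n%:R + 1 - c))|
    apply: polyfun_ext (polyfun_lin 2%:R (2%:R * n%:R + 1 + c'))] => z; rewrite /width; ring.
apply: polyfun_le (polyfunM (polyfun_const _) (polyfunM (polyfun_prod _ (fun i => l _ _))
  (polyfun_prod _ (fun i => l _ _)))).
by rewrite !size_iota; lia.
Qed.

Lemma polyfun_Ufun : is_polyfun (2 * n - 1) (Ufun n).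
Proof.
apply: polyfun_sum => i; rewrite mem_index_iota => /= hi.
have l c : is_polyfun 1 (fun z => z + c).
  by apply: polyfun_ext (polyfun_lin 1 c) => z; rewrite mul1r.
have l1 : is_polyfun 1 (fun z => z + i%:R + 1).
  by apply: polyfun_ext (l (i%:R + 1)) => z; rewrite addrA.
have l2 : is_polyfun 1 (fun z => z + 2%:R * n%:R + 2%:R - i%:R).
  by apply: polyfun_ext (l (2%:R * n%:R + 2%:R - i%:R)) => z; ring.
apply: (@polyfunM 0 (2 * n - 1)); first exact: polyfun_const.
apply: polyfunB.
  by apply: polyfun_le (polyfunM (polyfun_poch _ (l _)) (polyfun_poch _ l1)); lia.
by apply: polyfun_le (polyfunM (polyfun_poch _ (l _)) (polyfun_poch _ l2)); lia.
Qed.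

Definition even_prod (y : rat) : rat := \prod_(i <- iota 0 n') ((y - (2%:R * i%:R + 2%:R)) * (y + (2%:R * i%:R + 2%:R))).

Lemma Vfun_inv_norm z : width z != 0 -> even_prod (width z) != 0 ->
  Vfun z = width z * even_prod (width z) * \sum_(k < n) inv_norm (width z) k * (1 - alt_sum k / alt_sum n).
Proof.
move=> n0 w0; rewrite /Vfun big_mkord mulr_sumr; apply: eq_bigr => k _.
rewrite /inv_norm; set Y := width z in n0 w0 *.
have kn : (k <= n')%N by rewrite -ltnS.
have e : even_prod Y = \prod_(i <- iota 0 k) ((Y - (2%:R * i%:R + 2%:R)) * (Y + (2%:R * i%:R + 2%:R))) *
   \prod_(i <- iota k (n' - k)) ((Y - (2%:R * i%:R + 2%:R)) * (Y + (2%:R * i%:R + 2%:R))).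
  by rewrite /even_prod -big_cat /= -{2}[in iota k _](add0n k) -iotaD subnKC.
rewrite e in w0 *; move: w0; rewrite mulf_eq0 negb_or => /andP[w0 w1].
rewrite prodf_div.
have io (F : nat -> rat) : \prod_(i < k) F i = \prod_(i <- iota 0 k) F i.
  by rewrite -(big_mkord xpredT) /index_iota subn0.
rewrite (io (fun i => (Y - (2%:R * i%:R + 1)) * (Y + (2%:R * i%:R + 1)))).
rewrite (io (fun i => (Y - (2%:R * i%:R + 2%:R)) * (Y + (2%:R * i%:R + 2%:R)))).
move: (\prod_(i <- iota 0 k) _) (\prod_(i <- iota 0 k) _) w0 (\prod_(i <- iota k _) _) w1 => A B B0 C C0.
move: (1 - _) (dfact_ratio k ^+ 2) (4%:R * _ + 1) => D E F.
by field; rewrite n0 B0.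
Qed.

Lemma Vfun_even z : Vfun (- z - (2%:R * n%:R + 1)) = Vfun z.
Proof.
have e : width (- z - (2%:R * n%:R + 1)) = - width z by rewrite /width; ring.
have s c : (- width z - c) * (- width z + c) = (width z - c) * (width z + c) by ring.
apply: eq_bigr => k _; rewrite e; congr (_ * (_ * _)); by apply: eq_bigr => i _; rewrite s.
Qed.

Lemma even_prod_poch y : y * even_prod (2%:R * y) = 4%:R ^+ n' * poch (y - n'%:R) n'.*2.+1.
Proof.
rewrite poch_sym /even_prod -{1}(subn0 n') big_mkord mulrCA; congr (_ * _).
have -> : 4%:R ^+ n' = \prod_(i < n') 4%:R :> rat by rewrite prodr_const card_ord.
rewrite -big_split /=; apply: eq_bigr => i _.
by rewrite -natr1; ring.
Qed.

Lemma odd_half_neq0 (q : nat) i : 2%:R * (q%:R + 2%:R^-1) - (2%:R * i%:R + 2%:R) != 0 :> rat.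
Proof.
have -> : 2%:R * (q%:R + 2%:R^-1) - (2%:R * i%:R + 2%:R) = 2%:R * q%:R - 1 - 2%:R * i%:R :> rat by field.
exact: odd_neq0.
Qed.

(** Here [width] becomes 2q + 1, the size of the interval {-q, ..., q}, so the two sums run over the
    complete system and take the values 1 and (-1)^q. *)
Lemma Vfun_eval q : (q < n)%N -> Vfun (- (n - q)%:R) =
   2%:R * 4%:R ^+ n' * poch (q%:R + 2%:R^-1 - n'%:R) n'.*2.+1 * (1 - (-1) ^+ (q + n) * dfact_ratio n).
Proof.
move=> qn; have q0 := ler0n rat q.
have e : width (- (n - q)%:R) = 2%:R * (q%:R + 2%:R^-1).
  by rewrite /width natrB 1?ltnW //; field.
have w0 : even_prod (2%:R * (q%:R + 2%:R^-1)) != 0.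
  rewrite /even_prod prodf_seq_neq0; apply/allP => i _ /=; rewrite mulf_neq0 ?odd_half_neq0 //.
  by have i0 := ler0n rat i; apply: lt0r_neq0; lra.
have n0 : 2%:R * (q%:R + 2%:R^-1) != 0 :> rat by apply: lt0r_neq0; lra.
rewrite Vfun_inv_norm e // -(mulrA 2%:R (q%:R + _)) even_prod_poch !mulrA; congr (_ * _).
have eN : 2%:R * (q%:R + 2%:R^-1) = 2%:R * q%:R + 1 :> rat by field.
rewrite eN.
(* The factor i = q of the numerator is N - (2q + 1), which is zero at N = 2q + 1. *)
have t0 k : (q < k)%N -> inv_norm (2%:R * q%:R + 1) k = 0.
  move=> h; rewrite /inv_norm (bigD1 (Ordinal h)) //= subrr !mul0r mulr0 //.
have red (F : nat -> rat) : \sum_(k < n) inv_norm (2%:R * q%:R + 1) k * F k = \sum_(k < q.+1) inv_norm (2%:R * q%:R + 1) k * F k.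
  rewrite [RHS](big_ord_widen n (fun k => inv_norm (2%:R * q%:R + 1) k * F k)) // [RHS]big_mkcond.
  by apply: eq_bigr => k _; case: ltnP => // h; rewrite t0 ?mul0r.
rewrite (red (fun k => 1 - alt_sum k / alt_sum n)).
transitivity (\sum_(k < q.+1) inv_norm (2%:R * q%:R + 1) k - (\sum_(k < q.+1) inv_norm (2%:R * q%:R + 1) k * alt_sum k) / alt_sum n).
  by rewrite mulr_suml -sumrB; apply: eq_bigr => k _; rewrite mulrBr mulr1 mulrA.
rewrite sum_inv_norm sum_inv_norm_alt alt_sumE invf_div exprD; congr (1 - _).
by rewrite invr_sign [dfact_ratio n * _]mulrC mulrA /dfact_ratio mulrA.
Qed.

Lemma Ufun_Vfun z : Ufun n z = n`!%:R / 2%:R ^+ n' * Vfun z.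
Proof.
pose rs := [seq - (i.+1%:R : rat) | i <- iota 0 (2 * n)].
apply: (@polyfun_eq (2 * n - 1) (Ufun n) (fun z => n`!%:R / 2%:R ^+ n' * Vfun z) rs).
- exact: polyfun_Ufun.
- exact: (polyfunM (polyfun_const _) polyfun_Vfun).
- rewrite map_inj_uniq ?iota_uniq // => i j /oppr_inj /eqP; rewrite eqr_nat => /eqP []; lia.
- by rewrite size_map size_iota; lia.
have key i : (0 < i <= n)%N -> ((-1) ^+ i.+1 * (dfact (2 * n - 1))%:R + (dfact (2 * n))%:R) *
     poch (3%:R / 2%:R - i%:R) (2 * n - 1)%N = n`!%:R / 2%:R ^+ n' * Vfun (- i%:R).
  move=> /andP[i0 ilen]; have -> : i = (n - (n - i))%N by lia.
  set q := (n - i)%N; have qn : (q < n)%N by lia.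
  rewrite Vfun_eval //.
  have -> : (2 * n - 1)%N = n'.*2.+1 by lia.
  have -> : (2 * n)%N = n.*2 by lia.
  rewrite dfact_odd dfact_even.
  have -> : 3%:R / 2%:R - (n - q)%:R = q%:R + 2%:R^-1 - n'%:R :> rat.
    by rewrite natrB 1?ltnW //; field.
  have -> : (-1) ^+ (n - q).+1 = - (-1) ^+ (q + n) :> rat.
    by rewrite -signr_odd -[in RHS]signr_odd /= oddB ?oddD 1?ltnW //; case: (odd n); case: (odd q) => /=; ring.
  have t0 : 2%:R ^+ n' != 0 :> rat by rewrite expf_neq0.
  rewrite natrM natrX exprS (_ : 4%:R = 2%:R ^+ 2 :> rat); last by ring.
  rewrite -exprM mulnC exprM.
  move: (_ ^+ (q + n)) (poch _ _) (dfact_ratio n) (n`!%:R) (2%:R ^+ n') t0 => e p d f t t0.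
  by field.
move=> y /mapP[i]; rewrite mem_iota add0n => /andP[_ hi] ->.
case: (leqP i.+1 n) => h.
  by have [-> _] := @Ufun_eval n i.+1 h; rewrite key.
have hj : (0 < 2 * n - i <= n)%N by lia.
have [_] := @Ufun_eval n (2 * n - i) hj.
have -> : (2 * n + 1 - (2 * n - i) = i.+1)%N by lia.
move=> ->; rewrite key //; congr (_ * _); rewrite -Vfun_even; congr Vfun.
have -> : (2 * n - i)%:R = 2%:R * n%:R - i%:R :> rat by rewrite natrB ?natrM //; lia.
by ring.
Qed.

End Identity.

(** * Evaluation of R and ST *)

(** Duplication formula for the factorial; it converts the ratio of (2x + 2)! to (2x + 4n)! into the
    Pochhammer symbol of the cleared denominator. *)
Lemma fact_double u k : ((2 * (u + k))`!)%:R * u`!%:R =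
  ((2 * u)`!)%:R * (u + k)`!%:R * 4%:R ^+ k * poch (u%:R + 2%:R^-1) k :> rat.
Proof.
elim: k => [|k IH]; first by rewrite addn0 /poch big_ord0; ring.
have -> : (2 * (u + k.+1) = (2 * (u + k)).+2)%N by lia.
transitivity ((2 * (u + k)).+2%:R * (2 * (u + k)).+1%:R * ((2 * (u + k))`!%:R * u`!%:R) : rat).
  by rewrite !factS !natrM; ring.
rewrite IH addnS [(u + k).+1`!]factS natrM pochS exprS.
move: (poch _ _) (4%:R ^+ k) ((2 * u)`!%:R) ((u + k)`!%:R) => A B C D; by field.
Qed.

Lemma centre_ratio_inv_norm M n : (n <= M)%N -> centre_ratio M n = \sum_(k < n) inv_norm (2%:R * M%:R + 1) k * (1 - alt_sum k / alt_sum n).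
Proof.
move=> nM; apply: eq_bigr => k _.
by rewrite (@gram_norm_inv M k _).2 // (leq_trans (ltn_ord k)).
Qed.

(** The factor in front of U in [R] is exactly the reciprocal of the denominator cleared in [Vfun],
    together with the constant of [Ufun_Vfun]. *)
Lemma R_centre_ratio n x : (0 < n)%N -> R n x = centre_ratio (n + x) n.
Proof.
case: n => [//|n'] _; set n := n'.+1; set M := (n + x)%N.
have x0 := ler0n rat x; have n0 := ler0n rat n.
rewrite /R UfunE Ufun_Vfun centre_ratio_inv_norm ?leq_addr //.
have eN : width n' x%:R = 2%:R * M%:R + 1 by rewrite /width /M natrD -/n; ring.
have ey : 2%:R * M%:R + 1 = 2%:R * (M%:R + 2%:R^-1) :> rat by field.
have w0 : even_prod n' (width n' x%:R) != 0.
  rewrite /even_prod prodf_seq_neq0; apply/allP => i _ /=; rewrite eN ey mulf_neq0 ?odd_half_neq0 //.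
  by have i0 := ler0n rat i; have m0 := ler0n rat M; apply: lt0r_neq0; lra.
rewrite Vfun_inv_norm //; last first.
  by rewrite eN; have m0 := ler0n rat M; apply: lt0r_neq0; lra.
rewrite eN ey -(mulrA 2%:R (M%:R + _)) even_prod_poch -ey.
set S := \sum_(k < _) _; rewrite !mulrA -[RHS]mul1r; congr (_ * S).
have -> : M%:R + 2%:R^-1 - n'%:R = (x + 1)%:R + 2%:R^-1 :> rat.
  by rewrite /M /n !natrD -[n'.+1%:R]natr1; ring.
have := fact_double (x + 1) n'.*2.+1.
have -> : (2 * (x + 1) = 2 * x + 2)%N by lia.
have -> : (x + 1 + n'.*2.+1 = x + 2 * n)%N by rewrite /n; lia.
have -> : (2 * (x + 2 * n) = 2 * x + 4 * n)%N by lia.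
have -> : (3 * n - 2 = n' + n' + n' + 1)%N by rewrite /n; lia.
have f1 := fact_neq0 (x + 1); have f2 := fact_neq0 (2 * x + 4 * n); have f3 := fact_neq0 n.
have e4 : 4%:R ^+ n'.*2.+1 = 2%:R ^+ n' * 2%:R ^+ n' * 2%:R ^+ n' * 2%:R ^+ n' * 4%:R :> rat.
  by rewrite (_ : 4%:R = 2%:R ^+ 2 :> rat) -?exprM -?exprD; [congr (_ ^+ _); lia|ring].
have e4' : 4%:R ^+ n' = 2%:R ^+ n' * 2%:R ^+ n' :> rat.
  by rewrite (_ : 4%:R = 2%:R ^+ 2 :> rat) -?exprM -?exprD; [congr (_ ^+ _); lia|ring].
have t0 : 2%:R ^+ n' != 0 :> rat by rewrite expf_neq0.
rewrite e4 e4' natrX !exprD expr1.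
move: ((2 * x + 2)`!%:R) ((x + 2 * n)`!%:R) ((x + 1)`!%:R) ((2 * x + 4 * n)`!%:R) (n`!%:R) (poch _ _) (2%:R ^+ n') f1 f2 f3 t0.
move=> A B C D E p t f1 f2 f3 t0 e.
transitivity (A * B * (t * t * t * t * 4%:R) * p / (D * C)); first by field; rewrite f1 f2 f3 t0.
by rewrite -e divff // mulf_neq0.
Qed.

Lemma prod_ord_shift c k : \prod_(i < k) (i + c + 1)%:R = (c + k)`!%:R / c`!%:R :> rat.
Proof.
have f := fact_neq0 c.
elim: k => [|k IH]; first by rewrite big_ord0 addn0 divff.
rewrite big_ord_recr /= IH (addnS c k) factS natrM (_ : k + c + 1 = (c + k).+1)%N; last lia.
by rewrite mulrC mulrA.
Qed.

(** The first product of [ST] is the missing diagonal i = j of the second. *)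
Lemma STE a c : ST a c = \prod_(j < a) \prod_(i < j.+1) ((i + j + 1 + c)%:R / (i + j + 1)%:R).
Proof.
rewrite /ST !big_add1 /= !big_mkord -big_split /=; apply: eq_bigr => j _.
rewrite big_add1 /= big_mkord big_ord_recr /= mulrC; congr (_ * _).
  by apply: eq_bigr => i _; congr (_%:R / _%:R); lia.
by congr (_%:R / _%:R); lia.
Qed.

Lemma prod_tri (G : nat -> nat -> rat) a :
  \prod_(j < a.+2) \prod_(i < j.+1) G i j = (\prod_(j < a.+1) G 0 j) *
   (\prod_(j < a) \prod_(i < j.+1) G i.+1 j.+1) * \prod_(i < a.+2) G i a.+1.
Proof.
rewrite big_ord_recr /=; congr (_ * _).
under eq_bigr => j _ do rewrite big_ord_recl.
rewrite big_split /=; congr (_ * _).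
by rewrite big_ord_recl big_ord0 mul1r.
Qed.

(** At fixed M, raising n by 1 lowers x by 1, so (a, c + 2) becomes (a + 2, c). Removing the first
    row and the last column of the triangle of index pairs shifts i + j by 2, which matches the
    shift of c. *)
Lemma ST_step a c : ST a.+2 c = ST a (c + 2) *
   (\prod_(j < a.+1) (j + 1 + c)%:R * \prod_(i < a.+2) (i + a + 2 + c)%:R) /
   (((a + a.+1)`!%:R / a`!%:R) * ((a.+1 + a.+2)`!%:R / a.+1`!%:R)).
Proof.
rewrite !STE.
under eq_bigr => j _ do rewrite prodf_div; under [in RHS]eq_bigr => j _ do rewrite prodf_div.
rewrite !prodf_div (prod_tri (fun i j => (i + j + 1 + c)%:R)).
rewrite -!prod_ord_shift.
have e1 : \prod_(j < a) \prod_(i < j.+1) (i.+1 + j.+1 + 1 + c)%:R = \prod_(j < a) \prod_(i < j.+1) (i + j + 1 + (c + 2))%:R :> rat.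
  by apply: eq_bigr => j _; apply: eq_bigr => i _; congr (_%:R); lia.
have e2 : \prod_(i < a.+2) (i + a.+1 + 1 + c)%:R = \prod_(i < a.+2) (i + a + 2 + c)%:R :> rat.
  by apply: eq_bigr => i _; congr (_%:R); lia.
have e3 : \prod_(j < a.+1) (0 + j + 1 + c)%:R = \prod_(j < a.+1) (j + 1 + c)%:R :> rat by [].
have e4 : \prod_(j < a.+2) \prod_(i < j.+1) (i + j + 1)%:R = (\prod_(j < a) \prod_(i < j.+1) (i + j + 1)%:R) *
   \prod_(i < a.+1) (i + a + 1)%:R * \prod_(i < a.+2) (i + a.+1 + 1)%:R :> rat.
  by rewrite (big_ord_recr a.+1) (big_ord_recr a).
by rewrite e1 e2 e3 e4 !invfM; ring.
Qed.

(** * Comparison of the determinant with the product formula *)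

Section STdet.
Variable M : nat.
Notation m := (M%:R : rat).
Notation Nr := (2%:R * m + 1).

(** This and [ST_factor] are the ratios between n + 1 and n of the two sides of [det_ST]. *)
Definition det_factor j := gram_norm M j / ((j%:R + 2%:R^-1) * (gram_coef M j j * gram_coef M j.+1 j.+1)).
Definition ST_factor n : rat := Nr * \prod_(i < 2 * n + 1) ((Nr - (i%:R + 1)) * (Nr + (i%:R + 1))) *
  (((2 * n)`!%:R * (2 * n + 1)`!%:R) ^+ 2 / ((4 * n + 1)`!%:R * (4 * n + 3)`!%:R)).

Lemma gram_coef_diag j : (j < M)%N -> gram_coef M j.+1 j.+1 = gram_coef M j j *
  ((4%:R * j%:R + 1) * (4%:R * j%:R + 3%:R) / ((2%:R * j%:R + 1) ^+ 2 * (m - j%:R) * (m + j%:R + 1))).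
Proof.
move=> h; have j0 := ler0n rat j; have h' := natr_ltM h.
have p0 := psi_neq0 (ltnW h).
have p1 : j%:R - m != 0 by apply: ltr0_neq0; lra.
rewrite /gram_coef gram_numSS psiS_M -[j.+1%:R]natr1; move: (gram_num j j) (psi _ _) p0 => A B p0.
by field; nonzero.
Qed.

Lemma gram_norm_step j : (j.+1 < M)%N -> gram_norm M j.+1 = gram_norm M j *
  (((4%:R * j%:R + 1) * (j%:R + 1) ^+ 2 * (2%:R * m - 1 - 2%:R * j%:R) *
    (2%:R * m + 3%:R + 2%:R * j%:R)) /
   ((4%:R * j%:R + 5%:R) * (2%:R * j%:R + 1) ^+ 2 * (m - j%:R) * (m + j%:R + 1))).
Proof.
move=> h; have [n1 e1] := gram_norm_inv h; have [n0 e0] := gram_norm_inv (ltnW h).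
have := @inv_norm_next M j; rewrite -e1 -e0 => /(_ (leq_trans (leqnSn _) (ltnW h))) e.
by rewrite -[LHS]invrK e invfM invrK invf_div.
Qed.

Lemma ST_det_factor n : (n < M)%N -> ST_factor n = det_factor n.
Proof.
elim: n => [|n IH] h.
  rewrite /ST_factor /det_factor gram_norm0 gram_coef_diag // gram_coef0 big_ord1 /=.
  have m1 := natr_ltM h; rewrite /= in m1.
  by rewrite !factS fact0; field; nonzero.
have n0 := ler0n rat n; have m1 := natr_ltM h; rewrite -natr1 in m1.
have -> : det_factor n.+1 = det_factor n * ((2%:R * m - 1 - 2%:R * n%:R) * (2%:R * m + 3%:R + 2%:R * n%:R) * (m - n%:R - 1) * (m + n%:R + 2%:R)
     * (n%:R + 1) ^+ 2 * (2%:R * n%:R + 1) * (2%:R * n%:R + 3%:R) /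
   ((4%:R * n%:R + 3%:R) * (4%:R * n%:R + 5%:R) ^+ 2 * (4%:R * n%:R + 7%:R) )).
  rewrite /det_factor gram_norm_step // [gram_coef M n.+2 n.+2]gram_coef_diag // [gram_coef M n.+1 n.+1]gram_coef_diag; last exact: ltnW.
  have a0 := gram_coef_neq0 (leq_trans (leqnSn _) (ltnW h)).
  rewrite -[n.+1%:R]natr1.
  move: (gram_coef M n n) a0 (gram_norm M n) => A a0 B.
  clear IH; field; nonzero.
rewrite -IH; last exact: ltnW.
rewrite /ST_factor (_ : (2 * n.+1 + 1 = (2 * n + 1).+2)%N); last by lia.
rewrite !big_ord_recr /= (_ : (2 * n.+1 = (2 * n + 1).+1)%N); last by lia.
rewrite (_ : (4 * n.+1 + 1 = (4 * n + 3).+2)%N); last by lia.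
rewrite (_ : (4 * n.+1 + 3 = (4 * n + 3).+4)%N); last by lia.
have -> : (2 * n + 1).+2`! = ((2 * n + 1).+2 * ((2 * n + 1).+1 * (2 * n + 1)`!))%N by rewrite !factS.
have -> : (2 * n + 1).+1`! = ((2 * n + 1).+1 * ((2 * n + 1) * (2 * n)`!))%N by rewrite factS addn1 factS.
have -> : (4 * n + 3).+4`! = ((4 * n + 3).+4 * ((4 * n + 3).+3 * ((4 * n + 3).+2 * ((4 * n + 3).+1 * (4 * n + 3)`!))))%N.
  by rewrite !factS.
have -> : (4 * n + 3).+2`! = ((4 * n + 5) * ((4 * n + 4) * ((4 * n + 3) * ((4 * n + 2) * (4 * n + 1)`!))))%N.
  rewrite !factS (_ : (4 * n + 3 = (4 * n + 1).+2)%N); last by lia.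
  by rewrite !factS; congr (_ * (_ * (_ * (_ * _))))%N; lia.
have f1 := fact_neq0 (4 * n + 3); have f2 := fact_neq0 (4 * n + 1).
rewrite !natrM.
move: (\prod_(i < _) _) ((4 * n + 3)`!%:R) f1 ((4 * n + 1)`!%:R) f2 ((2 * n)`!%:R) ((2 * n + 1)`!%:R) => P A A0 B B0 C D.
clear IH.
set Q := _ ^+ 2 / (_ * _).
have -> : Q = (C * D) ^+ 2 / (B * A) * ((2%:R * n%:R + 1) * (n%:R + 1) ^+ 2 * (2%:R * n%:R + 3%:R) /
   (4%:R * (4%:R * n%:R + 3%:R) * (4%:R * n%:R + 5%:R) ^+ 2 * (4%:R * n%:R + 7%:R))).
  rewrite /Q; field; nonzero.
field; nonzero.
Qed.

Theorem det_ST n : (n <= M)%N ->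
  \det (skew_mx M n) = ST (2 * n) (2 * (M - n) + 1) * \prod_(k < n.*2) k`!%:R.
Proof.
elim: n => [|n IH] nM.
  by rewrite STE /= !big_ord0 det_mx00 mulr1.
have hM : (n < M)%N by [].
have e : \det (skew_mx M n.+1) = \det (skew_mx M n) * det_factor n.
  rewrite !det_skew_mx !det_gram_mx //; last exact: ltnW.
  rewrite !big_ord_recr /= /det_factor.
  have p0 : \prod_(j < n) j.+1%:R != 0 :> rat by apply/prodf_neq0 => j _; apply: natS_neq0.
  have j1 := natS_neq0 n; have n0 := ler0n rat n.
  have a0 := gram_coef_neq0 (ltnW nM); have a1 := gram_coef_neq0 nM.
  move: (\prod_(j < n) j.+1%:R) p0 (\prod_(j < n) _) (gram_coef _ _ _) a0 (gram_coef _ _ _) a1 (gram_norm _ _) => P p0 Q A A0 B B0 C.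
  rewrite -natr1 in j1 *; clear IH; field; nonzero.
rewrite e IH 1?ltnW // -ST_det_factor // /ST_factor.
rewrite doubleS !big_ord_recr /=.
have -> : (2 * n.+1 = (2 * n).+2)%N by lia.
rewrite ST_step (_ : (2 * (M - n.+1) + 1 + 2 = 2 * (M - n) + 1)%N); last by lia.
set a := (2 * n)%N.
have -> : \prod_(j < a.+1) (j + 1 + (2 * (M - n.+1) + 1))%:R = \prod_(j < a.+1) (Nr - (j%:R + 1)) :> rat.
  rewrite (reindex_inj rev_ord_inj); apply: eq_bigr => j _ /=.
  have jl := ltn_ord j; rewrite -[Nr](_ : (2 * M + 1)%:R = _); last by ring.
  by rewrite -[_ + 1 in RHS](natrD _ j 1) -natrB; [congr (_%:R); rewrite /a in jl *; lia|rewrite /a in jl *; lia].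
have -> : \prod_(i < a.+2) (i + a + 2 + (2 * (M - n.+1) + 1))%:R = Nr * \prod_(i < a.+1) (Nr + (i%:R + 1)) :> rat.
  rewrite big_ord_recl /=; congr (_ * _).
    by rewrite -[RHS](_ : (2 * M + 1)%:R = _); [congr (_%:R); rewrite /a; lia|ring].
  apply: eq_bigr => j _ /=; rewrite -[Nr](_ : (2 * M + 1)%:R = _); last by ring.
  by rewrite -[_ + 1 in RHS](natrD _ j 1) -natrD; congr (_%:R); rewrite /a /bump /=; lia.
have -> : (2 * n + 1 = a.+1)%N by rewrite /a; lia.
have -> : (4 * n + 1 = a + a.+1)%N by rewrite /a; lia.
have -> : (4 * n + 3 = a.+1 + a.+2)%N by rewrite /a; lia.
have -> : n.*2 = a by rewrite /a; lia.
rewrite big_split /=.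
have f1 := fact_neq0 a; have f2 := fact_neq0 (a + a.+1).
have f3 := fact_neq0 a.+1; have f4 := fact_neq0 (a.+1 + a.+2).
move: (a`!%:R) f1 ((a + a.+1)`!%:R) f2 (a.+1`!%:R) f3 ((a.+1 + a.+2)`!%:R) f4 => A A0 B B0 C C0 D D0.
move: (ST _ _) (\prod_(k < a) _) (\prod_(i < a.+1) _) (\prod_(i < a.+1) _) => S F P Q.
by field; rewrite A0 B0 C0 D0.
Qed.
End STdet.

(** * Centered tilings *)

Section Centered.
Variables (n M : nat).
Hypothesis n_gt0 : (0 < n)%N.
Hypothesis nM : (n <= M)%N.
Notation m := (M%:R : rat).
Notation N := (M.*2.+1).
Let i0 := Ordinal n_gt0.

Definition skew_mx0 := \matrix_(i < n, j < n)
  skew_form N (fun p => (p != M)%:R * basis M i.*2 p) (fun p => (p != M)%:R * basis M j.*2.+1 p).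

Lemma node_M : node M M = 0. Proof. by rewrite /node subrr. Qed.

Lemma basis_M k : (0 < k)%N -> basis M k M = 0.
Proof.
case: k => [//|k] _; have := odd_double_half k; case: (odd k) => /= <-.
  by rewrite add1n -doubleS basis_even node_M phi0 mulr0.
by rewrite add0n basis_odd node_M /gam mul0r.
Qed.

Lemma mask_basis k p : (0 < k)%N -> (p != M)%:R * basis M k p = basis M k p.
Proof. by move=> k0; case: eqP => [->|_]; rewrite ?mul1r // basis_M // mulr0. Qed.

Lemma skew_mx0_row (i j : 'I_n) : i != i0 -> skew_mx0 i j = skew_mx M n i j.
Proof.
move=> ii; rewrite !mxE; apply: eq_skew_form => p; rewrite mask_basis //.
by rewrite double_gt0 lt0n.
Qed.

(** The deletion subtracts the pairing with the indicator of the middle. Since phi j.+1 vanishes at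
    0, only the boundary value of psi remains. *)
Lemma skew_mx0_row0 (j : 'I_n) : skew_mx M n i0 j - skew_mx0 i0 j = - ((-1) ^+ j / j.+1%:R * psi j.+1 m).
Proof.
rewrite !mxE.
have c0 p : basis M 0 p = 1 by rewrite /basis /basis_roots big_nil.
have -> : skew_form N (fun p => (p != M)%:R * basis M i0.*2 p) (fun p => (p != M)%:R * basis M j.*2.+1 p) =
   skew_form N (basis M i0.*2) (basis M j.*2.+1) - skew_form N (fun p => (p == M)%:R) (basis M j.*2.+1).
  rewrite -skew_formBl; apply: eq_skew_form => p; last by rewrite mask_basis.
  by rewrite /= c0; case: eqP => _; rewrite ?mul0r ?subrr ?subr0 ?mul1r.
rewrite opprB addrCA subrr addr0 skew_form_basis -mulrN; congr (_ * _).
have MN : (M < N)%N by lia.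
rewrite (bigD1 (Ordinal MN)) //= eqxx mul1r node_M phi0 sub0r big1 ?addr0 //.
by move=> p; rewrite -val_eqE /= => /negbTE->; rewrite mul0r.
Qed.

(** The two matrices share their cofactors along row 0. By Cramer's rule these are the determinant
    times the solution of [centre_ratio_spec], rescaled by the signs and factors j + 1 of
    [skew_mxE]. *)
Lemma det_diff : \det (skew_mx M n) - \det skew_mx0 = \det (skew_mx M n) * centre_ratio M n.
Proof.
have [x hx hR] := @centre_ratio_spec M n nM n_gt0 (fun k kn => (gram_norm_inv (leq_trans kn nM)).1).
rewrite (expand_det_row _ i0) (expand_det_row skew_mx0 i0).
have cofE j : cofactor skew_mx0 i0 j = cofactor (skew_mx M n) i0 j.
  rewrite /cofactor; congr (_ * \det _); apply/matrixP => k l; rewrite [LHS]mxE [LHS]mxE skew_mx0_row.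
    by rewrite [RHS]mxE [RHS]mxE.
  by rewrite eq_sym neq_lift.
under [X in _ - X]eq_bigr => j _ do rewrite cofE.
rewrite -sumrB.
pose ga := \col_(j < n) ((-1) ^+ j * j.+1%:R * x j.+1).
have e0 : skew_mx M n *m ga = \col_(i < n) (i == 0 :> nat)%:R.
  apply/matrixP => i z; rewrite !mxE.
  transitivity ((-1) ^+ i * \sum_(j < n) gram_mx M n i j * x j.+1).
    rewrite mulr_sumr; apply: eq_bigr => j _; rewrite skew_mxE [ga j z]mxE.
    have j1 := natS_neq0 j; have := sqrr_sign rat j; rewrite expr2.
    move: ((-1) ^+ j) (j.+1%:R) j1 (gram_mx M n i j) ((-1) ^+ i) (x j.+1) => e d d0 B s y ee.
    by transitivity (s * (B * y) * (e * e)); [field|rewrite ee mulr1].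
  by rewrite hx; case: (i : nat) => [|k]; rewrite ?mulr0 // mulr1.
have e1 j : \det (skew_mx M n) * ga j 0 = cofactor (skew_mx M n) i0 j.
  have := congr1 (fun B => (\adj (skew_mx M n) *m B) j 0) e0.
  rewrite mulmxA mul_adj_mx mul_scalar_mx mxE => ->.
  rewrite !mxE (bigD1 i0) //= !mxE eqxx mulr1 big1 ?addr0 // => i.
  by rewrite -val_eqE /= mxE => /negbTE ->; rewrite mulr0.
rewrite -[centre_ratio M n]opprK -hR -sumrN mulr_sumr -(expand_det_row _ i0); apply: eq_bigr => j _.
rewrite -mulrBl skew_mx0_row0 -e1 mxE.
have j1 := natS_neq0 j; have := sqrr_sign rat j; rewrite expr2.
move: ((-1) ^+ j) (j.+1%:R) j1 (\det _) (psi _ _) (x j.+1) => e d d0 D s y ee.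
by transitivity (D * - (y * s) * (e * e)); [field|rewrite ee mulr1].
Qed.

(** Centered patterns are all patterns minus those that avoid the middle position; both counts are
    determinants. *)
Theorem centered_sum : (\sum_(S : bits N | bit_at S M) pattern_count n.*2 S)%:R =
  centre_ratio M n * ST (2 * n) (2 * (M - n) + 1) :> rat.
Proof.
have F0 : \prod_(k < n.*2) k`!%:R != 0 :> rat by apply/prodf_neq0 => k _; apply: fact_neq0.
have MN : (M < N)%N by lia.
apply: (mulIf F0); rewrite -mulrA -det_ST // mulrC -[RHS]mulrC -det_diff.
have <- := @sum_pattern_count_basis M n nM (fun p => p != M); last first.
  move=> p hp /=; congr (~~ _); apply/eqP/eqP; lia.
have := @sum_pattern_count_basis M n nM predT (fun _ _ => erefl).
have -> : \matrix_(i < n, j < n) skew_form N (fun p => (predT p)%:R * basis M i.*2 p) (fun p => (predT p)%:R * basis M j.*2.+1 p) = skew_mx M n.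
  by apply/matrixP => i j; rewrite !mxE; apply: eq_skew_form => p; rewrite mul1r.
move=> <-; rewrite -mulrBl mulrC; congr (_ * _).
apply/eqP; rewrite eq_sym subr_eq -natrD; apply/eqP; congr (_%:R).
rewrite (eq_bigl predT) => [|S]; last by apply/forallP => p; rewrite implybT.
rewrite (bigID (fun S : bits N => bit_at S M)) /=; congr (_ + _)%N; apply: eq_bigl => S.
have -> : bit_at S M = S (Ordinal MN) by rewrite -bit_atE.
apply/idP/forallP => [h p|/(_ (Ordinal MN))]; last by rewrite eqxx implybF.
by apply/implyP => Sp; apply: contraNneq h => e; have -> : Ordinal MN = p by apply: val_inj.
Qed.

End Centered.

Theorem theorem3 (n x : nat) : (1 <= n)%N ->
  (num_cvs_tilings (2 * n) (2 * x + 1))%:R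
    = R n x * ST (2 * n) (2 * x + 1) :> rat.
Proof.
move=> n_gt0; rewrite num_cvs_tilingsE; [|lia|lia].
have := centered_sum n_gt0 (leq_addr x n); rewrite -R_centre_ratio // addKn.
have -> : (2 * n + (2 * x + 1) = (n + x).*2.+1)%N by lia.
have -> : ((n + x).*2.+1./2 = n + x)%N by lia.
by rewrite -[n.*2]mul2n.
Qed.
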